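(* Let $y\in W$ satisfy the Extended Hamilton's Principle for the cracked shallow arch, i.e. for all $0\le t_1<t_2\le T$, all $v\in V$ and all smooth $\zeta:[t_1,t_2]\to\mathbb{R}$ with $\zeta(t_1)=\zeta(t_2)=0$, $I'(y,\zeta v)=0$. Then for almost every $t\in[0,T]$, $$\ddot y+\mathcal{A}y-\frac1\pi\Big(\beta+\frac12|y'|_H^2\Big)\Big(y''+\sum_{i=1}^m J[y'](x_i)\,\delta(x-x_i)\Big)+c_d\,\dot y=p\quad\text{in }V'.$$ If in addition $y(\cdot,t)\in D(\mathcal{A})$ for almost every $t\in[0,T]$, then for almost every $t\in[0,T]$, $$\ddot y+y''''-\frac1\pi\Big(\beta+\frac12\int_0^\pi|y'(x,t)|^2\,dx\Big)\Big(y''+\sum_{i=1}^m\theta_i\,y''(x_i,t)\,\delta(x-x_i)\Big)+c_d\,\dot y=p\quad\text{in }V'.$$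
   Context: Fix $T>0$, an integer $m\ge 0$, crack positions $0=x_0<x_1<\dots<x_m<x_{m+1}=\pi$, flexibilities $\theta_i>0$ ($i=1,\dots,m$), a damping coefficient $c_d\ge 0$, a constant $\beta\in\mathbb{R}$ and a load $p\in L^2(0,T;H)$. Put $l_i=(x_{i-1},x_i)$, $i=1,\dots,m+1$, and for a function $u$ with one-sided limits put $J[u](x)=u(x^+)-u(x^-)$. Spaces: $H=\bigoplus_{i=1}^{m+1}L^2(l_i)$ with $(u,v)_H=\sum_{i=1}^{m+1}(u,v)_i$, where $(\cdot,\cdot)_i$ is the $L^2(l_i)$ inner product, and $|u|_H^2=(u,u)_H$. $H_0^1=H_0^1(0,\pi)$ with $(u,v)_1=(u',v')_H$. $$V=\Big\{u\in\bigoplus_{i=1}^{m+1}H^2(l_i): u(0)=u(\pi)=0,\ J[u](x_i)=0,\ i=1,\dots,m\Big\},$$ a Hilbert space with inner product $((u,v))_V=\sum_{i=1}^{m+1}(u'',v'')_i+\sum_{i=1}^m J[u'](x_i)J[v'](x_i)$. Throughout, $u''$ and $u''''$ denote derivatives taken separately on each $l_i$, so they are elements of $H$ when square integrable on each $l_i$. With $H$ identified with $H'$, $V\subset H_0^1\subset H\subset(H_0^1)'\subset V'$ with continuous dense embeddings; the pairing $\langle\cdot,\cdot\rangle_V$ between $V'$ and $V$ extends $(\cdot,\cdot)_H$. For $a\in[0,\pi]$, $\delta(x-a)\in(H_0^1)'$ is the functional $v\mapsto v(a)$. $$W=\{y: y\in L^2(0,T;V),\ \dot y\in L^2(0,T;H),\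 \ddot y\in L^2(0,T;V')\},$$ dots denoting distributional time derivatives. Operator $\mathcal{A}:V\to V'$: $\langle\mathcal{A}u,v\rangle_V=\sum_{i=1}^{m+1}(u'',v'')_i+\sum_{i=1}^m\frac1{\theta_i}J[u'](x_i)J[v'](x_i)$ for $u,v\in V$, and $D(\mathcal{A})=\{v\in V:\mathcal{A}v\in H\}$. Known fact (from earlier work): if $u\in D(\mathcal{A})$ then $u|_{l_i}\in H^4(l_i)$ and $\mathcal{A}u=u''''$ a.e. on $l_i$ for each $i=1,\dots,m+1$, $u''(0)=u''(\pi)=0$, and $J[u''](x_i)=J[u'''](x_i)=0$, $J[u'](x_i)=\theta_iu''(x_i^+)$ for $i=1,\dots,m$; thus $u''(x_i)$ denotes the common value $u''(x_i^+)=u''(x_i^-)$. Energies and work (nondimensional): $T_k(y)=\frac12|\dot y|_H^2$; $U_b(y)=\frac12\big(|y''|_H^2+\sum_{i=1}^m\frac1{\theta_i}|J[y'](x_i)|^2\big)$ on $V$; $U_a(y)=\frac1{2\pi}\big(\beta+\frac12|y'|_H^2\big)^2$ on $H_0^1$; $\mathcal{W}_{ext}(y)=(p,y)_H$. First variation of the action on $[t_1,t_2]$: for $\eta(x,t)=\zeta(t)v(x)$, $$I'(y,\eta)=\lim_{\alpha\to0+}\frac1\alpha\int_{t_1}^{t_2}\Big[(T_k-U_b-U_a+\mathcal{W}_{ext})(y+\alpha\eta)-(T_k-U_b-U_a+\mathcal{W}_{ext})(y)\Big]dt\;-\;c_d\int_{t_1}^{t_2}(\dot y(t),v)_H\,\zeta(t)\,dt,$$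 the last term being the (non-variationally defined) contribution of the viscous damping force $-c_d\dot y$. *)

(* Defs.v *)
From HB Require Import structures.
From mathcomp Require Import all_boot all_order all_algebra.
From mathcomp Require Import all_classical all_reals all_analysis.

Set Implicit Arguments.
Unset Strict Implicit.
Unset Printing Implicit Defensive.
Import Order.TTheory GRing.Theory Num.Theory.
Import numFieldNormedType.Exports.

Local Open Scope classical_set_scope.
Local Open Scope ring_scope.

Local Notation leb R := (@lebesgue_measure R) (only parsing).

(* Elements of L^2 and Sobolev spaces are represented by functions R -> R, of
   which only the a.e. class on the relevant open intervals matters: weak
   derivatives and traces below are invariant under a.e. modification.        *)
Section Sobolev.
Context {R : realType}.
Implicit Types (u v g phi : R -> R) (a b : R).

Definition smooth phi := forall n s, derivable (derive1n n phi) s 1.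

(* C_c^oo(a, b) *)
Definition test_function a b phi :=
  smooth phi /\
  exists K : set R, [/\ compact K, K `<=` `]a, b[ & forall s, ~ K s -> phi s = 0].

Definition in_L2 (I : set R) u := u \_ I \in Lfun (leb R) 2%:E.

Definition weak_derivative a b u g := forall phi, test_function a b phi ->
  \int[leb R]_(s in `]a, b[) (u s * derive1 phi s) =
  - \int[leb R]_(s in `]a, b[) (g s * phi s).

(* One-sided limits u(a^+), u(a^-) of the class of u: the limit is that of any
   function equal to u a.e. near a on the relevant side.                      *)
Definition right_trace u a : R := xget 0
  [set l | exists w : R -> R,
    (exists2 d, 0 < d & w = u %[ae (leb R) in `]a, (a + d)[%classic]) /\
    w @ a^'+ --> l].

Definition left_trace u a : R := xget 0
  [set l | exists w : R -> R,
    (exists2 d, 0 < d & w = u %[ae (leb R) in `](a - d), a[%classic]) /\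
    w @ a^'- --> l].

Definition jump u a : R := right_trace u a - left_trace u a.

(* delta(x - a): evaluation at a of the representative continuous on [0, pi]. *)
Definition delta a v : R := xget 0
  [set l | exists w : R -> R,
    [/\ {within `[0, pi], continuous w}, w = v %[ae (leb R) in `[0, pi]%classic]
      & w a = l]].

End Sobolev.

(* Functions of time with values in a normed space, given as a subspace S of
   an ambient lmodType E together with a norm N, meaningful on S only.        *)
Section Bochner.
Context {R : realType} {E : lmodType R}.
Variables (S : set E) (N : E -> R).
Implicit Types (f g : R -> E) (D : set R).

Record simple_function := SimpleFunction {
  sf_size : nat ;
  sf_set : 'I_sf_size -> set R ;
  sf_val : 'I_sf_size -> E ;
  sf_measurable : forall k, measurable (sf_set k) ;
  sf_in : forall k, S (sf_val k) }.

Definition sf_eval (h : simple_function) (t : R) : E :=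
  \sum_k \1_(sf_set (s := h) k) t *: sf_val (s := h) k.

Definition sf_integral D (h : simple_function) : E :=
  \sum_k fine (leb R (sf_set (s := h) k `&` D)) *: sf_val (s := h) k.

Definition strongly_measurable D f := exists h : nat -> simple_function,
  \forall t \ae (leb R), D t -> N (sf_eval (h n) t - f t) @[n --> \oo] --> 0.

Definition is_bochner_integral D f (z : E) :=
  S z /\ exists h : nat -> simple_function,
  [/\ \forall t \ae (leb R), D t -> N (sf_eval (h n) t - f t) @[n --> \oo] --> 0,
      (\int[leb R]_(t in D) (N (sf_eval (h n) t - f t))%:E)%E @[n --> \oo] --> 0%E
    & N (sf_integral D (h n) - z) @[n --> \oo] --> 0].

(* f \in L^2(0, T; S) *)
Definition bochner_L2 (T : R) f :=
  [/\ \forall t \ae (leb R), t \in `]0, T[ -> S (f t),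
      strongly_measurable `]0, T[ f
    & (\int[leb R]_(t in `]0%R, T[) (N (f t) ^+ 2)%:E < +oo)%E].

(* g is the derivative of f in the sense of S-valued distributions on (0, T). *)
Definition time_derivative (T : R) f g := forall phi, test_function 0 T phi ->
  exists2 z : E,
    is_bochner_integral `]0, T[ (fun t => derive1 phi t *: f t) z &
    is_bochner_integral `]0, T[ (fun t => phi t *: g t) (- z).

End Bochner.

(* The arch [0, pi] with m cracks at x 1 < ... < x m, where x 0 = 0 and
   x m.+1 = pi; the values of x beyond m.+1 play no role.                     *)
Section Arch.
Context {R : realType}.
Variables (m : nat) (x : nat -> R).
Implicit Types (u v w : R -> R) (F G : (R -> R) -> R).

Definition piece (i : nat) : set R := `]x i.-1, x i[.

Definition in_H u := forall i, (1 <= i <= m.+1)%N -> in_L2 (piece i) u.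

Definition inner_H u v : R :=
  \sum_(1 <= i < m.+2) \int[leb R]_(s in piece i) (u s * v s).

Definition norm_H u : R := Num.sqrt (inner_H u u).

Definition is_pw_deriv u g :=
  in_H g /\
  forall i, (1 <= i <= m.+1)%N -> weak_derivative (x i.-1) (x i) u g.

(* u', taken separately on each piece, hence without Dirac masses at x i. *)
Definition pw_deriv u : R -> R := xget 0 [set g | is_pw_deriv u g].

Definition in_H2 u :=
  in_H u /\ exists u1, is_pw_deriv u u1 /\ exists u2, is_pw_deriv u1 u2.

Definition in_V u :=
  [/\ in_H2 u, right_trace u 0 = 0, left_trace u pi = 0
    & forall i, (1 <= i <= m)%N -> jump u (x i) = 0].

Definition inner_V u v : R :=
  inner_H (pw_deriv (pw_deriv u)) (pw_deriv (pw_deriv v)) +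
  \sum_(1 <= i < m.+1) jump (pw_deriv u) (x i) * jump (pw_deriv v) (x i).

Definition norm_V u : R := Num.sqrt (inner_V u u).

(* V': functionals defined on all of R -> R, of which only the restriction to
   V is meaningful.                                                           *)
Definition in_V' F :=
  (forall (a : R) u v, in_V u -> in_V v -> F (a *: u + v) = a * F u + F v) /\
  exists C : R, forall v, in_V v -> `|F v| <= C * norm_V v.

Definition norm_V' F : R :=
  sup [set `|F v| | v in [set v | in_V v /\ norm_V v <= 1]].

Definition eq_V' F G := forall v, in_V v -> F v = G v.

(* The embedding of H into V'. *)
Definition embed_H u : (R -> R) -> R := fun v => inner_H u v.

(* y \in W, with time derivatives yt and ytt. *)
Definition in_W (T : R) (y yt : R -> R -> R) (ytt : R -> (R -> R) -> R) :=
  [/\ bochner_L2 in_V norm_V T y,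
      bochner_L2 in_H norm_H T yt,
      bochner_L2 in_V' norm_V' T ytt,
      time_derivative in_H norm_H T y yt
    & time_derivative in_V' norm_V' T (fun t => embed_H (yt t)) ytt].

Variable theta : nat -> R.

Definition opA u : (R -> R) -> R := fun v =>
  inner_H (pw_deriv (pw_deriv u)) (pw_deriv (pw_deriv v)) +
  \sum_(1 <= i < m.+1)
    (theta i)^-1 * jump (pw_deriv u) (x i) * jump (pw_deriv v) (x i).

Definition in_DA u := in_V u /\ exists2 f, in_H f & eq_V' (opA u) (embed_H f).

Definition kinetic_energy w : R := 2^-1 * norm_H w ^+ 2.

Definition bending_energy u : R :=
  2^-1 * (norm_H (pw_deriv (pw_deriv u)) ^+ 2 +
          \sum_(1 <= i < m.+1) (theta i)^-1 * `|jump (pw_deriv u) (x i)| ^+ 2).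

Definition axial_energy (beta : R) u : R :=
  (2 * pi)^-1 * (beta + 2^-1 * norm_H (pw_deriv u) ^+ 2) ^+ 2.

Definition external_work (q : R -> R) u : R := inner_H q u.

(* T_k - U_b - U_a + W_ext at position u and velocity w, under the load q. *)
Definition lagrangian (beta : R) (q u w : R -> R) : R :=
  kinetic_energy w - bending_energy u - axial_energy beta u +
  external_work q u.

(* I'(y, eta) = l on [t1, t2] for eta = zeta v, whose time derivative is
   zeta' v; the limit is part of the assertion.                               *)
Definition is_first_variation (beta cd : R) (p y yt : R -> R -> R)
    (t1 t2 : R) (zeta : R -> R) (v : R -> R) (l : R) :=
  alpha^-1 * \int[leb R]_(t in `[t1, t2])
      (lagrangian beta (p t) (y t + (alpha * zeta t) *: v)
                             (yt t + (alpha * derive1 zeta t) *: v) -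
       lagrangian beta (p t) (y t) (yt t))
    - cd * \int[leb R]_(t in `[t1, t2]) (inner_H (yt t) v * zeta t)
  @[alpha --> 0^'+] --> l.

Definition extended_hamilton (T beta cd : R) (p y yt : R -> R -> R) :=
  forall (t1 t2 : R) (zeta v : R -> R),
    0 <= t1 -> t1 < t2 -> t2 <= T -> in_V v ->
    smooth zeta -> zeta t1 = 0 -> zeta t2 = 0 ->
    is_first_variation beta cd p y yt t1 t2 zeta v 0.

End Arch.

(* Main.v *)
Require Import Defs.
From HB Require Import structures.
From mathcomp Require Import all_boot all_order all_algebra.
From mathcomp Require Import all_classical all_reals all_analysis.
From mathcomp Require Import measurable_realfun ring lra.

Set Implicit Arguments.
Unset Strict Implicit.
Unset Printing Implicit Defensive.
Import Order.TTheory GRing.Theory Num.Theory.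
Import numFieldNormedType.Exports.
Local Open Scope classical_set_scope.
Local Open Scope ring_scope.

(** Expanded in alpha, the difference of the Lagrangians at y + alpha zeta v and
    at y is a polynomial without constant term, so the first variation is its
    linear coefficient, integrated in time, minus the damping term. Once the
    coefficients are known to be integrable, the fundamental lemma of the
    calculus of variations and the weak form of the time derivative of yt give,
    for every v in V, the equation tested against v for almost every t. Two
    points need an argument.

    Integrability. The axial force times (y', v') has cubic growth in y',
    whereas y is only square integrable in time with values in V. Since y and
    yt are square integrable in time with values in H, y is bounded in H
    ([y_bounded]), and an interpolation inequality bounds the cube of the H
    norm of y' by a quadratic polynomial in the V norm of y
    ([interpolation]). The measurability of the coefficients comes from simple
    functions ([strongly_measurable_ae]).

    The exceptional null set depends on v. The simple functions that
    approximate y, yt, ytt and p have countably many values; each choice of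
    such values defines one functional on V, and countably many v almost attain
    the norms of these functionals. If the equation holds at t for those v, it
    holds at t for all v ([vanish_ae_uniformly], [equation_ae]).

    The distribution y'' + sum J[y'](x_i) delta(x - x_i) is the functional
    v |-> - (y', v')_H ([axial_pairing]): an element of V is the primitive of
    its piecewise derivative, and integration by parts on the pieces produces
    the jumps. For y(t) in D(A), test functions supported in one piece show
    that y'''' = A y ([fourth_derivative]), and a polynomial on the piece to the
    right of x_i yields J[y'](x_i) = theta_i y''(x_i^+) ([jump_condition]);
    this turns the first equation into the second. *)

(** * Almost everywhere equality and Lebesgue integrals *)

Section AlmostEverywhere.
Context {R : realType}.
Local Notation mu := (@lebesgue_measure R).
Implicit Types (D E : set R) (f g h : R -> R).

Import HBNNSimple.

(** Declared as an instance, so that filterS and near apply to properties that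
    hold Lebesgue almost everywhere. *)
Lemma ae_lebesgue_filter : Filter (nbhs (almost_everywhere mu)).
Proof. exact: ae_filter_ringOfSetsType. Qed.
#[local] Existing Instance ae_lebesgue_filter.

(** A simple function below f, set to 0 on the null set where f > g, lies below
    g and has the same integral. *)
Lemma ge0_le_integral_ae (f g : R -> \bar R) :
  (forall x, 0 <= f x)%E -> (forall x, 0 <= g x)%E ->
  {ae mu, forall x, (f x <= g x)%E} -> (\int[mu]_x f x <= \int[mu]_x g x)%E.
Proof.
move=> f0 g0 [N [mN N0 fgN]].
rewrite !ge0_integralTE//.
apply: ge_ereal_sup => _ [h hf <-].
have mCN : measurable (~` N) by exact: measurableC.
have sE (k : {nnsfun measurableTypeR R >-> R}) : sintegral mu k = (\int[mu]_x (k x)%:E)%E.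
  by rewrite integral_nnsfun// patch_setT.
have -> : sintegral mu h = sintegral mu (proj_nnsfun h mCN).
  rewrite !sE.
  apply: ae_eq_integral => //.
  - exact/measurable_EFinP.
  - exact/measurable_EFinP.
  - exists N; split => // x /=; apply: contra_notP => Nx _.
    by rewrite /= mindicE mem_set ?mulr1.
apply: ereal_sup_ubound; exists (proj_nnsfun h mCN) => //.
move=> x; rewrite /= mindicE; have [Nx|Nx] := boolP (x \in ~` N).
  rewrite mulr1; apply: (le_trans (hf x)).
  by move: Nx; rewrite inE /=; apply: contra_notP => fgx; exact: fgN.
by rewrite mulr0.
Qed.

Lemma ge0_eq_integral_ae (f g : R -> \bar R) :
  (forall x, 0 <= f x)%E -> (forall x, 0 <= g x)%E ->
  {ae mu, forall x, f x = g x} -> (\int[mu]_x f x = \int[mu]_x g x)%E.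
Proof.
move=> f0 g0 fg; apply/eqP; rewrite eq_le; apply/andP; split;
  apply: ge0_le_integral_ae => //; apply: filterS fg => x -> //.
Qed.

(** The integral is defined by simple functions from below, so it depends
    only on the a.e. class of the integrand, whatever the integrand is. *)
Lemma eq_integral_ae D (f g : R -> \bar R) :
  {ae mu, forall x, D x -> f x = g x} ->
  (\int[mu]_(x in D) f x = \int[mu]_(x in D) g x)%E.
Proof.
move=> fg; rewrite integral_mkcond [RHS]integral_mkcond integralE [RHS]integralE.
have {}fg : {ae mu, forall x, (f \_ D) x = (g \_ D) x}.
  apply: filterS fg => x fgx; rewrite /patch.
  by case: ifPn => // /set_mem /fgx.
congr (_ - _)%E; apply: ge0_eq_integral_ae => //;
  by apply: filterS fg => x fgx; rewrite ?funeposE ?funenegE fgx.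
Qed.

Lemma eq_Rintegral_ae D f g :
  {ae mu, forall x, D x -> f x = g x} ->
  \int[mu]_(x in D) f x = \int[mu]_(x in D) g x.
Proof.
move=> fg; rewrite /Rintegral; congr fine; apply: eq_integral_ae.
by apply: filterS fg => x fgx /fgx ->.
Qed.

Lemma Rintegral_set_ae D E f :
  {ae mu, forall x, D x <-> E x} ->
  \int[mu]_(x in D) f x = \int[mu]_(x in E) f x.
Proof.
move=> DE; rewrite Rintegral_mkcond [RHS]Rintegral_mkcond.
apply: eq_Rintegral_ae; apply: filterS DE => x DEx _.
by rewrite /patch (_ : (x \in D) = (x \in E))//; apply/idP/idP => /set_mem/DEx/mem_set.
Qed.

Lemma ae_set1 (a : R) : {ae mu, forall x, x <> a}.
Proof.
exists [set a]; split => //; first exact: lebesgue_measure_set1.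
by move=> x /= /notP.
Qed.

Lemma ae_and (P Q : R -> Prop) :
  {ae mu, forall x, P x} -> {ae mu, forall x, Q x} -> {ae mu, forall x, P x /\ Q x}.
Proof. by move=> p q; near=> x; split; near: x. Unshelve. all: end_near. Qed.

Lemma ae_in_itv (a b : R) (P : R -> Prop) : a < b ->
  {ae mu, forall x, `]a, b[%classic x -> P x} -> exists2 x, `]a, b[%classic x & P x.
Proof.
move=> ab [N [mN N0 HN]]; apply: contrapT => /forall2NP nP.
have : (mu `]a, b[%classic <= mu N)%E.
  apply: le_measure; rewrite ?inE// => x xab.
  by apply: HN => /= /(_ xab); case: (nP x).
rewrite N0 lebesgue_measure_itv/= lte_fin ab -EFinD lee_fin subr_le0.
by rewrite leNgt ab.
Qed.

Definition itg D f := mu.-integrable D (EFin \o f).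

Lemma itg_meas D f : itg D f -> measurable_fun D f.
Proof. by move=> /measurable_int /measurable_EFinP. Qed.

Lemma itgD D f g : measurable D -> itg D f -> itg D g -> itg D (fun x => f x + g x).
Proof. by move=> mD fi gi; apply: (integrableD _ fi gi). Qed.

Lemma itgZ D k f : measurable D -> itg D f -> itg D (fun x => k * f x).
Proof. by move=> mD fi; apply: (integrableZl _ k fi). Qed.

Lemma itgB D f g : measurable D -> itg D f -> itg D g -> itg D (fun x => f x - g x).
Proof. by move=> mD fi gi; apply: (integrableB _ fi gi). Qed.

Lemma itg_norm D f : measurable D -> itg D f -> itg D (fun x => `|f x|).
Proof. by move=> mD fi; exact: (integrable_norm fi). Qed.

Lemma itg_eq D f g : measurable D -> (forall x, D x -> f x = g x) -> itg D f -> itg D g.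
Proof.
move=> mD fg; apply: eq_integrable => // x; rewrite inE => Dx /=.
by rewrite fg.
Qed.

Lemma itg_le D f g : measurable D -> measurable_fun D f ->
  (forall x, D x -> `|f x| <= g x) -> itg D g -> itg D f.
Proof.
move=> mD mf fg; apply: le_integrable => //; first exact/measurable_EFinP.
move=> x Dx /=; by rewrite lee_fin (le_trans (fg x Dx))// ler_norm.
Qed.

Lemma itg_le_ae D f g : measurable D -> measurable_fun D f ->
  {ae mu, forall x, D x -> `|f x| <= g x} -> itg D g -> itg D f.
Proof.
move=> mD mf fg gi; apply/integrableP; split; first exact/measurable_EFinP.
have := @integrable_lty _ _ _ mu D mD _ (integrable_norm gi).
apply: le_lt_trans.
rewrite [leLHS]integral_mkcond [leRHS]integral_mkcond.
apply: ge0_le_integral_ae.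
- by move=> x; apply: erestrict_ge0.
- by move=> x; rewrite /patch; case: ifP => // _; rewrite /= lee_fin.
apply: filterS fg => x fgx; rewrite /patch; case: ifPn => // /set_mem Dx.
by rewrite lee_fin (le_trans (fgx Dx))// ler_norm.
Qed.

Lemma itg_mulb D f g (M : R) : measurable D -> measurable_fun D f ->
  (forall x, D x -> `|f x| <= M) -> itg D g -> itg D (fun x => f x * g x).
Proof.
move=> mD mf fM gi.
apply: (itg_le (g := fun x => M * `|g x|)) => //.
- by apply: measurable_funM => //; exact: itg_meas.
- by move=> x Dx; rewrite normrM ler_wpM2r// fM.
- by apply: itgZ => //; exact: itg_norm.
Qed.

Lemma itg_mkcond D f : measurable D -> itg D f -> itg setT (f \_ D).
Proof.
move=> mD fi; rewrite /itg -restrict_EFin.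
exact: (@integrable_mkcond _ _ _ mu D (EFin \o f) mD).1.
Qed.

Lemma itgS D E f : measurable D -> measurable E -> E `<=` D -> itg D f -> itg E f.
Proof. by move=> mD mE ED; apply: integrableS. Qed.

Lemma itg_cst D k : measurable D -> (mu D < +oo)%E -> itg D (fun=> k).
Proof.
move=> mD Doo; apply/integrableP; split; first exact: measurable_cst.
under eq_integral do rewrite /=.
by rewrite integral_cst// ltey_eq fin_numM// ge0_fin_numE.
 Qed.

Lemma itg_bounded D f (M : R) : measurable D -> (mu D < +oo)%E -> measurable_fun D f ->
  (forall x, D x -> `|f x| <= M) -> itg D f.
Proof. by move=> mD Doo mf fM; apply: (itg_le (g := fun=> M)) => //; exact: itg_cst. Qed.

Lemma itg_sqr D f g : measurable D -> measurable_fun D f -> measurable_fun D g ->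
  itg D (fun x => f x ^+ 2) -> itg D (fun x => g x ^+ 2) -> itg D (fun x => f x * g x).
Proof.
move=> mD mf mg fi gi; apply: (itg_le (g := fun x => f x ^+ 2 + g x ^+ 2)) => //.
- exact: measurable_funM.
- move=> x _; rewrite ler_norml; apply/andP; split; nra.
- exact: itgD.
Qed.

Lemma lebesgue_itv_lty (a b : R) : (mu `]a, b[%classic < +oo)%E.
Proof. by rewrite lebesgue_measure_itv/=; case: ifP => // _; rewrite -EFinD ltry. Qed.

Lemma Rintegral_sum D (I : Type) (s : seq I) (P : pred I) (F : I -> R -> R) :
  measurable D -> (forall i, itg D (F i)) ->
  itg D (fun x => \sum_(i <- s | P i) F i x) /\
  \int[mu]_(x in D) (\sum_(i <- s | P i) F i x) =
  \sum_(i <- s | P i) \int[mu]_(x in D) F i x.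
Proof.
move=> mD Fi; elim: s => [|i s [IH1 IH2]].
  split.
    by apply: (itg_eq (f := cst 0)) => // [x _|]; [rewrite big_nil|exact: integrable0].
  rewrite big_nil; under eq_Rintegral do rewrite big_nil.
  by rewrite Rintegral_cst// mul0r.
case Pi : (P i); last first.
  rewrite big_cons Pi; split.
    by apply: itg_eq IH1 => // x _; rewrite big_cons Pi.
  by rewrite -IH2; apply: eq_Rintegral => x _; rewrite big_cons Pi.
split.
  by apply: itg_eq (itgD mD (Fi i) IH1) => // x _; rewrite big_cons Pi.
rewrite big_cons Pi -IH2 -RintegralD//; last exact: Fi.
by apply: eq_Rintegral => x _; rewrite big_cons Pi.
Qed.

End AlmostEverywhere.

#[local] Existing Instance ae_lebesgue_filter.

(** * Smooth functions and bumps *)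
Section SmoothFunctions.
Context {R : realType}.
Implicit Types (f g : R -> R) (a b c d s t : R).

Lemma derive1_is f g : (forall s, is_derive s 1 f (g s)) -> derive1 f = g.
Proof. by move=> fg; apply/funext => s; rewrite derive1E; exact: derive_val. Qed.

Lemma derive1nSn n f : derive1n n.+1 f = derive1n n (derive1 f).
Proof. by elim: n => // n IH; rewrite derive1nS IH -derive1nS. Qed.

Lemma smooth_is_derive f s : smooth f -> is_derive s 1 f (derive1 f s).
Proof.
by move=> fs; rewrite derive1E; apply/derivableP; have := fs 0%N s.
Qed.

Lemma smooth_derive1 f : smooth f -> smooth (derive1 f).
Proof. by move=> fs n s; rewrite -derive1nSn; exact: fs. Qed.

Lemma smooth_primitive f g : (forall s, is_derive s 1 f (g s)) -> smooth g -> smooth f.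
Proof.
move=> fg gs [|n] s; first by have [] := fg s.
by rewrite derive1nSn (derive1_is fg); exact: gs.
Qed.

(** A family of derivable functions that is stable under derivation consists
    of smooth functions; all closure properties of smoothness come from it. *)
Lemma smooth_coind (S : (R -> R) -> Prop) :
  (forall f, S f -> exists2 g, S g & forall s, is_derive s 1 f (g s)) ->
  forall f, S f -> smooth f.
Proof.
move=> SS f Sf n; elim: n f Sf => [|n IH] f Sf s.
  by have [g _ /(_ s) []] := SS f Sf.
rewrite derive1nSn; have [g Sg fg] := SS f Sf.
by rewrite (derive1_is fg); exact: IH.
Qed.

Lemma is_derive_add f g s df dg : is_derive s 1 f df -> is_derive s 1 g dg ->
  is_derive s 1 (fun x => f x + g x) (df + dg).
Proof. by move=> hf hg; exact: is_deriveD. Qed.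

Lemma is_derive_mul f g s df dg : is_derive s 1 f df -> is_derive s 1 g dg ->
  is_derive s 1 (fun x => f x * g x) (df * g s + f s * dg).
Proof.
move=> hf hg; apply: (is_derive_eq (is_deriveM hf hg)).
by rewrite /GRing.scale/=; ring.
Qed.

Lemma is_derive_scal f s df c : is_derive s 1 f df -> is_derive s 1 (fun x => c * f x) (c * df).
Proof. by move=> hf; exact: (is_deriveZ c hf). Qed.

Lemma is_derive_affine f (df : R -> R) (a b s : R) : is_derive (a * s + b) 1 f (df (a * s + b)) ->
  is_derive s 1 (fun x => f (a * x + b)) (a * df (a * s + b)).
Proof.
move=> hf; rewrite mulrC.
apply: (@is_derive1_comp _ f (fun x => a * x + b)) => //.
apply: (is_derive_eq (is_derive_add (is_derive_scal a (is_derive_id s 1)) (is_derive_cst b s 1))).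
by rewrite mulr1 addr0.
Qed.

#[local] Opaque smooth.

Lemma smooth_cst c : smooth (cst c).
Proof.
apply: (@smooth_coind (fun f => exists c, f = cst c)); last by exists c.
by move=> _ [d ->]; exists (cst 0); [exists 0 | move=> s; exact: is_derive_cst].
Qed.

(** The derivative of a product is a sum of products: the family to which
    [smooth_coind] applies. *)
Inductive products : (R -> R) -> Prop :=
| products_mul f g : smooth f -> smooth g -> products (fun s => f s * g s)
| products_add f g : products f -> products g -> products (fun s => f s + g s).

Lemma smoothM f g : smooth f -> smooth g -> smooth (fun s => f s * g s).
Proof.
move=> fs gs; apply: (@smooth_coind products); last exact: products_mul.
move=> h; elim=> {h f g fs gs} [f g fs gs|f g _ [df Pdf hf] _ [dg Pdg hg]].
  exists (fun s => derive1 f s * g s + f s * derive1 g s).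
    apply: products_add; apply: products_mul.
    - exact: smooth_derive1.
    - exact: gs.
    - exact: fs.
    - exact: smooth_derive1.
  move=> s; apply: is_derive_mul; exact: smooth_is_derive.
exists (fun s => df s + dg s); first exact: products_add.
by move=> s; exact: is_derive_add.
Qed.

Lemma smoothD f g : smooth f -> smooth g -> smooth (fun s => f s + g s).
Proof.
move=> fs gs.
apply: (@smooth_coind (fun h => exists f g, [/\ smooth f, smooth g & h = fun s => f s + g s])).
  move=> _ [{fs gs}f [{}g [fs gs ->]]]; exists (fun s => derive1 f s + derive1 g s).
    exists (derive1 f), (derive1 g); split; [exact: smooth_derive1|exact: smooth_derive1|reflexivity].
  by move=> s; apply: is_derive_add; exact: smooth_is_derive.
exists f, g; split; [exact: fs|exact: gs|reflexivity].
Qed.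

Lemma smoothZ c f : smooth f -> smooth (fun s => c * f s).
Proof. move=> fs; apply: smoothM fs; exact: smooth_cst. Qed.

Lemma smooth_affine f a b : smooth f -> smooth (fun s => f (a * s + b)).
Proof.
move=> fs.
apply: (@smooth_coind (fun h => exists c g, smooth g /\ h = fun s => c * g (a * s + b))).
  move=> _ [c [g [gs ->]]]; exists (fun s => c * a * derive1 g (a * s + b)).
    exists (c * a), (derive1 g); split; [exact: smooth_derive1|reflexivity].
  move=> s; rewrite -mulrA; apply: is_derive_scal; apply: is_derive_affine.
  exact: smooth_is_derive.
exists 1, f; split; [exact: fs|]; by apply/funext => s; rewrite mul1r.
Qed.

Lemma smooth_continuous f : smooth f -> continuous f.
Proof.
move=> fs s; apply: differentiable_continuous.
by apply/derivable1_diffP; have := fs 0%N s.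
Qed.

(** t^-k exp(- 1 / t) for t > 0, extended by 0: a family stable under derivation. *)
Definition flat (k : nat) t : R := if 0 < t then t^-1 ^+ k * expR (- t^-1) else 0.

Lemma flat_ge0 k t : 0 <= flat k t.
Proof.
rewrite /flat; case: ifPn => // t0.
by rewrite mulr_ge0// ?expR_ge0// exprn_ge0// invr_ge0 ltW.
Qed.

(** The term of degree k + 1 of the exponential series at 1 / t. *)
Lemma flat_le k t : flat k t <= (k.+1)`!%:R * `|t|.
Proof.
rewrite /flat; case: ifPn => t0; last by rewrite mulr_ge0.
rewrite gtr0_norm//.
have ti0 : 0 < t^-1 by rewrite invr_gt0.
have fk0 : 0 < (k.+1)`!%:R :> R by rewrite ltr0n fact_gt0.
have : t^-1 ^+ k.+1 / (k.+1)`!%:R <= expR t^-1.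
  apply: le_trans (expR_ge1Dxn k (ltW ti0)); by rewrite lerDr.
rewrite ler_pdivrMr// => h.
rewrite expRN -(ler_pM2r (expR_gt0 t^-1)) -mulrA mulVf ?gt_eqF ?expR_gt0// mulr1.
rewrite -(ler_pM2l ti0) -exprS (le_trans h)//.
rewrite le_eqVlt; apply/orP; left; apply/eqP; field; by rewrite gt_eqF.
Qed.

Lemma is_derive_flat k t : is_derive t 1 (flat k) (- k%:R * flat k.+1 t + flat k.+2 t).
Proof.
have [t0|t0|->] := ltgtP t 0.
- rewrite /flat !ltNge (ltW t0)/= mulr0 addr0.
  apply: (near_eq_is_derive (f := cst 0)).
  near=> u; rewrite ltNge (_ : u <= 0)//; near: u.
  by apply: filterS (lt_nbhsl t0) => u; exact: ltW.
- have t_neq0 : t != 0 by rewrite gt_eqF.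
  have hV : is_derive t 1 (fun u : R => u^-1) (- t^-2).
    apply: (is_derive_eq (is_deriveV (f := id) t_neq0 (is_derive_id t 1))).
    by rewrite /GRing.scale/= mulr1.
  have hX : is_derive t 1 (fun u : R => u^-1 ^+ k) ((k%:R * t^-1 ^+ k.-1) *: - t^-2).
    rewrite (_ : (fun _ => _) = (fun u : R => u^-1) ^+ k); first exact: is_deriveX.
    by apply/funext => u; rewrite exprfctE.
  have hE : is_derive t 1 (fun u : R => expR (- u^-1)) (expR (- t^-1) * t^-2).
    apply: (@is_derive1_comp _ expR (fun u => - u^-1)).
    apply: (is_derive_eq (is_deriveN hV)); by rewrite opprK.
  apply: (@near_eq_is_derive _ _ _ (fun u : R => (u^-1) ^+ k * expR (- u^-1))).
    near=> u; rewrite /flat (_ : 0 < u)//; near: u.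
    exact: lt_nbhsr.
  apply: (is_derive_eq (is_derive_mul hX hE)).
  rewrite /flat t0 /GRing.scale/=.
  case: k {hX} => [|k]; first by rewrite expr0 !mul0r oppr0 !mul0r !add0r mul1r -exprVn mulrC.
  rewrite /= -exprVn (exprS _ k.+2) (exprS _ k.+1) (exprS _ k) expr2; ring.
(* At 0 the difference quotient of flat k is flat k.+1, which tends to 0. *)
- rewrite /flat ltxx mulr0 addr0.
  have cv : (fun h => h^-1 *: (flat k (h *: 1 + 0) - flat k 0)) @ 0^' --> (0 : R).
    apply/cvgr0Pnorm_lt => e e0.
    have c0 : 0 < (k.+2)`!%:R :> R by rewrite ltr0n fact_gt0.
    near=> h.
    have h0 : h != 0 by near: h; exact: nbhs_dnbhs_neq.
    rewrite addr0 {2}/flat ltxx subr0 /GRing.scale/= mulr1.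
    have -> : `|h^-1 * flat k h| = flat k.+1 h.
      rewrite /flat; case: ifPn => hp; last by rewrite mulr0 normr0.
      rewrite mulrA -exprS ger0_norm// mulr_ge0// ?expR_ge0// exprn_ge0// invr_ge0 ltW//.
    apply: (le_lt_trans (flat_le _ _)); rewrite mulrC -ltr_pdivlMr//.
    near: h; apply: dnbhs0_lt; exact: divr_gt0.
  split; first by apply/cvg_ex; exists 0.
  by rewrite /derive; exact: cvg_lim.
Unshelve. all: end_near. Qed.

(** Spanned by the functions flat k; stable under derivation by
    [is_derive_flat]. *)
Inductive flats : (R -> R) -> Prop :=
| flats_scal c k : flats (fun s => c * flat k s)
| flats_add f g : flats f -> flats g -> flats (fun s => f s + g s).

Lemma smooth_flat k : smooth (flat k).
Proof.
apply: (@smooth_coind flats); last first.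
  rewrite (_ : flat k = fun s => 1 * flat k s); first exact: flats_scal.
  by apply/funext => s; rewrite mul1r.
move=> h; elim=> {h} [c n|f g _ [df Pdf hf] _ [dg Pdg hg]].
  exists (fun s => (c * - n%:R) * flat n.+1 s + c * flat n.+2 s).
    by apply: flats_add; exact: flats_scal.
  move=> s; rewrite -mulrA -mulrDr; apply: is_derive_scal; exact: is_derive_flat.
exists (fun s => df s + dg s); first exact: flats_add.
by move=> s; exact: is_derive_add.
Qed.

(** For a < c < d < b and n tending to oo these test functions increase to the
    indicator function of ]c, d[. *)
Definition bump c d (n : nat) s : R :=
  flat 0 (n.+1%:R * s + - (n.+1%:R * c)) * flat 0 (- n.+1%:R * s + n.+1%:R * d).

Lemma smooth_bump c d n : smooth (bump c d n).
Proof. by apply: smoothM; apply: smooth_affine; exact: smooth_flat. Qed.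

Lemma flat0_le1 t : flat 0 t <= 1.
Proof.
rewrite /flat expr0 mul1r; case: ifPn => // t0.
by rewrite expR_le1 oppr_le0 invr_ge0 ltW.
Qed.

Lemma bump_ge0 c d n s : 0 <= bump c d n s.
Proof. by rewrite mulr_ge0// flat_ge0. Qed.

Lemma bump_le1 c d n s : bump c d n s <= 1.
Proof. by rewrite -[leRHS]mulr1 ler_pM// ?flat_ge0// flat0_le1. Qed.

Lemma bumpE c d n s : bump c d n s =
  (if c < s then expR (- (n.+1%:R * (s - c))^-1) else 0) *
  (if s < d then expR (- (n.+1%:R * (d - s))^-1) else 0).
Proof.
rewrite /bump (_ : _ + - _ = n.+1%:R * (s - c)); last by rewrite mulrBr.
rewrite (_ : - n.+1%:R * s + n.+1%:R * d = n.+1%:R * (d - s)); last by rewrite mulrBr mulNr addrC.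
rewrite /flat !expr0 !mul1r.
by rewrite !pmulr_rgt0 ?ltr0n// !subr_gt0.
Qed.

Lemma bump_gt0 c d n s : `]c, d[%classic s -> 0 < bump c d n s.
Proof. by rewrite /= in_itv/= bumpE => /andP[-> ->]; rewrite mulr_gt0 ?expR_gt0. Qed.

Lemma bump_out c d n s : ~ `]c, d[%classic s -> bump c d n s = 0.
Proof.
rewrite /= in_itv/= bumpE.
by case: ifP => _; case: ifP => _; rewrite ?mul0r ?mulr0// => /(_ isT).
Qed.

Lemma expR_inv_cvg (r : R) : 0 < r -> expR (- (n.+1%:R * r)^-1) @[n --> \oo] --> (1 : R).
Proof.
move=> r0; rewrite -[X in _ --> X]expR0 -oppr0.
apply: (@continuous_cvg _ _ _ _ _ _ expR); first exact: continuous_expR.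
apply: cvgN; rewrite -[X in _ --> X](mul0r (r^-1)).
have -> : (fun n => (n.+1%:R * r)^-1) = (fun n => n.+1%:R^-1 * r^-1).
  by apply/funext => n; rewrite invfM.
by apply: cvgM; [exact: cvg_harmonic | exact: cvg_cst].
Qed.

Lemma bump_cvg c d s : bump c d n s @[n --> \oo] --> (\1_(`]c, d[%classic : set R) s : R).
Proof.
rewrite indicE; have [|] := boolP (s \in `]c, d[%classic).
  rewrite inE/= in_itv/= => /andP[cs sd];
  have -> : bump c d ^~ s = fun n => expR (- (n.+1%:R * (s - c))^-1) * expR (- (n.+1%:R * (d - s))^-1).
    by apply/funext => n; rewrite bumpE cs sd.
  rewrite -[X in _ --> X]mulr1; apply: cvgM; apply: expR_inv_cvg; by rewrite subr_gt0.
rewrite notin_setE => sn;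
have -> : bump c d ^~ s = cst 0 by apply/funext => n; rewrite bump_out.
exact: cvg_cst.
Qed.

Lemma test_function_bump a b c d n : a < c -> d < b -> test_function a b (bump c d n).
Proof.
move=> ac db; split; first exact: smooth_bump.
exists `[c, d]%classic; split; first exact: segment_compact.
  by apply: subset_itv; rewrite bnd_simp.
move=> s ns; apply: bump_out => cd; apply: ns; move: s cd.
by apply: subset_itv; rewrite bnd_simp.
Qed.

End SmoothFunctions.

#[local] Opaque smooth.

(** * Fundamental lemma and primitives *)
Section Primitives.
Context {R : realType}.
Local Notation mu := (@lebesgue_measure R).
Implicit Types (f g h u : R -> R) (a b c d r s t : R).

Lemma Rintegral_dominated (D : set R) (f_ : nat -> R -> R) f g :
  measurable D -> (forall n, measurable_fun D (f_ n)) -> measurable_fun D f ->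
  (forall s, D s -> f_ n s @[n --> \oo] --> f s) ->
  (forall n s, D s -> `|f_ n s| <= g s) -> itg D g ->
  \int[mu]_(s in D) f_ n s @[n --> \oo] --> \int[mu]_(s in D) f s.
Proof.
move=> mD mf_ mf cvf fg gi.
have [] := @dominated_convergence _ _ _ mu D mD (fun n => EFin \o f_ n) (EFin \o f) (EFin \o g).
- by move=> n; apply/measurable_EFinP; exact: mf_.
- exact/measurable_EFinP.
- by apply: aeW => s Ds; apply: cvg_EFin; [exact: nearW|exact: cvf].
- exact: gi.
- by apply: aeW => s n Ds; rewrite /= lee_fin fg.
move=> fi _ cvi; rewrite /Rintegral.
apply: fine_cvg; rewrite fineK; last exact: (integrable_fin_num _ fi).
exact: cvi.
Qed.

Lemma Rintegral_bnd (a b : R) (p q : bool) f :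
  \int[mu]_(s in [set` Interval (BSide p a) (BSide q b)]) f s = \int[mu]_(s in `]a, b[) f s.
Proof.
apply: Rintegral_set_ae; have := ae_and (ae_set1 a) (ae_set1 b).
apply: filterS => s [sa sb] /=; rewrite !in_itv/=.
have -> : (s < b ?<= if ~~ q) = (s < b).
  by case: q => //=; rewrite le_eqVlt (negbTE (introN eqP sb)).
have -> // : (a < s ?<= if p) = (a < s).
by case: p => //=; rewrite le_eqVlt eq_sym (negbTE (introN eqP sa)).
Qed.

Lemma test_bounded a b phi : test_function a b phi ->
  continuous phi /\ exists M, forall s, `|phi s| <= M.
Proof.
move=> [sphi [K [Kc Kab K0]]]; have cphi := smooth_continuous sphi; split => //.
have /compact_bounded[M [_ HM]] : compact (phi @` K).
  by apply: continuous_compact => //; exact: continuous_subspaceT.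
exists (`|M| + 1) => s; have [Ks|/K0 ->] := pselect (K s).
  by apply: HM; [rewrite (le_lt_trans (ler_norm M))// ltrDl | exists s].
by rewrite normr0 addr_ge0.
Qed.

Lemma itg_mul_test a b g phi : itg `]a, b[%classic g -> test_function a b phi ->
  itg `]a, b[%classic (fun s => g s * phi s).
Proof.
move=> gi /test_bounded[cphi [M HM]].
have : itg `]a, b[%classic (fun s => phi s * g s).
  apply: itg_mulb gi => //; apply: measurable_funTS; exact: continuous_measurable_fun.
by apply: itg_eq => // s _; rewrite mulrC.
Qed.

Lemma test_derive1 a b phi : test_function a b phi -> test_function a b (derive1 phi).
Proof.
move=> [sphi [K [Kc Kab K0]]]; split; first exact: smooth_derive1.
exists K; split => // s Ks; rewrite derive1E.
rewrite (@near_eq_derive _ _ _ phi (cst 0)) ?derive_cst//.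
have Ko : open (~` K) by apply: closed_openC; apply: compact_closed.
have : \forall u \near s, (~` K) u by apply: open_nbhs_nbhs; split.
by apply: filterS => u /= /K0.
Qed.

(** The test function vanishes near a and near b, because the complement of its
    compact support is an open set containing both. *)
Lemma test_support a b phi : a < b -> test_function a b phi -> exists c d,
  [/\ a < c, c <= d, d < b & forall s, s <= c \/ d <= s -> phi s = 0].
Proof.
move=> ab [sphi [K [Kc Kab K0]]].
have Ko : open (~` K) by apply: closed_openC; apply: compact_closed.
have nK s : ~ `]a, b[%classic s -> \forall u \near s, phi u = 0.
  move=> ns; have : \forall u \near s, (~` K) u.
    by apply: open_nbhs_nbhs; split => //; apply: contra_not ns; exact: Kab.
  by apply: filterS => u /= /K0.
have [e e0 He] : exists2 e, 0 < e & forall u : R, `|a - u| < e -> phi u = 0.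
  have /nbhs_ballP[e e0 He] : \forall u \near a, phi u = 0.
    by apply: nK; rewrite /= in_itv/= ltxx.
  by exists e => // u ue; apply: He.
have [e' e'0 He'] : exists2 e, 0 < e & forall u : R, `|b - u| < e -> phi u = 0.
  have /nbhs_ballP[e' e'0 He'] : \forall u \near b, phi u = 0.
    by apply: nK; rewrite /= in_itv/= ltxx andbF.
  by exists e' => // u ue; apply: He'.
have out s : ~ `]a, b[%classic s -> phi s = 0.
  by move=> ns; apply: K0; apply: contra_not ns; exact: Kab.
pose e0' := Num.min (Num.min e e') (b - a) / 2.
have e00 : 0 < e0' by rewrite divr_gt0// !lt_min e0 e'0 subr_gt0 ab.
have [ee ee' eb] : [/\ e0' < e, e0' < e' & e0' <= (b - a) / 2].
  have m1 : Num.min (Num.min e e') (b - a) <= Num.min e e' by rewrite ge_min lexx.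
  have m2 : Num.min e e' <= e by rewrite ge_min lexx.
  have m3 : Num.min e e' <= e' by rewrite ge_min lexx orbT.
  have m4 : Num.min (Num.min e e') (b - a) <= b - a by rewrite ge_min lexx orbT.
  rewrite /e0' in e00 *; split; lra.
exists (a + e0'), (b - e0'); split; [lra|lra|lra|].
move=> s [sa|sb].
  have [sa'|sa'] := leP s a; first by apply: out; rewrite /= in_itv/= ltNge sa'.
  by apply: He; rewrite distrC ger0_norm; lra.
have [sb'|sb'] := leP b s; first by apply: out; rewrite /= in_itv/= [s < b]ltNge sb' andbF.
by apply: He'; rewrite ger0_norm; lra.
Qed.

(** By Lebesgue differentiation g is a.e. the derivative of its indefinite
    integral, which is locally constant here. *)
Lemma itg_zero_itv a b g : itg `]a, b[%classic g ->
  (forall c d, a < c -> c < d -> d < b -> \int[mu]_(s in `]c, d[) g s = 0) ->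
  {ae mu, forall s, `]a, b[%classic s -> g s = 0}.
Proof.
move=> gi g0; pose G := g \_ `]a, b[.
have Gi : itg setT G by exact: (itg_mkcond _ gi).
have li : locally_integrable setT G.
  split; [exact: itg_meas Gi|exact: openT|].
  move=> K _ Kc; have mK : measurable K by apply: compact_measurable.
  have GK : itg K G by apply: itgS Gi.
  exact: (@integrable_lty _ _ _ mu K mK _ (itg_norm mK GK)).
have GiI (i : interval R) : itg [set` i] G by apply: itgS Gi.
have := FTC1Ny (fun y => GiI `]-oo, y]) li.
apply: filterS => s [_ dG] sab; rewrite -[RHS](_ : G s = 0); first by rewrite /G patchT// inE.
rewrite -dG derive1E; move: sab; rewrite /= in_itv/= => /andP[as_ sb].
pose c := (a + s) / 2; pose d := (s + b) / 2.
have [ac cs sd db] : [/\ a < c, c < s, s < d & d < b] by rewrite /c /d; split; lra.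
pose F := fun y => \int[mu]_(t in `]-oo, y]) G t.
rewrite (@near_eq_derive _ _ _ _ (cst (F c))) ?derive_cst//.
near=> u.
have cu : c < u by near: u; exact: lt_nbhsr.
have ud : u < d by near: u; exact: lt_nbhsl.
apply/eqP; rewrite -subr_eq0 Rintegral_itvB//; [|exact: GiI|by rewrite bnd_simp ltW].
rewrite Rintegral_bnd -[X in _ == X](g0 c u)//; last exact: lt_trans db.
apply/eqP; apply: eq_Rintegral => t; rewrite inE /= in_itv/= => /andP[ct tu].
by rewrite /G patchT// inE /= in_itv/= (lt_trans ac ct) (lt_trans tu (lt_trans ud db)).
Unshelve. all: end_near. Qed.

(** Fundamental lemma of the calculus of variations: bump functions detect the
    integral over every subinterval, hence the density at Lebesgue points. *)
Lemma fundamental_lemma a b g : itg `]a, b[%classic g ->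
  (forall phi, test_function a b phi -> \int[mu]_(s in `]a, b[) (g s * phi s) = 0) ->
  {ae mu, forall s, `]a, b[%classic s -> g s = 0}.
Proof.
move=> gi g0; apply: itg_zero_itv => // c d ac cd db.
have gm := itg_meas gi.
have : \int[mu]_(s in `]a, b[) (g s * bump c d n s) @[n --> \oo] -->
       \int[mu]_(s in `]a, b[) (g s * \1_(`]c, d[%classic : set R) s).
  apply: (@Rintegral_dominated _ _ _ (fun s => `|g s|)) => //.
  - move=> n; apply: measurable_funM => //; apply: measurable_funTS.
    apply: continuous_measurable_fun; apply: smooth_continuous; exact: smooth_bump.
  - by apply: measurable_funM => //; apply: measurable_funTS; exact: measurable_indic.
  - by move=> s _; apply: cvgM; [exact: cvg_cst|exact: bump_cvg].
  - by move=> n s _; rewrite normrM [X in _ * X]ger0_norm ?bump_ge0// ler_piMr// bump_le1.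
  - exact: itg_norm.
rewrite (_ : (fun n => _) = cst 0); last first.
  by apply/funext => n; apply: g0; exact: test_function_bump.
move=> /(cvg_lim (@Rhausdorff R)); rewrite lim_cst// => ->.
rewrite [RHS]Rintegral_mkcond Rintegral_mkcond; congr Rintegral; apply/funext => s.
rewrite /patch indicE; case: (boolP (s \in `]c, d[%classic)) => scd.
  rewrite mulr1 ifT//; move: scd; rewrite !inE /=; move: s; apply: subset_itv; rewrite bnd_simp ltW//.
by rewrite mulr0; case: ifP.
Qed.

(** For s <= a the interval is empty and the value is 0. *)
Definition prim a g s := \int[mu]_(t in `]a, s[) g t.

Lemma prim_split a b g r s : itg `]a, b[%classic g -> a <= r -> r <= s -> s <= b ->
  prim a g s = prim a g r + \int[mu]_(t in `]r, s[) g t.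
Proof.
move=> gi ar; rewrite le_eqVlt => /predU1P[<- _|rs sb].
  by rewrite set_itv_ge ?bnd_simp// Rintegral_set0 addr0.
apply/eqP; rewrite addrC -subr_eq; apply/eqP.
rewrite /prim -[X in _ - X](Rintegral_bnd a r false false) Rintegral_itvB//.
apply: itgS gi => //; apply: subset_itvl; rewrite bnd_simp//.
Qed.

Lemma prim_at a g : prim a g a = 0.
Proof. by rewrite /prim set_itv_ge ?bnd_simp// Rintegral_set0. Qed.

Lemma prim_continuous a b g : a <= b -> itg `]a, b[%classic g ->
  {within `[a, b], continuous (prim a g)}.
Proof.
move=> ab gi; pose G := g \_ `]a, b[.
have Gi : itg setT G by exact: (itg_mkcond _ gi).
have Giab : itg `[a, b]%classic G by apply: itgS Gi.
have := @parameterized_integral_continuous R a b G ab Giab.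
apply: subspace_eq_continuous => s.
rewrite inE /= in_itv/= => /andP[as_ sb].
rewrite /from_subspace/= /parameterized_integral Rintegral_bnd; apply: eq_Rintegral => t.
rewrite inE /= in_itv/= => /andP[at_ ts]; rewrite /G patchT// inE/= in_itv/= at_ /=.
exact: lt_le_trans ts sb.
Qed.

Lemma prim_cvg_right a b g : a < b -> itg `]a, b[%classic g ->
  prim a g s @[s --> a^'+] --> (0 : R).
Proof.
move=> ab gi; rewrite -(prim_at a g).
by have /(continuous_within_itvP _ ab)[_ + _] := prim_continuous (ltW ab) gi.
Qed.

Lemma prim_cvg_left a b g : a < b -> itg `]a, b[%classic g ->
  prim a g s @[s --> b^'-] --> prim a g b.
Proof.
move=> ab gi.
by have /(continuous_within_itvP _ ab)[_ _ +] := prim_continuous (ltW ab) gi.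
Qed.

Lemma prim_bounded a b g s : itg `]a, b[%classic g -> a <= s -> s <= b ->
  `|prim a g s| <= \int[mu]_(t in `]a, b[) `|g t|.
Proof.
move=> gi as_ sb.
have gis : itg `]a, s[%classic g by apply: itgS gi => //; apply: subset_itvl; rewrite bnd_simp.
apply: (le_trans (le_normr_Rintegral _ gis)) => //.
have := prim_split (itg_norm (measurable_itv _) gi) as_ sb (lexx b).
rewrite /prim => ->; rewrite lerDl; exact: Rintegral_ge0.
Qed.

Lemma prim_itg a b g : itg `]a, b[%classic g -> itg `]a, b[%classic (prim a g).
Proof.
move=> gi; have [ab|ba] := leP a b; last first.
  by rewrite set_itv_ge ?bnd_simp -?leNgt ?ltW//; exact: integrable_set0.
apply: (@itg_bounded _ _ _ (\int[mu]_(t in `]a, b[) `|g t|)) => //.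
- exact: lebesgue_itv_lty.
- have := prim_continuous ab gi => /(subspace_continuous_measurable_fun (measurable_itv _)).
  by apply: measurable_funS => //; apply: subset_itv; rewrite bnd_simp.
- by move=> s; rewrite /= in_itv/= => /andP[as_ sb]; apply: prim_bounded => //; exact: ltW.
Qed.

End Primitives.

(** * Weak derivatives in dimension one *)
Section WeakDerivatives.
Context {R : realType}.
Local Notation mu := (@lebesgue_measure R).
Implicit Types (f g h u : R -> R) (a b c d r s t : R).

Lemma Rintegral_derive a b f g : a <= b -> (forall s, is_derive s 1 f (g s)) ->
  continuous g -> \int[mu]_(s in `]a, b[) g s = f b - f a.
Proof.
rewrite le_eqVlt => /predU1P[<- _ _|ab fg cg].
  by rewrite set_itv_ge ?bnd_simp// Rintegral_set0 subrr.
have cf : continuous f.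
  by move=> s; apply: differentiable_continuous; apply/derivable1_diffP; have [] := fg s.
rewrite -(Rintegral_bnd a b true false) /Rintegral (@continuous_FTC2 _ g f)//.
- exact: continuous_subspaceT.
- split; first by move=> s _; have [] := fg s.
  + by apply: cvg_at_right_filter; exact: cf.
  + by apply: cvg_at_left_filter; exact: cf.
- by move=> s _; rewrite (derive1_is fg).
Qed.

(** Integration by parts for absolutely continuous functions is the integral of
    g r * h s over the two triangles r < s and s < r of the square. *)
Lemma prim_by_parts a b g h : a < b -> itg `]a, b[%classic g -> itg `]a, b[%classic h ->
  \int[mu]_(s in `]a, b[) (prim a g s * h s) =
  prim a g b * prim a h b - \int[mu]_(s in `]a, b[) (g s * prim a h s).
Proof.
move=> ab gi hi; pose G := g \_ `]a, b[; pose H := h \_ `]a, b[.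
have Gi : itg setT G by exact: (itg_mkcond _ gi).
have Hi : itg setT H by exact: (itg_mkcond _ hi).
have mG : measurable_fun setT G by exact: itg_meas Gi.
have mH : measurable_fun setT H by exact: itg_meas Hi.
(* F is g r * h s on the triangle r < s and is integrated in both orders. *)
pose F (z : measurableTypeR R * measurableTypeR R) := if z.1 < z.2 then G z.1 * H z.2 else 0.
have mF : measurable_fun setT F.
  apply: measurable_fun_ifT.
  - by apply: measurable_fun_ltr; [exact: measurable_fst|exact: measurable_snd].
  - apply: measurable_funM.
      by apply: (measurableT_comp mG); exact: measurable_fst.
    by apply: (measurableT_comp mH); exact: measurable_snd.
  - exact: measurable_cst.
have F1 r : itg setT (fun s => F (r, s)).
  apply: (itg_le (g := fun s => `|G r| * `|H s|)) => //.
  - by apply: measurableT_comp => //; exact: measurable_pair1.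
  - by move=> s _; rewrite /F/=; case: ifP; rewrite ?normrM// normr0 mulr_ge0.
  - by apply: itgZ => //; exact: itg_norm.
have F2 s : itg setT (fun r => F (r, s)).
  apply: (itg_le (g := fun r => `|H s| * `|G r|)) => //.
  - by apply: measurableT_comp => //; exact: measurable_pair2.
  - by move=> r _; rewrite /F/=; case: ifP; rewrite ?normrM// 1?mulrC// normr0 mulr_ge0.
  - by apply: itgZ => //; exact: itg_norm.
have Fi : (mu \x mu)%E.-integrable setT (EFin \o F).
  apply/integrable12ltyP; first exact/measurable_EFinP.
  have HE : (\int[mu]_s `|H s|%:E = (\int[mu]_s `|H s|)%:E)%E.
    rewrite /Rintegral fineK//; apply: integrable_fin_num => //; exact: (itg_norm _ Hi).
  have GE : (\int[mu]_s `|G s|%:E = (\int[mu]_s `|G s|)%:E)%E.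
    rewrite /Rintegral fineK//; apply: integrable_fin_num => //; exact: (itg_norm _ Gi).
  apply: (@le_lt_trans _ _ (\int[mu]_r (`|G r|%:E * (\int[mu]_s `|H s|)%:E))%E).
    apply: ge0_le_integral_ae.
    - by move=> r; exact: integral_ge0.
    - by move=> r; rewrite -EFinM lee_fin mulr_ge0// Rintegral_ge0.
    - apply: aeW => r; rewrite -HE -ge0_integralZl//; last first.
        by apply/measurable_EFinP; exact: measurableT_comp.
      apply: ge0_le_integral_ae => //.
      apply: aeW => s; rewrite /F /= -EFinM lee_fin.
      by case: ifP; rewrite ?normrM// normr0 mulr_ge0.
  under eq_integral do rewrite muleC.
  rewrite ge0_integralZl//; last 2 first.
  - by apply/measurable_EFinP; exact: measurableT_comp.
  - by rewrite lee_fin Rintegral_ge0.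
  by rewrite GE -EFinM ltry.
have RF1 r : (\int[mu]_s (EFin \o F) (r, s) = (\int[mu]_s F (r, s))%:E)%E.
  by rewrite /Rintegral fineK//; exact: (integrable_fin_num _ (F1 r)).
have RF2 s : (\int[mu]_r (EFin \o F) (r, s) = (\int[mu]_r F (r, s))%:E)%E.
  by rewrite /Rintegral fineK//; exact: (integrable_fin_num _ (F2 s)).
have := Fubini Fi.
under eq_integral do rewrite RF1.
under [in RHS]eq_integral do rewrite RF2.
move=> /(congr1 fine); rewrite -!/(Rintegral _ _ _).
have -> : \int[mu]_s \int[mu]_r F (r, s) = \int[mu]_(s in `]a, b[) (prim a g s * h s).
  rewrite [RHS]Rintegral_mkcond; apply: eq_Rintegral => s _; rewrite [RHS]/patch.
  case: (boolP (s \in _)) => sab; last first.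
    rewrite (_ : (fun r => _) = cst 0) ?Rintegral_cst ?mul0r//.
    by apply/funext => r; rewrite /F/= /H /patch (negbTE sab) mulr0; case: ifP.
  move: (sab); rewrite inE/= in_itv/= => /andP[as_ sb].
  rewrite /prim -RintegralZr//; last by apply: itgS gi => //; apply: subset_itvl; rewrite bnd_simp ltW.
  rewrite [RHS]Rintegral_mkcond; apply: eq_Rintegral => r _.
  rewrite /F/= /G /H /patch sab !mem_setE !in_itv/=.
  case: (ltP r s) => rs; rewrite ?andbF// andbT (lt_trans rs sb) andbT.
  by case: ifP; rewrite ?mul0r.
have -> : \int[mu]_r \int[mu]_s F (r, s) =
    \int[mu]_(r in `]a, b[) (g r * (prim a h b - prim a h r)).
  rewrite [RHS]Rintegral_mkcond; apply: eq_Rintegral => r _; rewrite [RHS]/patch.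
  case: (boolP (r \in _)) => rab; last first.
    rewrite (_ : (fun s => _) = cst 0) ?Rintegral_cst ?mul0r//.
    by apply/funext => s; rewrite /F/= /G /patch (negbTE rab) mul0r; case: ifP.
  move: (rab); rewrite inE/= in_itv/= => /andP[ar rb].
  rewrite (prim_split hi (ltW ar) (ltW rb))// addrC addKr.
  rewrite -RintegralZl//; last by apply: itgS hi => //; apply: subset_itvr; rewrite bnd_simp ltW.
  rewrite [RHS]Rintegral_mkcond; apply: eq_Rintegral => s _.
  rewrite /F/= /G /H /patch rab !mem_setE !in_itv/=.
  case: (ltP r s) => rs//=; rewrite (lt_trans ar rs)/=.
  by case: ifP; rewrite ?mulr0.
move=> <-.
have gPi : itg `]a, b[%classic (fun s => g s * prim a h s).
  apply: (itg_eq (f := fun s => prim a h s * g s)) => // [s _|]; first by rewrite mulrC.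
  apply: (@itg_mulb _ _ _ _ (\int[mu]_(t in `]a, b[) `|h t|)) => //.
    exact: itg_meas (prim_itg hi).
  by move=> s; rewrite /= in_itv/= => /andP[as_ sb]; apply: prim_bounded => //; exact: ltW.
under eq_Rintegral do rewrite mulrBr.
have gci : itg `]a, b[%classic (fun s => g s * prim a h b).
  apply: (itg_eq (f := fun s => prim a h b * g s)) => // [s _|]; first by rewrite mulrC.
  exact: itgZ.
by rewrite RintegralB// RintegralZr.
Qed.

(** The fundamental theorem of calculus from a, where phi vanishes. *)
Lemma prim_test a b phi s : test_function a b phi -> a <= s -> prim a (derive1 phi) s = phi s.
Proof.
move=> tphi as_; have [cphi _] := test_bounded tphi; have [sphi [K [_ Kab K0]]] := tphi.
have cphi' : continuous (derive1 phi) by apply: smooth_continuous; exact: smooth_derive1.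
rewrite /prim (Rintegral_derive as_ (fun t => smooth_is_derive t sphi) cphi').
by rewrite [phi a]K0 ?subr0// => /Kab; rewrite /= in_itv/= ltxx.
Qed.

Lemma itg_test a b phi : test_function a b phi -> itg `]a, b[%classic phi.
Proof.
move=> /test_bounded[cphi [M HM]]; apply: itg_bounded (fun s _ => HM s) => //.
  exact: lebesgue_itv_lty.
by apply: measurable_funTS; exact: continuous_measurable_fun.
Qed.

Lemma eq_weak_derivative a b u u' g g' :
  {ae mu, forall s, `]a, b[%classic s -> u s = u' s} ->
  {ae mu, forall s, `]a, b[%classic s -> g s = g' s} ->
  weak_derivative a b u g -> weak_derivative a b u' g'.
Proof.
move=> uu gg ug phi tphi; have := ug phi tphi.
rewrite (@eq_Rintegral_ae _ _ _ (fun s => u' s * derive1 phi s)); last first.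
  by apply: filterS uu => s h /h ->.
by rewrite (@eq_Rintegral_ae _ _ (fun s => g s * phi s) (fun s => g' s * phi s));
  [|apply: filterS gg => s h /h ->].
Qed.

(** [prim_by_parts] for g and the derivative of the test function, whose
    primitive vanishes at b. *)
Lemma weak_derivative_prim a b c g : a < b -> itg `]a, b[%classic g ->
  weak_derivative a b (fun s => c + prim a g s) g.
Proof.
move=> ab gi phi tphi.
have tphi' := test_derive1 tphi.
have phib : phi b = 0.
  by have [_ [K [_ Kab ->]]] := tphi => // /Kab; rewrite /= in_itv/= ltxx andbF.
under eq_Rintegral do rewrite mulrDl.
rewrite RintegralD//; last 2 first.
- by apply: itgZ => //; exact: itg_test.
- apply: itg_mul_test => //; exact: prim_itg.
rewrite RintegralZl//; last exact: itg_test.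
rewrite -/(prim a (derive1 phi) b) (prim_test tphi (ltW ab)) phib mulr0 add0r.
rewrite prim_by_parts//; last exact: itg_test.
rewrite (prim_test tphi (ltW ab)) phib mulr0 sub0r; congr (- _).
apply: eq_Rintegral => s; rewrite inE/= in_itv/= => /andP[as_ sb].
by rewrite (prim_test tphi (ltW as_)).
Qed.

Lemma weak_derivative_uniq a b u g g' : itg `]a, b[%classic g -> itg `]a, b[%classic g' ->
  weak_derivative a b u g -> weak_derivative a b u g' ->
  {ae mu, forall s, `]a, b[%classic s -> g s = g' s}.
Proof.
move=> gi gi' ug ug'.
have ggi : itg `]a, b[%classic (fun s => g s - g' s) by exact: itgB.
have gg phi : test_function a b phi -> \int[mu]_(s in `]a, b[) ((g s - g' s) * phi s) = 0.
  move=> tphi; under eq_Rintegral do rewrite mulrBl.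
  rewrite RintegralB//; [|exact: itg_mul_test..].
  by apply/eqP; rewrite subr_eq0 -eqr_opp -(ug _ tphi) -(ug' _ tphi).
apply: filterS (fundamental_lemma ggi gg) => s h /h /eqP.
by rewrite subr_eq0 => /eqP.
Qed.

(** A bump on a smaller interval, divided by its integral. *)
Lemma unit_test a b : a < b ->
  exists2 rho, test_function a b rho & \int[mu]_(s in `]a, b[) rho s = 1.
Proof.
move=> ab; pose c := (a + (a + b) / 2) / 2; pose d := (b + (a + b) / 2) / 2.
have [ac cd db] : [/\ a < c, c < d & d < b] by rewrite /c /d; split; lra.
have tB := test_function_bump 0 ac db.
have Bi := itg_test tB.
have I0 : \int[mu]_(s in `]a, b[) bump c d 0 s != 0.
  apply/eqP => I0.
  have := (ae_eq_integral_abs mu (measurable_itv `]a, b[) (f := EFin \o bump c d 0) _).1.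
  have mB : measurable_fun `]a, b[%classic (EFin \o bump c d 0).
    by apply/measurable_EFinP; exact: itg_meas Bi.
  move=> /(_ mB); under eq_integral do rewrite gee0_abs ?lee_fin ?bump_ge0//.
  have -> : (\int[mu]_(s in `]a, b[) (bump c d 0 s)%:E = 0)%E.
    by rewrite -[LHS]fineK ?[fine _]I0//; exact: (integrable_fin_num _ Bi).
  move=> /(_ erefl) ae0.
  have ae0' : {ae mu, forall s, `]c, d[%classic s -> `]a, b[%classic s -> (bump c d 0 s)%:E = 0%E}.
    by apply: filterS ae0 => s h _; exact: h.
  have [s scd] := ae_in_itv cd ae0'.
  have sab : `]a, b[%classic s.
    by move: s scd; apply: subset_itv; rewrite bnd_simp ltW.
  by move=> /(_ sab) [] B0; have := bump_gt0 0 scd; rewrite B0 ltxx.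
exists (fun s => (\int[mu]_(s in `]a, b[) bump c d 0 s)^-1 * bump c d 0 s).
  have [sB [K [Kc Kab K0]]] := tB; split; first exact: smoothZ.
  by exists K; split => // s /K0 ->; rewrite mulr0.
by rewrite RintegralZl// mulVf.
Qed.

(** A test function with zero mean is the derivative of a test function; rho
    corrects the mean. *)
Lemma test_primitive a b rho psi : a < b -> test_function a b rho ->
  \int[mu]_(s in `]a, b[) rho s = 1 -> test_function a b psi ->
  exists2 phi, test_function a b phi &
    derive1 phi = fun s => psi s - (\int[mu]_(s in `]a, b[) psi s) * rho s.
Proof.
move=> ab trho rho1 tpsi; set I := \int[mu]_(s in _) psi s.
have [rhoi psii] := (itg_test trho, itg_test tpsi).
pose chi s := psi s + - I * rho s.
have tchi : test_function a b chi.
  have [srho [K [Kc Kab K0]]] := trho; have [spsi [K' [Kc' Kab' K0']]] := tpsi.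
  split.
    apply: (smoothD spsi); exact: smoothZ.
  exists (K `|` K'); split; first exact: compactU.
  - by move=> s [/Kab|/Kab'].
  - by move=> s /not_orP[/K0 r0 /K0' p0]; rewrite /chi r0 p0 mulr0 addr0.
have chii := itg_test tchi; have [cchi _] := test_bounded tchi.
have chi0 : \int[mu]_(s in `]a, b[) chi s = 0.
  rewrite RintegralD//; last exact: itgZ.
  by rewrite RintegralZl// rho1 mulr1 subrr.
have [c [d [ac cd db out]]] := test_support ab tchi.
pose Phi y := \int[mu]_(t in `]a, y]) chi t.
have Phi0 s : s <= c \/ d <= s -> Phi s = 0.
  move=> [sc|ds].
    rewrite /Phi Rintegral_mkcond (_ : _ \_ _ = cst 0) ?Rintegral_cst ?mul0r//.
    apply/funext => t; rewrite /patch; case: ifPn => //.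
    by rewrite inE/= in_itv/= => /andP[_ ts]; apply: out; left; exact: le_trans ts sc.
  rewrite -chi0 /Phi Rintegral_mkcond [RHS]Rintegral_mkcond; congr Rintegral.
  apply/funext => t; rewrite /patch !mem_setE !in_itv/=.
  case: (ltP a t) => //= at_; case: (leP t s) => ts; case: (ltP t b) => tb //.
    by apply: out; right; rewrite (le_trans _ tb)// ltW.
  by rewrite out//; right; exact: le_trans ds (ltW ts).
have dPhi s : is_derive s 1 Phi (chi s).
  have [sc|cs] := ltP s c.
    rewrite out; last by left; exact: ltW.
    apply: (@near_eq_is_derive _ _ _ (cst 0)).
    by apply: filterS (lt_nbhsl sc) => u uc; rewrite Phi0//; left; exact: ltW.
  have as_ : (BRight a < BRight s)%O by rewrite bnd_simp (lt_le_trans ac cs).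
  have chis : itg `]a, (s + 1)]%classic chi.
    have [_ [M HM]] := test_bounded tchi.
    apply: itg_bounded (fun s _ => HM s) => //.
      by rewrite lebesgue_measure_itv/=; case: ifP => // _; rewrite -EFinD ltry.
    by apply: measurable_funTS; exact: continuous_measurable_fun.
  have [dP dE] := @continuous_FTC1 R chi (BRight a) s (s + 1) (ltr_pwDr ltr01 (lexx _)) chis as_ (cchi s).
  by rewrite -dE derive1E; apply/derivableP.
exists Phi; last by rewrite (derive1_is dPhi); apply/funext => s; rewrite /chi mulNr.
split; first by apply: smooth_primitive dPhi _; have [] := tchi.
exists `[c, d]%classic; split; first exact: segment_compact.
  by apply: subset_itv; rewrite bnd_simp.
move=> s; rewrite /= in_itv/= => /negP; rewrite negb_and -!ltNge => /orP[sc|ds];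
  apply: Phi0; by [left; exact: ltW|right; exact: ltW].
Unshelve. all: end_near. Qed.

(** For rho of mean 1, psi - (mean of psi) rho is the derivative of a test function:
    the hypothesis gives the action of w on psi' up to a multiple of the mean of
    psi, which a constant in the derivative absorbs. *)
Lemma weak_derivative2 a b w f : a < b -> itg `]a, b[%classic w -> itg `]a, b[%classic f ->
  (forall phi, test_function a b phi ->
    \int[mu]_(s in `]a, b[) (w s * derive1 (derive1 phi) s) =
    \int[mu]_(s in `]a, b[) (f s * phi s)) ->
  exists c, weak_derivative a b w (fun s => c + prim a f s).
Proof.
move=> ab wi fi wf; have [rho trho rho1] := unit_test ab.
have trho' := test_derive1 trho.
pose A := \int[mu]_(s in `]a, b[) (w s * derive1 rho s).
pose B := \int[mu]_(s in `]a, b[) (prim a f s * rho s).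
exists (- (A + B)) => psi tpsi.
have [phi tphi dphi] := test_primitive ab trho rho1 tpsi.
set I := \int[mu]_(s in _) psi s in dphi.
have tpsi' := test_derive1 tpsi.
have ddphi : derive1 (derive1 phi) = fun s => derive1 psi s - I * derive1 rho s.
  rewrite dphi; apply: derive1_is => s; rewrite -mulNr.
  under eq_fun do rewrite -mulNr.
  apply: is_derive_add; last apply: is_derive_scal; apply: smooth_is_derive.
    by have [] := tpsi.
  by have [] := trho.
have Pi := prim_itg fi.
have := weak_derivative_prim 0 ab fi tphi.
move=> /(congr1 -%R); rewrite opprK -(wf phi tphi) ddphi dphi.
under eq_Rintegral do rewrite add0r mulrBr mulrCA.
rewrite RintegralB//; [|exact: itg_mul_test|apply: itgZ => //; exact: itg_mul_test].
rewrite RintegralZl//; last exact: itg_mul_test.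
under [in RHS]eq_Rintegral do rewrite mulrBr mulrCA.
rewrite RintegralB//; [|exact: itg_mul_test|apply: itgZ => //; exact: itg_mul_test].
rewrite RintegralZl//; last exact: itg_mul_test.
rewrite -/A -/B => E.
under [in RHS]eq_Rintegral do rewrite mulrDl.
rewrite RintegralD//; [|by apply: itgZ => //; exact: itg_test|exact: itg_mul_test].
rewrite RintegralZl//; last exact: itg_test.
rewrite -/I; lra.
Qed.

(** The lemma of du Bois-Reymond. *)
Lemma weak_derivative_primE a b u g : a < b -> itg `]a, b[%classic u -> itg `]a, b[%classic g ->
  weak_derivative a b u g ->
  exists c, {ae mu, forall s, `]a, b[%classic s -> u s = c + prim a g s}.
Proof.
move=> ab ui gi ug; have [rho trho rho1] := unit_test ab.
have Pi := prim_itg gi.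
have vi : itg `]a, b[%classic (fun s => u s - prim a g s) by exact: itgB.
exists (\int[mu]_(s in `]a, b[) ((u s - prim a g s) * rho s)); set c := \int[mu]_(s in _) _.
have vci : itg `]a, b[%classic (fun s => u s - prim a g s - c).
  by apply: itgB => //; apply: itg_cst => //; exact: lebesgue_itv_lty.
(* u - prim a g is orthogonal to derivatives of test functions, that is, to
   test functions of mean 0; subtracting c makes it orthogonal to rho too. *)
have orth phi : test_function a b phi ->
    \int[mu]_(s in `]a, b[) ((u s - prim a g s - c) * phi s) = 0.
  move=> tphi; have [Phi tPhi dPhi] := test_primitive ab trho rho1 tphi.
  have tPhi' := test_derive1 tPhi.
  have E : \int[mu]_(s in `]a, b[) ((u s - prim a g s) * derive1 Phi s) = 0.
    under eq_Rintegral do rewrite mulrBl.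
    rewrite RintegralB//; [|exact: itg_mul_test..].
    rewrite ug//; have := weak_derivative_prim 0 ab gi tPhi.
    by under eq_Rintegral do rewrite add0r; move=> ->; rewrite subrr.
  move: E; rewrite dPhi; under eq_Rintegral do rewrite mulrBr mulrCA.
  rewrite RintegralB//; [|exact: itg_mul_test|apply: itgZ => //; exact: itg_mul_test].
  rewrite RintegralZl//; last exact: itg_mul_test.
  rewrite -/c => E.
  under eq_Rintegral do rewrite mulrBl.
  rewrite RintegralB//; [|exact: itg_mul_test|apply: itgZ => //; exact: itg_test].
  rewrite RintegralZl//; last exact: itg_test.
  by rewrite mulrC.
apply: filterS (fundamental_lemma vci orth) => s h /h /eqP.
by rewrite subr_eq0 subr_eq => /eqP ->; rewrite addrC.
Qed.

End WeakDerivatives.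

(** * Semi-inner products *)
Section SemiInnerProduct.
Context {R : realType} {E : lmodType R} (S : set E) (B : E -> E -> R).
Hypothesis S_lin : forall (k : R) u v, S u -> S v -> S (k *: u + v).
Hypothesis B_lin : forall (k : R) u v w, S u -> S v -> S w ->
  B (k *: u + v) w = k * B u w + B v w.
Hypothesis B_sym : forall u v, S u -> S v -> B u v = B v u.
Hypothesis B_ge0 : forall u, S u -> 0 <= B u u.
Let N u := Num.sqrt (B u u).

Lemma sip_linr (k : R) u v w : S u -> S v -> S w -> B w (k *: u + v) = k * B w u + B w v.
Proof. by move=> Su Sv Sw; rewrite B_sym//; [rewrite B_lin// ![B _ w]B_sym|exact: S_lin]. Qed.

Lemma sip_expand (k : R) u v : S u -> S v ->
  B (k *: u + v) (k *: u + v) = k ^+ 2 * B u u + 2 * k * B u v + B v v.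
Proof.
move=> Su Sv; rewrite B_lin//; last exact: S_lin.
by rewrite !sip_linr// (B_sym Sv Su); ring.
Qed.

(** The quadratic polynomial k |-> B (k u + v) (k u + v) is nonnegative. When
    B u u = 0 it has degree at most 1 and takes the value -1 unless it is
    constant. *)
Lemma sip_CS2 u v : S u -> S v -> B u v ^+ 2 <= B u u * B v v.
Proof.
move=> Su Sv; have u0 := B_ge0 Su; have v0 := B_ge0 Sv.
have H k := B_ge0 (S_lin k Su Sv).
have {}H k : 0 <= k ^+ 2 * B u u + 2 * k * B u v + B v v by rewrite -sip_expand.
have [Bu0|Bu0] := eqVneq (B u u) 0.
  rewrite Bu0 mul0r; have := H (- (B v v + 1) / (2 * B u v)); rewrite Bu0 mulr0 add0r.
  have [->|Buv0] := eqVneq (B u v) 0; first by rewrite expr0n.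
  by rewrite (_ : 2 * _ * _ = - (B v v + 1)); [move=> ?; lra|field; rewrite Buv0].
have Bu_gt0 : 0 < B u u by rewrite lt_neqAle eq_sym Bu0.
have := H (- B u v / B u u).
rewrite (_ : _ + _ + _ = B v v - B u v ^+ 2 / B u u); last by field.
by rewrite subr_ge0 ler_pdivrMr// mulrC.
Qed.

Lemma sip_CS u v : S u -> S v -> `|B u v| <= N u * N v.
Proof.
move=> Su Sv; rewrite /N -sqrtrM ?B_ge0// -sqrtr_sqr ler_wsqrtr//.
exact: sip_CS2.
Qed.

Lemma sip_norm_sqr u : S u -> N u ^+ 2 = B u u.
Proof. by move=> Su; rewrite sqr_sqrtr// B_ge0. Qed.

Lemma sip_normZ_D (k : R) u v : S u -> S v -> N (k *: u + v) <= `|k| * N u + N v.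
Proof.
move=> Su Sv; have Nu : 0 <= N u by exact: sqrtr_ge0.
have Nv : 0 <= N v by exact: sqrtr_ge0.
have kNN : 0 <= `|k| * N u + N v by rewrite addr_ge0// mulr_ge0.
rewrite -(ler_pXn2r (n := 2))// ?nnegrE ?sqrtr_ge0//.
rewrite sip_norm_sqr ?sip_expand//; last exact: S_lin.
rewrite sqrrD exprMn !sip_norm_sqr// real_normK ?num_real// lerD2r lerD2l.
rewrite -[leRHS]mulr_natl -!mulrA ler_pM2l//.
by apply: (le_trans (ler_norm _)); rewrite normrM ler_wpM2l// sip_CS.
Qed.

End SemiInnerProduct.

(** * Square integrable functions, traces and H^1 on an interval *)
Section SquareIntegrable.
Context {R : realType}.
Local Notation mu := (@lebesgue_measure R).
Implicit Types (u v g h w : R -> R) (a b c r s t : R) (D : set R).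

Definition sqi D u := measurable_fun D u /\ itg D (fun s => u s ^+ 2).

Lemma in_L2P D u : measurable D -> in_L2 D u <-> sqi D u.
Proof.
move=> mD.
have mE : measurable_fun setT (u \_ D) <-> measurable_fun D u.
  by rewrite -(@measurable_restrict _ _ _ _ D setT u)// setTI.
have sqE : (fun s => (u \_ D) s ^+ 2) = (fun s => u s ^+ 2) \_ D.
  by apply/funext => s; rewrite /patch; case: ifP; rewrite // expr0n.
have iE : itg setT (fun s => (u \_ D) s ^+ 2) <-> itg D (fun s => u s ^+ 2).
  rewrite sqE /itg -restrict_EFin; symmetry.
  exact: (@integrable_mkcond _ _ _ mu D (EFin \o (fun s => u s ^+ 2)) mD).
split.
  move=> uL; split.
    by apply/mE; move: uL; rewrite /in_L2 => /sub_Lfun_mfun; rewrite inE.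
  by apply/iE; exact: (Lfun2_integrable_sqr uL).
move=> [/mE mu_ /iE iu]; rewrite /in_L2 inE; apply/andP; split; first by rewrite inE.
rewrite inE /= /finite_norm unlock /=; apply: poweR_lty.
have := @integrable_lty _ _ _ mu setT measurableT _ iu; apply: le_lt_trans.
apply: ge0_le_integral_ae => //.
- by move=> s; rewrite lee_fin sqr_ge0.
- by apply: aeW => s /=; rewrite lee_fin powR_mulrn// real_normK// num_real.
Qed.

Lemma sqi_itg D u : measurable D -> (mu D < +oo)%E -> sqi D u -> itg D u.
Proof.
move=> mD Doo [um ui]; apply: (itg_le (g := fun s => 1 + u s ^+ 2)) => //.
  by move=> s _; rewrite ler_norml; apply/andP; split; nra.
by apply: itgD => //; exact: itg_cst.
Qed.

Lemma sqiM D u v : measurable D -> sqi D u -> sqi D v -> itg D (fun s => u s * v s).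
Proof. by move=> mD [um ui] [vm vi]; exact: itg_sqr. Qed.

Lemma sqi_lin D (k : R) u v : measurable D -> sqi D u -> sqi D v -> sqi D (k *: u + v).
Proof.
move=> mD su sv; have [um ui] := su; have [vm vi] := sv; split.
  by apply: measurable_funD => //; apply: measurable_funM.
apply: (itg_eq (f := fun s => k ^+ 2 * u s ^+ 2 + (2 * k * (u s * v s) + v s ^+ 2))) => //.
  by move=> s _; rewrite !fctE /GRing.scale/=; ring.
apply: itgD => //; first exact: itgZ.
by apply: itgD => //; apply: itgZ => //; exact: sqiM.
Qed.

Lemma sqi_bounded D u (M : R) : measurable D -> (mu D < +oo)%E -> measurable_fun D u ->
  (forall s, D s -> `|u s| <= M) -> sqi D u.
Proof.
move=> mD Doo um uM; split => //; apply: (@itg_bounded _ _ _ (M ^+ 2)) => //.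
  exact: measurable_funX.
move=> s Ds; rewrite ger0_norm ?sqr_ge0// -[_ ^+ 2]real_normK ?num_real//.
by rewrite ler_pXn2r ?nnegrE// ?uM// (le_trans _ (uM s Ds)).
Qed.

Lemma sqiS D (E : set R) u : measurable D -> measurable E -> E `<=` D -> sqi D u -> sqi E u.
Proof.
move=> mD mE ED [um ui]; split; first exact: measurable_funS um.
exact: itgS ui.
Qed.

(** Functions that are equal a.e. on ]a, b[ agree at points arbitrarily close
    to a. *)
Lemma cvg_right_ae_uniq w1 w2 a b (l1 l2 : R) : a < b ->
  {ae mu, forall s, `]a, b[%classic s -> w1 s = w2 s} ->
  w1 s @[s --> a^'+] --> l1 -> w2 s @[s --> a^'+] --> l2 -> l1 = l2.
Proof.
move=> ab ww c1 c2; apply/eqP/negPn/negP => l12.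
have e0 : 0 < `|l1 - l2| / 2 by rewrite divr_gt0// normr_gt0 subr_eq0.
have h : \forall s \near a^'+, [/\ `|l1 - w1 s| < `|l1 - l2| / 2,
    `|l2 - w2 s| < `|l1 - l2| / 2 & s < b].
  near=> s; split; near: s; last exact: nbhs_right_lt.
    by move/cvgrPdist_lt : c1; apply.
  by move/cvgrPdist_lt : c2; apply.
have [d /= d0 hd] := h.
have adb : a < Num.min (a + d) b by rewrite lt_min ltrDl d0.
have ww' : {ae mu, forall s, `]a, (Num.min (a + d) b)[%classic s -> w1 s = w2 s}.
  apply: filterS ww => s ws sa; apply: ws; move: s sa; apply: subset_itvl.
  by rewrite bnd_simp ge_min lexx orbT.
have [s] := ae_in_itv adb ww'.
rewrite /= in_itv/= lt_min => /and3P[as_ sd sb] ws.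
have [] : [/\ `|l1 - w1 s| < `|l1 - l2| / 2, `|l2 - w2 s| < `|l1 - l2| / 2 & s < b].
  apply: hd => //=; rewrite ltr0_norm ?subr_lt0//; lra.
rewrite ws => h1 h2 _; have := ler_distD (w2 s) l1 l2.
rewrite [`|w2 s - l2|]distrC; lra.
Unshelve. all: end_near. Qed.

Lemma cvg_left_ae_uniq w1 w2 a b (l1 l2 : R) : a < b ->
  {ae mu, forall s, `]a, b[%classic s -> w1 s = w2 s} ->
  w1 s @[s --> b^'-] --> l1 -> w2 s @[s --> b^'-] --> l2 -> l1 = l2.
Proof.
move=> ab ww c1 c2; apply/eqP/negPn/negP => l12.
have e0 : 0 < `|l1 - l2| / 2 by rewrite divr_gt0// normr_gt0 subr_eq0.
have h : \forall s \near b^'-, [/\ `|l1 - w1 s| < `|l1 - l2| / 2,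
    `|l2 - w2 s| < `|l1 - l2| / 2 & a < s].
  near=> s; split; near: s; last exact: nbhs_left_gt.
    by move/cvgrPdist_lt : c1; apply.
  by move/cvgrPdist_lt : c2; apply.
have [d /= d0 hd] := h.
have adb : Num.max (b - d) a < b by rewrite gt_max gtrBl d0.
have ww' : {ae mu, forall s, `](Num.max (b - d) a), b[%classic s -> w1 s = w2 s}.
  apply: filterS ww => s ws sa; apply: ws; move: s sa; apply: subset_itvr.
  by rewrite bnd_simp le_max lexx orbT.
have [s] := ae_in_itv adb ww'.
rewrite /= in_itv/= gt_max => /andP[/andP[ds as_] sb] ws.
have [] : [/\ `|l1 - w1 s| < `|l1 - l2| / 2, `|l2 - w2 s| < `|l1 - l2| / 2 & a < s].
  apply: hd => //=; rewrite gtr0_norm ?subr_gt0//; lra.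
rewrite ws => h1 h2 _; have := ler_distD (w2 s) l1 l2.
rewrite [`|w2 s - l2|]distrC; lra.
Unshelve. all: end_near. Qed.

Lemma right_trace_val u w a b (l : R) : a < b ->
  {ae mu, forall s, `]a, b[%classic s -> u s = w s} ->
  w s @[s --> a^'+] --> l -> right_trace u a = l.
Proof.
move=> ab uw wl; rewrite /right_trace.
case: xgetP => [_ -> [w' [[d d0 w'u] w'l]]|/(_ l)]; last first.
  apply: contra_notP => _; exists w; split => //; exists (b - a); first by rewrite subr_gt0.
  by rewrite addrC subrK; apply: filterS uw => s h /h.
have adb : a < Num.min (a + d) b by rewrite lt_min ltrDl d0.
apply: (cvg_right_ae_uniq adb _ w'l wl).
have := ae_and w'u uw; apply: filterS => s [h1 h2] sab.
rewrite h1 ?h2//; move: s sab {h1 h2}; apply: subset_itvl; rewrite bnd_simp ge_min lexx ?orbT//.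
Qed.

Lemma left_trace_val u w a b (l : R) : a < b ->
  {ae mu, forall s, `]a, b[%classic s -> u s = w s} ->
  w s @[s --> b^'-] --> l -> left_trace u b = l.
Proof.
move=> ab uw wl; rewrite /left_trace.
case: xgetP => [_ -> [w' [[d d0 w'u] w'l]]|/(_ l)]; last first.
  apply: contra_notP => _; exists w; split => //; exists (b - a); first by rewrite subr_gt0.
  by rewrite opprB addrC subrK; apply: filterS uw => s h /h.
have adb : Num.max (b - d) a < b by rewrite gt_max gtrBl d0.
apply: (cvg_left_ae_uniq adb _ w'l wl).
have := ae_and w'u uw; apply: filterS => s [h1 h2] sab.
rewrite h1 ?h2//; move: s sab {h1 h2}; apply: subset_itvr; rewrite bnd_simp le_max lexx ?orbT//.
Qed.

(** u is in H^1(a, b) with derivative g. *)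
Definition sob a b u g :=
  [/\ sqi `]a, b[%classic u, sqi `]a, b[%classic g & weak_derivative a b u g].

Section Traces.
Variables (a b : R).
Hypothesis ab : a < b.

Let D_itg u : sqi `]a, b[%classic u -> itg `]a, b[%classic u.
Proof. by apply: sqi_itg => //; exact: lebesgue_itv_lty. Qed.

Lemma primE_traces u c g : itg `]a, b[%classic g ->
  {ae mu, forall s, `]a, b[%classic s -> u s = c + prim a g s} ->
  right_trace u a = c /\ left_trace u b = c + prim a g b.
Proof.
move=> gi uE; split.
  apply: (right_trace_val ab uE); rewrite -[X in _ --> X]addr0.
  by apply: cvgD; [exact: cvg_cst|exact: prim_cvg_right gi].
apply: (left_trace_val ab uE).
by apply: cvgD; [exact: cvg_cst|exact: prim_cvg_left gi].
Qed.

Lemma sob_prim u g : sob a b u g ->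
  {ae mu, forall s, `]a, b[%classic s -> u s = right_trace u a + prim a g s} /\
  left_trace u b = right_trace u a + prim a g b.
Proof.
move=> [/D_itg ui /D_itg gi ug].
have [c uE] := weak_derivative_primE ab ui gi ug.
by have [-> ->] := primE_traces gi uE.
Qed.

(** Both functions are constants plus primitives; the constants contribute
    boundary terms and [prim_by_parts] does the rest. *)
Lemma sob_by_parts u g v h : sob a b u g -> sob a b v h ->
  \int[mu]_(s in `]a, b[) (g s * v s) + \int[mu]_(s in `]a, b[) (u s * h s) =
  left_trace u b * left_trace v b - right_trace u a * right_trace v a.
Proof.
move=> sug svh; have [uE ->] := sob_prim sug; have [vE ->] := sob_prim svh.
have [_ /D_itg gi _] := sug; have [_ /D_itg hi _] := svh.
set c := right_trace u a in uE *; set d := right_trace v a in vE *.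
have gPi : itg `]a, b[%classic (fun s => g s * prim a h s).
  apply: (itg_eq (f := fun s => prim a h s * g s)) => // [s _|]; first by rewrite mulrC.
  apply: (@itg_mulb _ _ _ _ (\int[mu]_(t in `]a, b[) `|h t|)) => //.
    exact: itg_meas (prim_itg hi).
  by move=> s; rewrite /= in_itv/= => /andP[as_ sb]; apply: prim_bounded => //; exact: ltW.
have Phi : itg `]a, b[%classic (fun s => prim a g s * h s).
  apply: (@itg_mulb _ _ _ _ (\int[mu]_(t in `]a, b[) `|g t|)) => //.
    exact: itg_meas (prim_itg gi).
  by move=> s; rewrite /= in_itv/= => /andP[as_ sb]; apply: prim_bounded => //; exact: ltW.
have -> : \int[mu]_(s in `]a, b[) (g s * v s) =
    \int[mu]_(s in `]a, b[) (d * g s + g s * prim a h s).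
  by apply: eq_Rintegral_ae; apply: filterS vE => s vs sab; rewrite vs//; ring.
have -> : \int[mu]_(s in `]a, b[) (u s * h s) =
    \int[mu]_(s in `]a, b[) (c * h s + prim a g s * h s).
  by apply: eq_Rintegral_ae; apply: filterS uE => s us sab; rewrite us//; ring.
rewrite !RintegralD//; try exact: itgZ.
by rewrite !RintegralZl// (prim_by_parts ab gi hi) -!/(prim _ _ _); ring.
Qed.

Lemma weak_derivative_lin (k : R) u g v h :
  sob a b u g -> sob a b v h -> weak_derivative a b (k *: u + v) (k *: g + h).
Proof.
move=> [/D_itg ui /D_itg gi ug] [/D_itg vi /D_itg hi vh] phi tphi.
have tphi' := test_derive1 tphi.
have E (f1 f2 psi : R -> R) : itg `]a, b[%classic f1 -> itg `]a, b[%classic f2 -> test_function a b psi ->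
    \int[mu]_(s in `]a, b[) ((k *: f1 + f2) s * psi s) =
    k * \int[mu]_(s in `]a, b[) (f1 s * psi s) + \int[mu]_(s in `]a, b[) (f2 s * psi s).
  move=> f1i f2i tpsi.
  have -> : (fun s => (k *: f1 + f2) s * psi s) = (fun s => k * (f1 s * psi s) + f2 s * psi s).
    by apply/funext => s; rewrite !fctE /GRing.scale/=; ring.
  rewrite RintegralD//; [|apply: itgZ => //; exact: itg_mul_test|exact: itg_mul_test].
  by rewrite RintegralZl//; exact: itg_mul_test.
by rewrite !E// ug// vh//; ring.
Qed.

Lemma traces_lin (k : R) u g v h : sob a b u g -> sob a b v h ->
  right_trace (k *: u + v) a = k * right_trace u a + right_trace v a /\
  left_trace (k *: u + v) b = k * left_trace u b + left_trace v b.
Proof.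
move=> sug svh; have [uE ->] := sob_prim sug; have [vE ->] := sob_prim svh.
have [_ /D_itg gi _] := sug; have [_ /D_itg hi _] := svh.
have kgh : itg `]a, b[%classic (k *: g + h) by apply: (itgD _ (itgZ k _ gi) hi).
have P s : prim a (k *: g + h) s = k * prim a g s + prim a h s \/ ~ (a <= s <= b).
  have [/andP[as_ sb]|] := boolP (a <= s <= b); last by right; exact/negP.
  left; have sub : `]a, s[%classic `<=` `]a, b[%classic.
    by apply: subset_itvl; rewrite bnd_simp.
  have gis : itg `]a, s[%classic g by apply: itgS gi.
  have his : itg `]a, s[%classic h by apply: itgS hi.
  have kgis := itgZ k (measurable_itv _) gis.
  by rewrite /prim -RintegralZl// -RintegralD.
have [] := @primE_traces (k *: u + v) (k * right_trace u a + right_trace v a) _ kgh.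
  have := ae_and uE vE; apply: filterS => s [us vs] sab.
  rewrite !fctE /GRing.scale/= us// vs//.
  case: (P s) => [->|]; first by ring.
  by case; move: sab; rewrite /= in_itv/= => /andP[/ltW -> /ltW ->].
move=> -> ->; split => //; case: (P b) => [->|]; first by ring.
by case; rewrite lexx ltW.
Qed.

Lemma eq_traces u v g : sob a b u g ->
  {ae mu, forall s, `]a, b[%classic s -> u s = v s} ->
  right_trace v a = right_trace u a /\ left_trace v b = left_trace u b.
Proof.
move=> sug uv; have [uE ->] := sob_prim sug; have [_ /D_itg gi _] := sug.
apply: primE_traces => //; have := ae_and uE uv.
by apply: filterS => s [h1 h2] sab; rewrite -h2// h1.
Qed.

End Traces.

Lemma sob_derive a b f g : a < b -> (forall s, is_derive s 1 f (g s)) -> continuous g ->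
  [/\ sob a b f g, right_trace f a = f a & left_trace f b = f b].
Proof.
move=> ab fg cg.
have cf : continuous f.
  by move=> s; apply: differentiable_continuous; apply/derivable1_diffP; have [] := fg s.
have sc k : continuous k -> sqi `]a, b[%classic k.
  move=> ck; have [c _ Hc] := @EVT_max R (fun s => `|k s|) a b (ltW ab) (continuous_subspaceT (fun s => continuous_comp (ck s) (@norm_continuous _ _ _))).
  apply: (@sqi_bounded _ _ `|k c|) => //; first exact: lebesgue_itv_lty.
    by apply: measurable_funTS; exact: continuous_measurable_fun.
  by move=> s; rewrite /= in_itv/= => /andP[as_ sb]; apply: Hc; rewrite in_itv/= !ltW.
have gi : itg `]a, b[%classic g by apply: sqi_itg (sc _ cg) => //; exact: lebesgue_itv_lty.
have fE s : `]a, b[%classic s -> f s = f a + prim a g s.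
  rewrite /= in_itv/= => /andP[as_ _]; rewrite /prim (Rintegral_derive (ltW as_) fg cg); ring.
split.
- split; [exact: sc|exact: sc|].
  apply: (@eq_weak_derivative _ a b (fun s => f a + prim a g s) _ g g _ _ (weak_derivative_prim (f a) ab gi)).
    by apply: aeW => s /fE.
  exact: aeW.
- apply: (right_trace_val ab (w := f)); first exact: aeW.
  by apply: cvg_at_right_filter; exact: cf.
- apply: (left_trace_val ab (w := f)); first exact: aeW.
  by apply: cvg_at_left_filter; exact: cf.
Qed.

End SquareIntegrable.

(** * Strongly measurable functions and Bochner integrals *)
Lemma ae_countable (R : realType) (K : countType) (P : K -> R -> Prop) :
  (forall k, {ae @lebesgue_measure R, forall t, P k t}) ->
  {ae @lebesgue_measure R, forall t, forall k, P k t}.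
Proof.
move=> HP.
have : {ae @lebesgue_measure R, forall t, forall n : nat, if unpickle n is Some k then P k t else True}.
  apply/ae_foralln => n; case: (unpickle n) => [k|]; first exact: HP.
  exact: aeW.
by apply: filterS => t h k; have := h (pickle k); rewrite pickleK.
Qed.

Lemma cvg_pow (R : realType) (I : Type) (F : set_system I) {FF : Filter F} (f : I -> R) (a : R) n :
  f i @[i --> F] --> a -> f i ^+ n @[i --> F] --> a ^+ n.
Proof.
move=> fa; elim: n => [|n IH]; first by under eq_fun do rewrite expr0; exact: cvg_cst.
by under eq_fun do rewrite exprS; rewrite exprS; exact: cvgM.
Qed.

(** Sequential continuity on S for the norm N, the notion of continuity along
    which simple functions converge. *)
Definition norm_continuous (R : realType) (E : lmodType R) (S : set E) (N : E -> R) (Psi : E -> R) :=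
  forall (u_ : nat -> E) u,
  (forall n, S (u_ n)) -> S u -> N (u_ n - u) @[n --> \oo] --> (0 : R) ->
  Psi (u_ n) @[n --> \oo] --> Psi u.

Section Bochner.
Context {R : realType} {E : lmodType R}.
Local Notation mu := (@lebesgue_measure R).
Variables (S : set E) (N : E -> R).
Hypothesis S0 : S 0.
Hypothesis S_lin : forall (k : R) u v, S u -> S v -> S (k *: u + v).
Hypothesis N_ge0 : forall u, 0 <= N u.
Hypothesis N_lin : forall (k : R) u v, S u -> S v -> N (k *: u + v) <= `|k| * N u + N v.
Implicit Types (h : simple_function S) (f g : R -> E) (D : set R) (t : R).

Lemma S_sub u v : S u -> S v -> S (u - v).
Proof. by move=> Su Sv; rewrite addrC -scaleN1r; exact: S_lin. Qed.

Lemma S_scal (k : R) u : S u -> S (k *: u).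
Proof. by move=> Su; rewrite -[_ *: _]addr0; exact: S_lin. Qed.

Lemma S_sum (I : Type) (r : seq I) (c : I -> R) (u : I -> E) :
  (forall i, S (u i)) -> S (\sum_(i <- r) c i *: u i).
Proof.
by move=> Su; elim: r => [|i r IH]; rewrite ?big_nil ?big_cons//; exact: S_lin.
Qed.

(** A simple function takes finitely many values, indexed by the pattern of the
    sets that contain t; any function of this pattern is Borel. *)
Definition pattern h : finType := {ffun 'I_(sf_size h) -> bool}.

Definition sf_pattern h t : pattern h := [ffun k => t \in @sf_set _ _ _ h k].

Definition sf_value h (b : pattern h) : E := \sum_k (b k)%:R *: @sf_val _ _ _ h k.

Lemma sf_evalE h t : sf_eval h t = sf_value (sf_pattern h t).
Proof. by apply: eq_bigr => k _; rewrite ffunE indicE. Qed.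

Lemma sf_value_in h (b : pattern h) : S (sf_value b).
Proof. by apply: S_sum => k; exact: sf_in. Qed.

Lemma sf_eval_in h t : S (sf_eval h t).
Proof. by rewrite sf_evalE; exact: sf_value_in. Qed.

Lemma measurable_sf_pattern h (G : pattern h -> R) :
  measurable_fun setT (fun t => G (sf_pattern h t)).
Proof.
pose A (b : pattern h) : set R := [set t | sf_pattern h t = b].
have mA b : measurable (A b).
  have -> : A b = \bigcap_(k in [set: 'I_(sf_size h)]) (if b k then sf_set k else ~` sf_set k).
    apply/seteqP; split => [t <- k _ /=|t H].
      by rewrite ffunE; case: ifPn => [/set_mem//|]; rewrite notin_setE.
    apply/ffunP => k; rewrite ffunE; have := H k I.
    by case: (b k) => [/mem_set//|nk]; apply/negbTE; rewrite notin_setE.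
  apply: fin_bigcap_measurable => [|k _]; first exact: finite_finset.
  case: (b k); first exact: sf_measurable.
  by apply: measurableC; exact: sf_measurable.
have -> : (fun t => G (sf_pattern h t)) = (fun t => \sum_(b : pattern h) G b * \1_(A b) t).
  apply/funext => t; rewrite (bigD1 (sf_pattern h t))//= indicE mem_set// mulr1.
  rewrite big1 ?addr0// => b bt; rewrite indicE memNset ?mulr0// => tb.
  by rewrite /A /= in tb; rewrite tb eqxx in bt.
by apply: measurable_sum => b; apply: measurable_funM.
Qed.

Local Notation N_continuous := (norm_continuous S N).

Lemma norm_continuousN : N_continuous N.
Proof.
move=> u_ u Su_ Su /cvgrPdist_lt c; apply/cvgrPdist_lt => e e0.
have := c e e0; apply: filterS => n; rewrite sub0r normrN (ger0_norm (N_ge0 _)) => ne.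
have h1 : N (u_ n) <= N (u_ n - u) + N u.
  have := N_lin 1 (S_sub (Su_ n) Su) Su; by rewrite scale1r normr1 mul1r subrK.
have h2 : N u <= N (u_ n - u) + N (u_ n).
  have := N_lin (-1) (S_sub (Su_ n) Su) (Su_ n).
  by rewrite scaleN1r opprB subrK normrN1 mul1r.
rewrite ltr_norml; apply/andP; split; lra.
Qed.

Lemma bounded_continuous (l : E -> R) (C : R) :
  (forall (k : R) u v, S u -> S v -> l (k *: u + v) = k * l u + l v) ->
  (forall u, S u -> `|l u| <= C * N u) -> N_continuous l.
Proof.
move=> llin lC u_ u Su_ Su c; apply/cvgrPdist_lt => e e0.
have C0 : 0 < `|C| + 1 by rewrite ltr_wpDl.
move/cvgrPdist_lt : c => /(_ (e / (`|C| + 1))) []; first exact: divr_gt0.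
move=> n0 _ Hn; exists n0 => // n /Hn /=.
rewrite sub0r normrN (ger0_norm (N_ge0 _)) ltr_pdivlMr// => h.
rewrite distrC; have -> : l (u_ n) - l u = l (u_ n - u).
  have := llin (-1) u (u_ n) Su (Su_ n).
  by rewrite scaleN1r addrC => ->; ring.
apply: (le_lt_trans (lC _ (S_sub (Su_ n) Su))); apply: le_lt_trans h.
rewrite mulrC ler_wpM2l ?N_ge0//.
by rewrite (le_trans (ler_norm C))// lerDl.
Qed.

(** A limit a.e. of simple functions becomes Borel after composition with a
    continuous functional and modification on a null set. *)
Lemma strongly_measurable_ae D f Psi : measurable D ->
  {ae mu, forall t, D t -> S (f t)} -> strongly_measurable S N D f -> N_continuous Psi ->
  exists2 g, measurable_fun D g & {ae mu, forall t, D t -> Psi (f t) = g t}.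
Proof.
move=> mD Sf [h hf] cPsi.
have [A [mA A0 HA]] := ae_and Sf hf.
have mCA : measurable (~` A) by exact: measurableC.
exists ((fun t => Psi (f t)) \_ (~` A)).
  apply: (measurable_fun_cvg (h := fun n => (fun t => Psi (sf_eval (h n) t)) \_ (~` A))).
    move=> n; apply/measurable_restrict => //; apply: measurable_funTS.
    under eq_fun do rewrite sf_evalE.
    exact: (measurable_sf_pattern (fun b => Psi (sf_value b))).
  move=> t Dt; rewrite /patch; case: ifPn => [|_]; last exact: cvg_cst.
  rewrite inE => /= At; have [] : (D t -> S (f t)) /\ (D t -> N (sf_eval (h n) t - f t) @[n --> \oo] --> 0).
    by apply: contrapT => H; apply: At; exact: HA.
  move=> /(_ Dt) Sft /(_ Dt); apply: cPsi => // n; exact: sf_eval_in.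
exists A; split => // t /= H; apply: contrapT => At; apply: H => Dt.
by rewrite /patch mem_set.
Qed.

Lemma bochner_L2_integrable (T C : R) f Psi : bochner_L2 S N T f -> N_continuous Psi ->
  {ae mu, forall t, `]0, T[%classic t -> `|Psi (f t)| <= C * (1 + N (f t) ^+ 2)} ->
  exists2 g, itg `]0, T[%classic g & {ae mu, forall t, `]0, T[%classic t -> Psi (f t) = g t}.
Proof.
move=> [Sf sf Nf] cPsi PsiC.
have {}Sf : {ae mu, forall t, `]0, T[%classic t -> S (f t)} by [].
have mT : measurable (`]0, T[%classic : set R) by exact: measurable_itv.
have [g gm gE] := strongly_measurable_ae mT Sf sf cPsi.
have [n nm nE] := strongly_measurable_ae mT Sf sf norm_continuousN.
have ni : itg `]0, T[%classic (fun t => n t ^+ 2).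
  apply/integrableP; split; first by apply/measurable_EFinP; exact: measurable_funX.
  move: Nf; apply: le_lt_trans; rewrite le_eqVlt; apply/orP; left; apply/eqP.
  apply: eq_integral_ae; apply: filterS nE => t nt tT.
  by rewrite /= ger0_norm ?sqr_ge0// nt.
exists g => //.
apply: (@itg_le_ae _ _ _ (fun t => C * (1 + n t ^+ 2))) => //.
  have := ae_and gE (ae_and nE PsiC); apply: filterS => t [gt [nt Ct]] tT.
  by rewrite -gt// -nt// Ct.
apply: itgZ => //; apply: itgD => //; apply: itg_cst => //; exact: lebesgue_itv_lty.
Qed.

(** Linearity gives the equality for simple functions. Their images under l
    converge in L^1, because |l u - l v| <= C N(u - v), and the images of their
    integrals converge to l z for the same reason. *)
Lemma bochner_integral_functional D f z (l : E -> R) (C : R) : measurable D -> (mu D < +oo)%E ->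
  {ae mu, forall t, D t -> S (f t)} ->
  (forall (k : R) u v, S u -> S v -> l (k *: u + v) = k * l u + l v) ->
  (forall u, S u -> `|l u| <= C * N u) ->
  is_bochner_integral S N D f z -> \int[mu]_(t in D) l (f t) = l z.
Proof.
move=> mD Doo Sf llin lC [Sz [h [hf hint hz]]].
have cl := bounded_continuous llin lC.
have [g gm gE] := strongly_measurable_ae mD Sf (ex_intro _ h hf) cl.
rewrite (eq_Rintegral_ae gE).
have C0 : 0 < `|C| + 1 by rewrite ltr_wpDl.
have l0 : l 0 = 0 by have := llin (-1) 0 0 S0 S0; rewrite scaler0 addr0; lra.
have lsum (I : Type) (r : seq I) (c : I -> R) (u : I -> E) : (forall i, S (u i)) ->
    l (\sum_(i <- r) c i *: u i) = \sum_(i <- r) c i * l (u i).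
  move=> Su; elim: r => [|i r IH]; first by rewrite !big_nil.
  by rewrite !big_cons llin ?IH//; exact: S_sum.
have ind_i n k : itg D (fun t => \1_(@sf_set _ _ _ (h n) k) t * l (@sf_val _ _ _ (h n) k)).
  apply: (@itg_bounded _ _ _ `|l (@sf_val _ _ _ (h n) k)|) => //.
    by apply: measurable_funM => //; apply: measurable_indic; exact: sf_measurable.
  by move=> t _; rewrite normrM indicE; case: (_ \in _); rewrite ?normr1 ?mul1r// normr0 mul0r.
have [lhi lhE] : (forall n, itg D (fun t => l (sf_eval (h n) t))) /\
    (forall n, \int[mu]_(t in D) l (sf_eval (h n) t) = l (sf_integral D (h n))).
  have H n := Rintegral_sum (index_enum _) xpredT mD (ind_i n).
  split => n; have [H1 H2] := H n.
    apply: itg_eq H1 => // t _; rewrite /sf_eval lsum// => k; exact: sf_in.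
  rewrite /sf_integral lsum; last by move=> k; exact: sf_in.
  transitivity (\int[mu]_(t in D) \sum_k \1_(@sf_set _ _ _ (h n) k) t * l (@sf_val _ _ _ (h n) k)).
    by apply: eq_Rintegral => t _; rewrite /sf_eval lsum// => k; exact: sf_in.
  rewrite H2; apply: eq_bigr => k _.
  rewrite RintegralZr//; last first.
    apply: (@itg_bounded _ _ _ 1) => //.
      by apply: measurable_indic; exact: sf_measurable.
    by move=> t _; rewrite indicE; case: (_ \in _); rewrite ?normr1// normr0.
  congr (_ * _); rewrite /Rintegral integral_indic//; exact: sf_measurable.
have dist n : (\int[mu]_(t in D) ((`|C| + 1)^-1 * `|l (sf_eval (h n) t) - g t|)%:E <=
    \int[mu]_(t in D) (N (sf_eval (h n) t - f t))%:E)%E.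
  rewrite integral_mkcond [leRHS]integral_mkcond; apply: ge0_le_integral_ae.
  - by move=> t; rewrite /patch; case: ifP => // _; rewrite lee_fin mulr_ge0// invr_ge0 ltW.
  - by move=> t; rewrite /patch; case: ifP => // _; rewrite lee_fin.
  have := ae_and gE Sf; apply: filterS => t [gt Sft]; rewrite /patch; case: ifPn => // /set_mem Dt.
  rewrite lee_fin -gt// ler_pdivrMl//.
  have -> : l (sf_eval (h n) t) - l (f t) = l (sf_eval (h n) t - f t).
    have := llin (-1) _ _ (Sft Dt) (sf_eval_in (h n) t).
    by rewrite scaleN1r addrC => ->; ring.
  apply: (le_trans (lC _ (S_sub (sf_eval_in _ _) (Sft Dt)))).
  by rewrite ler_wpM2r// (le_trans (ler_norm C))// lerDl.
have lm n : measurable_fun D (fun t => l (sf_eval (h n) t) - g t).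
  by apply: measurable_funB => //; exact: itg_meas (lhi n).
have [n0 n0i] : exists n0, (\int[mu]_(t in D) (N (sf_eval (h n0) t - f t))%:E < +oo)%E.
  have /fine_cvgP[[n0 _ fin_n0] _] := hint.
  by exists n0; have := fin_n0 n0 (leqnn n0); rewrite ge0_fin_numE// integral_ge0// => t _; rewrite lee_fin.
have gi : itg D g.
  have di : itg D (fun t => (`|C| + 1)^-1 * `|l (sf_eval (h n0) t) - g t|).
    apply/integrableP; split.
      by apply/measurable_EFinP; apply: measurable_funM => //; apply: measurableT_comp => //; exact: lm.
    apply: le_lt_trans n0i; apply: le_trans (dist n0).
    rewrite le_eqVlt; apply/orP; left; apply/eqP; apply: eq_integral => t _ /=.
    by rewrite ger0_norm// mulr_ge0// invr_ge0 ltW.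
  have di' : itg D (fun t => `|l (sf_eval (h n0) t) - g t|).
    apply: itg_eq (itgZ (`|C| + 1) mD di) => // t _.
    by rewrite mulrA mulfV ?gt_eqF// mul1r.
  have di2 : itg D (fun t => l (sf_eval (h n0) t) - g t) by apply: itg_le di'.
  by apply: itg_eq (itgB mD (lhi n0) di2) => // t _; ring.
have cvg1 : \int[mu]_(t in D) l (sf_eval (h n) t) @[n --> \oo] --> \int[mu]_(t in D) g t.
  have /fine_cvgP[fin_n cvn] := hint.
  apply/cvgrPdist_lt => e e0.
  have e0' : 0 < e / (`|C| + 1) by exact: divr_gt0.
  move/cvgrPdist_lt : cvn => /(_ _ e0') cvn.
  near=> n.
  have fn : (\int[mu]_(t in D) (N (sf_eval (h n) t - f t))%:E)%E \is a fin_num by near: n.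
  have : `|0 - fine (\int[mu]_(t in D) (N (sf_eval (h n) t - f t))%:E)%E| < e / (`|C| + 1) by near: n.
  rewrite sub0r normrN ltr_pdivlMr// => h1.
  have di : itg D (fun t => l (sf_eval (h n) t) - g t) by exact: itgB.
  have dni := itg_norm mD di.
  have Bi := @RintegralB _ _ _ mu D _ _ mD (lhi n) gi.
  rewrite distrC -Bi; apply: (le_lt_trans (@le_normr_Rintegral _ _ _ mu D _ mD di)).
  apply: le_lt_trans h1; apply: (le_trans _ (ler_wpM2r (ltW C0) (ler_norm _))).
  have sci := itgZ (`|C| + 1)^-1 mD dni.
  have -> : \int[mu]_(t in D) `|l (sf_eval (h n) t) - g t| =
      (\int[mu]_(t in D) ((`|C| + 1)^-1 * `|l (sf_eval (h n) t) - g t|)) * (`|C| + 1).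
    by rewrite RintegralZl// mulrAC mulVf ?gt_eqF// mul1r.
  rewrite ler_wpM2r ?(ltW C0)//; apply: fine_le => //.
  exact: (@integrable_fin_num _ _ _ mu D mD _ sci).
have cvg2 : \int[mu]_(t in D) l (sf_eval (h n) t) @[n --> \oo] --> l z.
  under eq_fun do rewrite lhE.
  by apply: cl => // n; apply: S_sum => k; exact: sf_in.
by rewrite -(cvg_lim (@Rhausdorff R) cvg1); apply: cvg_lim.
Unshelve. all: end_near. Qed.

(** A bounded functional commutes with the two Bochner integrals that define
    the derivative. *)
Lemma time_derivative_weak (T : R) f g (l : E -> R) (C : R) :
  {ae mu, forall t, `]0, T[%classic t -> S (f t)} ->
  {ae mu, forall t, `]0, T[%classic t -> S (g t)} ->
  (forall (k : R) u v, S u -> S v -> l (k *: u + v) = k * l u + l v) ->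
  (forall u, S u -> `|l u| <= C * N u) ->
  time_derivative S N T f g -> weak_derivative 0 T (fun t => l (f t)) (fun t => l (g t)).
Proof.
move=> Sf Sg llin lC fg phi tphi; have [z fz gz] := fg phi tphi.
have mT : measurable (`]0, T[%classic : set R) by exact: measurable_itv.
have l0 : l 0 = 0 by have := llin (-1) 0 0 S0 S0; rewrite scaler0 addr0; lra.
have lZ k u : S u -> l (k *: u) = k * l u.
  by move=> Su; rewrite -[k *: u]addr0 llin// l0 addr0.
have SZ (p : R -> R) (e : R -> E) : {ae mu, forall t, `]0, T[%classic t -> S (e t)} ->
    {ae mu, forall t, `]0, T[%classic t -> S (p t *: e t)}.
  by apply: filterS => t h /h; exact: S_scal.
have E1 := bochner_integral_functional mT (lebesgue_itv_lty 0 T) (SZ (derive1 phi) f Sf) llin lC fz.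
have E2 := bochner_integral_functional mT (lebesgue_itv_lty 0 T) (SZ phi g Sg) llin lC gz.
have lzN : l (- z) = - l z by rewrite -scaleN1r lZ ?mulN1r//; case: fz.
transitivity (l z); last rewrite -[LHS]opprK -lzN -E2.
  rewrite -E1; apply: eq_Rintegral_ae; apply: filterS Sf => t h /h Sft.
  by rewrite lZ// mulrC.
congr (- _); apply: eq_Rintegral_ae; apply: filterS Sg => t h /h Sgt.
by rewrite lZ// mulrC.
Qed.

Lemma norm_continuous_le (S' : set E) (N' : E -> R) (C : R) Psi :
  (forall u, S u -> S' u) -> (forall u, 0 <= N' u) -> (forall u, S u -> N' u <= C * N u) ->
  norm_continuous S' N' Psi -> N_continuous Psi.
Proof.
move=> SS N'0 NC cPsi u_ u Su_ Su c; apply: cPsi; [by move=> n; exact: SS|exact: SS|].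
apply: (@squeeze_cvgr _ _ _ _ (cst 0) (fun n => C * N (u_ n - u))); last 2 first.
- exact: cvg_cst.
- by rewrite -[X in _ --> X](mulr0 C); apply: cvgM => //; exact: cvg_cst.
by apply: nearW => n; rewrite N'0/=; apply: NC; exact: S_sub.
Qed.

End Bochner.

#[local] Opaque weak_derivative in_L2 right_trace left_trace.

(** * The spaces H and V of the cracked arch *)

(** Copies of the inner product, the derivative and the jump that conversion
    does not unfold: their definitions are integrals and choices, which
    unification would otherwise compare structurally. The norms are restated
    in terms of these copies. *)
HB.lock Definition ip (R : realType) (m : nat) (x : nat -> R) (u v : R -> R) : R :=
  inner_H m x u v.
HB.lock Definition dv (R : realType) (m : nat) (x : nat -> R) (u : R -> R) : R -> R :=
  pw_deriv m x u.
HB.lock Definition jp (R : realType) (u : R -> R) (a : R) : R := jump u a.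
Definition nH (R : realType) m (x : nat -> R) (u : R -> R) : R := Num.sqrt (ip m x u u).
Definition iV (R : realType) m (x : nat -> R) (u v : R -> R) : R :=
  ip m x (dv m x (dv m x u)) (dv m x (dv m x v)) +
  \sum_(1 <= i < m.+1) jp (dv m x u) (x i) * jp (dv m x v) (x i).
Definition nV (R : realType) m (x : nat -> R) (u : R -> R) : R := Num.sqrt (iV m x u u).

Lemma ipE (R : realType) m (x : nat -> R) : inner_H m x = ip m x.
Proof. by rewrite ip.unlock. Qed.

Lemma dvE (R : realType) m (x : nat -> R) : pw_deriv m x = dv m x.
Proof. by rewrite dv.unlock. Qed.

Lemma jpE (R : realType) : @jump R = @jp R.
Proof. by rewrite jp.unlock. Qed.

Lemma nHE (R : realType) m (x : nat -> R) : norm_H m x = nH m x.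
Proof. by rewrite /nH -ipE. Qed.

Lemma iVE (R : realType) m (x : nat -> R) : inner_V m x = iV m x.
Proof. by rewrite /iV -jpE -ipE -dvE. Qed.

Lemma nVE (R : realType) m (x : nat -> R) : norm_V m x = nV m x.
Proof. by rewrite /nV -iVE. Qed.

Section Arch.
Context {R : realType}.
Local Notation mu := (@lebesgue_measure R).
Variables (m : nat) (x : nat -> R).
Hypothesis x_first : x 0%N = 0.
Hypothesis x_last : x m.+1 = pi.
Hypothesis x_incr : forall i, (i <= m)%N -> x i < x i.+1.
Implicit Types (u v w f g h : R -> R) (s t k : R).

Local Notation I := (`]0, pi[%classic : set R).
Local Notation in_H := (in_H m x).
Local Notation inner_H := (ip m x).
Local Notation norm_H := (nH m x).
Local Notation D := (dv m x).
Local Notation jump := (@jp R).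
Local Notation is_D := (is_pw_deriv m x).
Local Notation in_V := (in_V m x).
Local Notation norm_V := (nV m x).

Lemma x_mono i j : (i <= j)%N -> (j <= m.+1)%N -> x i <= x j.
Proof.
elim: j => [|j IH]; first by rewrite leqn0 => /eqP ->.
rewrite leq_eqVlt => /predU1P[->//|]; rewrite ltnS => ij jm.
by rewrite (le_trans (IH ij (ltnW jm)))// ltW// x_incr.
Qed.

Lemma x_ge0 i : (i <= m.+1)%N -> 0 <= x i.
Proof. by move=> im; rewrite -x_first x_mono. Qed.

Lemma x_le_pi i : (i <= m.+1)%N -> x i <= pi.
Proof. by move=> im; rewrite -x_last x_mono. Qed.

Lemma x_lt i : (1 <= i <= m.+1)%N -> x i.-1 < x i.
Proof. by case: i => // i /= im; exact: x_incr. Qed.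

Lemma piece_sub i : (1 <= i <= m.+1)%N -> piece x i `<=` I.
Proof.
move=> /andP[i1 im]; apply: subset_itv; rewrite bnd_simp ?x_le_pi//.
by rewrite x_ge0// (leq_trans (leq_pred _)).
Qed.

Lemma ae_pieces (P : R -> Prop) :
  (forall i, (1 <= i <= m.+1)%N -> {ae mu, forall s, piece x i s -> P s}) ->
  {ae mu, forall s, I s -> P s}.
Proof.
move=> HP.
have H n : (n <= m.+1)%N -> {ae mu, forall s, `]0, (x n)[%classic s -> P s}.
  elim: n => [_|n IH nm].
    by apply: aeW => s; rewrite x_first set_itv_ge ?bnd_simp.
  have := ae_and (ae_set1 (x n)) (ae_and (IH (ltnW nm)) (HP n.+1 nm)).
  apply: filterS => s [sn [h1 h2]]; rewrite /= in_itv/= => /andP[s0 sn1].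
  have [sx|xs|sx] := ltgtP s (x n); last by case: (sn sx).
    by apply: h1; rewrite /= in_itv/= s0.
  by apply: h2; rewrite /piece/= in_itv/= xs.
by rewrite -x_last; exact: H.
Qed.

Lemma itg_setU (A B : set R) f : measurable A -> measurable B ->
  itg A f -> itg B f -> itg (A `|` B) f.
Proof.
move=> mA mB fA fB; have mAB : measurable (A `|` B) by exact: measurableU.
have mf : measurable_fun (A `|` B) f.
  by apply/measurable_funU => //; split; exact: itg_meas.
have := itgD measurableT (itg_norm measurableT (itg_mkcond mA fA)) (itg_norm measurableT (itg_mkcond mB fB)).
move=> h; have {}h : itg (A `|` B) (fun s => `|(f \_ A) s| + `|(f \_ B) s|) by apply: itgS h.
apply: itg_le h => // s [As|Bs]; rewrite {1}/patch.
  by rewrite mem_set// lerDl.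
by rewrite [f \_ B]/patch [in X in _ + X]mem_set// lerDr.
Qed.

Lemma itg_pieces f : (forall i, (1 <= i <= m.+1)%N -> itg (piece x i) f) -> itg I f.
Proof.
move=> Hf; rewrite -x_last.
have H n : (n <= m.+1)%N -> itg `]0, (x n)[%classic f.
  elim: n => [_|n IH nm].
    by rewrite x_first set_itv_ge ?bnd_simp//; exact: integrable_set0.
  have f1 : itg [set x n] f.
    apply: (@itg_bounded _ _ _ `|f (x n)|) => //.
    - by rewrite lebesgue_measure_set1.
    - exact: measurable_fun_set1.
    - by move=> s ->.
  have := itg_setU (measurable_itv _) (measurableU _ _ (measurable_set1 (x n)) (measurable_itv _)) (IH (ltnW nm)) (itg_setU (measurable_set1 _) (measurable_itv _) f1 (Hf n.+1 nm)).
  apply: itgS => //; first by do ?apply: measurableU.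
  move=> s; rewrite /= !in_itv/= => /andP[s0 sn1].
  have [sx|xs|sx] := ltgtP s (x n).
  - by left; rewrite s0.
  - by right; right.
  - by right; left.
exact: H.
Qed.

Lemma Rintegral_pieces f : itg I f ->
  \sum_(1 <= i < m.+2) \int[mu]_(s in piece x i) f s = \int[mu]_(s in I) f s.
Proof.
move=> fi; rewrite -x_last -/(prim 0 f (x m.+1)).
have H n : (n <= m.+1)%N ->
    \sum_(1 <= i < n.+1) \int[mu]_(s in piece x i) f s = prim 0 f (x n).
  elim: n => [_|n IH nm]; first by rewrite big_nil x_first prim_at.
  rewrite big_nat_recr//= IH; last exact: ltnW.
  rewrite [RHS](@prim_split _ 0 pi f (x n))//.
  - exact: x_ge0 (ltnW nm).
  - by rewrite ltW// x_incr.
  - exact: x_le_pi.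
exact: H.
Qed.

(** The crack positions form a null set. *)
Lemma in_HP u : in_H u <-> sqi I u.
Proof.
split=> [uH|uI i im].
  have uH' i (im : (1 <= i <= m.+1)%N) := (in_L2P u (measurable_itv `]x i.-1, x i[)).1 (uH i im).
  split.
    apply: itg_meas; apply: itg_pieces => i im; apply: sqi_itg (uH' i im) => //.
    exact: lebesgue_itv_lty.
  by apply: itg_pieces => i im; exact: (uH' i im).2.
apply/in_L2P; first exact: measurable_itv.
by apply: sqiS uI; [| |exact: piece_sub]; exact: measurable_itv.
Qed.

Lemma inner_HE u v : in_H u -> in_H v -> inner_H u v = \int[mu]_(s in I) (u s * v s).
Proof.
by move=> /in_HP uI /in_HP vI; rewrite -ipE /Defs.inner_H Rintegral_pieces//; exact: sqiM.
Qed.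

Lemma inner_H_ae u u' v v' : {ae mu, forall s, I s -> u s = u' s} ->
  {ae mu, forall s, I s -> v s = v' s} -> inner_H u v = inner_H u' v'.
Proof.
move=> uu vv; rewrite -ipE; apply: eq_big_nat => i; rewrite ltnS => im; apply: eq_Rintegral_ae.
have := ae_and uu vv; apply: filterS => s [us vs] si.
by rewrite us ?vs//; exact: piece_sub si.
Qed.

Lemma inner_H_aer u v v' : {ae mu, forall s, I s -> v s = v' s} -> inner_H u v = inner_H u v'.
Proof. by move=> vv; apply: inner_H_ae vv; exact: aeW. Qed.

Lemma in_H_lin k u v : in_H u -> in_H v -> in_H (k *: u + v).
Proof. by move=> /in_HP uI /in_HP vI; apply/in_HP; exact: sqi_lin. Qed.

Lemma inner_H_lin k u v w : in_H u -> in_H v -> in_H w ->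
  inner_H (k *: u + v) w = k * inner_H u w + inner_H v w.
Proof.
move=> uH vH wH; rewrite !inner_HE//; last exact: in_H_lin.
move/in_HP : uH => uI; move/in_HP : vH => vI; move/in_HP : wH => wI.
rewrite -RintegralZl//; last exact: sqiM.
rewrite -RintegralD//; [|by apply: itgZ => //; exact: sqiM|exact: sqiM].
by apply: eq_Rintegral => s _; rewrite !fctE /GRing.scale/=; ring.
Qed.

Lemma inner_H_sym u v : inner_H u v = inner_H v u.
Proof.
by rewrite -ipE; apply: eq_bigr => i _; apply: eq_Rintegral => s _; rewrite mulrC.
Qed.

Lemma inner_H_ge0 u : 0 <= inner_H u u.
Proof. by rewrite -ipE; apply: sumr_ge0 => i _; apply: Rintegral_ge0 => s _; rewrite -expr2 sqr_ge0. Qed.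

Lemma inner_H_linr k u v w : in_H u -> in_H v -> in_H w ->
  inner_H w (k *: u + v) = k * inner_H w u + inner_H w v.
Proof. by move=> uH vH wH; rewrite inner_H_sym inner_H_lin// ![inner_H w _]inner_H_sym. Qed.

Lemma cauchy_schwarz_H u v : in_H u -> in_H v -> `|inner_H u v| <= norm_H u * norm_H v.
Proof.
exact: (sip_CS in_H_lin inner_H_lin (fun u v _ _ => inner_H_sym u v) (fun u _ => inner_H_ge0 u)).
Qed.

Lemma norm_H_sqr u : norm_H u ^+ 2 = inner_H u u.
Proof. by rewrite /nH sqr_sqrtr// inner_H_ge0. Qed.

Lemma norm_H_ge0 u : 0 <= norm_H u. Proof. exact: sqrtr_ge0. Qed.

Lemma norm_H_lin k u v : in_H u -> in_H v -> norm_H (k *: u + v) <= `|k| * norm_H u + norm_H v.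
Proof.
exact: (sip_normZ_D in_H_lin inner_H_lin (fun u v _ _ => inner_H_sym u v) (fun u _ => inner_H_ge0 u)).
Qed.

Lemma in_H_bounded u (M : R) : measurable_fun I u -> (forall s, I s -> `|u s| <= M) -> in_H u.
Proof.
by move=> um uM; apply/in_HP; apply: sqi_bounded uM => //; exact: lebesgue_itv_lty.
Qed.

Lemma in_H_cst k : in_H (cst k).
Proof. by apply: (@in_H_bounded _ `|k|). Qed.

Lemma in_H0 : in_H 0. Proof. exact: (in_H_cst 0). Qed.

(** u is H^1 on each piece, with derivative g. *)
Definition H1 u g := in_H u /\ is_D u g.

Lemma H1_sob u g i : H1 u g -> (1 <= i <= m.+1)%N -> sob (x i.-1) (x i) u g.
Proof.
move=> [/in_HP uH [/in_HP gH ug]] im; split; last exact: ug.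
  by apply: sqiS uH; [| |exact: piece_sub]; exact: measurable_itv.
by apply: sqiS gH; [| |exact: piece_sub]; exact: measurable_itv.
Qed.

Lemma D_uniq u g g' : is_D u g -> is_D u g' -> {ae mu, forall s, I s -> g s = g' s}.
Proof.
move=> [/in_HP gH ug] [/in_HP gH' ug']; apply: ae_pieces => i im.
have gi f : sqi I f -> itg (piece x i) f.
  move=> fI; apply: sqi_itg; [exact: measurable_itv|exact: lebesgue_itv_lty|].
  by apply: sqiS fI; [| |exact: piece_sub]; exact: measurable_itv.
exact: (weak_derivative_uniq (gi _ gH) (gi _ gH') (ug i im) (ug' i im)).
Qed.

(** D u is a choice; any weak derivative serves to identify it a.e. *)
Lemma D_spec u g : is_D u g -> is_D u (D u) /\ {ae mu, forall s, I s -> D u s = g s}.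
Proof.
move=> ug; have uD : is_D u (D u) by rewrite -dvE /pw_deriv; case: xgetP => [g' _ //|/(_ g)].
by split => //; exact: D_uniq uD ug.
Qed.

Lemma H1_D u g : H1 u g -> H1 u (D u).
Proof. by move=> [uH /D_spec[]]. Qed.

Lemma H1_in_H u g : H1 u g -> in_H g. Proof. by move=> [_ []]. Qed.

Lemma is_D_ae u u' g g' : in_H g' -> {ae mu, forall s, I s -> u s = u' s} ->
  {ae mu, forall s, I s -> g s = g' s} -> is_D u g -> is_D u' g'.
Proof.
move=> gH' uu gg [gH ug]; split => // i im.
apply: eq_weak_derivative (ug i im); [apply: filterS uu|apply: filterS gg] => s h si;
  by apply: h; exact: piece_sub si.
Qed.

Lemma H1_lin k u g v h : H1 u g -> H1 v h -> H1 (k *: u + v) (k *: g + h).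
Proof.
move=> ug vh; have [uH [gH _]] := ug; have [vH [hH _]] := vh; split; first exact: in_H_lin.
split; first exact: in_H_lin.
move=> i im; exact: (weak_derivative_lin k (H1_sob ug im) (H1_sob vh im)).
Qed.

Lemma D_lin k u g v h : H1 u g -> H1 v h ->
  {ae mu, forall s, I s -> D (k *: u + v) s = (k *: D u + D v) s}.
Proof.
by move=> /H1_D ug /H1_D vh; have [_ /D_spec[]] := H1_lin k ug vh.
Qed.

Lemma jump_lin k u g v h i : H1 u g -> H1 v h -> (1 <= i <= m)%N ->
  jump (k *: u + v) (x i) = k * jump u (x i) + jump v (x i).
Proof.
move=> ug vh /andP[i1 im].
have il : (1 <= i <= m.+1)%N by rewrite i1 leqW.
have ir : (1 <= i.+1 <= m.+1)%N by [].
have [_ lE] := traces_lin (x_lt il) k (H1_sob ug il) (H1_sob vh il).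
have [rE _] := traces_lin (x_lt ir) k (H1_sob ug ir) (H1_sob vh ir).
by rewrite -jpE /Defs.jump lE rE; ring.
Qed.

Lemma jump_ae u v g i : H1 u g -> {ae mu, forall s, I s -> u s = v s} -> (1 <= i <= m)%N ->
  jump v (x i) = jump u (x i) /\ right_trace v (x i) = right_trace u (x i).
Proof.
move=> ug uv /andP[i1 im].
have il : (1 <= i <= m.+1)%N by rewrite i1 leqW.
have ir : (1 <= i.+1 <= m.+1)%N by [].
have uvi j : (1 <= j <= m.+1)%N -> {ae mu, forall s, `](x j.-1), (x j)[%classic s -> u s = v s}.
  by move=> jm; apply: filterS uv => s h /(piece_sub jm)/h.
have [_ lE] := eq_traces (x_lt il) (H1_sob ug il) (uvi _ il).
have [rE _] := eq_traces (x_lt ir) (H1_sob ug ir) (uvi _ ir).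
by rewrite -jpE /Defs.jump lE rE.
Qed.

Lemma in_V_H1 u : in_V u -> H1 u (D u) /\ H1 (D u) (D (D u)).
Proof.
move=> [[uH [u1 [uu1 [u2 uu2]]]] _ _ _].
have [uD Du] := D_spec uu1.
have H : H1 u (D u) by [].
have DH := H1_in_H H.
split; first exact: H.
apply: (@H1_D _ u2); split; first exact: DH.
have u2H : in_H u2 by have [] := uu2.
apply: is_D_ae uu2 => //; last exact: aeW.
by apply: filterS Du => s h /h.
Qed.

Lemma in_V_H u : in_V u -> in_H u. Proof. by case/in_V_H1 => -[]. Qed.
Lemma in_V_DH u : in_V u -> in_H (D u). Proof. by case/in_V_H1 => _ []. Qed.
Lemma in_V_DDH u : in_V u -> in_H (D (D u)). Proof. by case/in_V_H1 => _ [_ []]. Qed.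

Lemma in_V_intro u u1 u2 : H1 u u1 -> H1 u1 u2 -> right_trace u 0 = 0 -> left_trace u pi = 0 ->
  (forall i, (1 <= i <= m)%N -> jump u (x i) = 0) -> in_V u.
Proof.
move=> [uH uu1] [_ u12] u0 upi uj; split; [|exact: u0|exact: upi|by rewrite jpE].
by split; [exact: uH|exists u1; split; [exact: uu1|exists u2; exact: u12]].
Qed.

Lemma in_V_lin k u v : in_V u -> in_V v -> in_V (k *: u + v).
Proof.
move=> uV vV; have [uD uDD] := in_V_H1 uV; have [vD vDD] := in_V_H1 vV.
have [_ u0 upi] := uV; have [_ v0 vpi] := vV; rewrite jpE => vj uj.
apply: (in_V_intro (H1_lin k uD vD) (H1_lin k uDD vDD)).
- have [] := traces_lin (x_lt (isT : (1 <= 1 <= m.+1)%N)) k (H1_sob uD (isT : (1 <= 1 <= m.+1)%N)) (H1_sob vD (isT : (1 <= 1 <= m.+1)%N)).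
  by rewrite /= x_first u0 v0 mulr0 addr0.
- have mm : (1 <= m.+1 <= m.+1)%N by rewrite leqnn.
  have [] := traces_lin (x_lt mm) k (H1_sob uD mm) (H1_sob vD mm).
  by rewrite x_last upi vpi mulr0 addr0.
- by move=> i im; rewrite (jump_lin k uD vD im) uj// vj// mulr0 addr0.
Qed.

Lemma DD_lin k u v : in_V u -> in_V v ->
  {ae mu, forall s, I s -> D (D (k *: u + v)) s = (k *: D (D u) + D (D v)) s}.
Proof.
move=> uV vV; have [uD uDD] := in_V_H1 uV; have [vD vDD] := in_V_H1 vV.
have kuvV := in_V_lin k uV vV; have [_ [_ H]] := in_V_H1 kuvV.
have [_ H2] := H1_lin k uDD vDD.
apply: (@D_uniq (k *: D u + D v)) => //.
have DH := in_V_DDH kuvV.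
apply: is_D_ae H => //; last exact: aeW.
exact: D_lin uD vD.
Qed.

Lemma jumpD_lin k u v i : in_V u -> in_V v -> (1 <= i <= m)%N ->
  jump (D (k *: u + v)) (x i) = k * jump (D u) (x i) + jump (D v) (x i).
Proof.
move=> uV vV im; have [uD uDD] := in_V_H1 uV; have [vD vDD] := in_V_H1 vV.
rewrite -(jump_lin k uDD vDD im).
have [|-> //] := jump_ae (v := D (k *: u + v)) (H1_lin k uDD vDD) _ im.
by apply: filterS (D_lin k uD vD) => s h /h.
Qed.

Lemma innerD_lin k u v w : in_V u -> in_V v -> in_V w ->
  inner_H (D (k *: u + v)) (D w) = k * inner_H (D u) (D w) + inner_H (D v) (D w).
Proof.
move=> uV vV wV; have [uD _] := in_V_H1 uV; have [vD _] := in_V_H1 vV.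
rewrite -inner_H_lin; [|exact: in_V_DH..].
by apply: inner_H_ae; [exact: D_lin uD vD|exact: aeW].
Qed.

Lemma innerDD_lin k u v w : in_V u -> in_V v -> in_V w ->
  inner_H (D (D (k *: u + v))) (D (D w)) = k * inner_H (D (D u)) (D (D w)) + inner_H (D (D v)) (D (D w)).
Proof.
move=> uV vV wV; rewrite -inner_H_lin; [|exact: in_V_DDH..].
by apply: inner_H_ae; [exact: DD_lin|exact: aeW].
Qed.

Lemma inner_V_lin k u v w : in_V u -> in_V v -> in_V w ->
  iV m x (k *: u + v) w = k * iV m x u w + iV m x v w.
Proof.
move=> uV vV wV; rewrite /iV.
rewrite (innerDD_lin k uV vV wV).
have -> : \sum_(1 <= i < m.+1) jump (D (k *: u + v)) (x i) * jump (D w) (x i) =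
   k * (\sum_(1 <= i < m.+1) jump (D u) (x i) * jump (D w) (x i)) +
   \sum_(1 <= i < m.+1) jump (D v) (x i) * jump (D w) (x i).
  rewrite mulr_sumr -big_split/=; apply: eq_big_nat => i im.
  by rewrite jumpD_lin//; ring.
by ring.
Qed.

Lemma inner_V_sym u v : iV m x u v = iV m x v u.
Proof.
rewrite /iV.
rewrite (inner_H_sym (D (D u))).
congr (_ + _).
apply: eq_bigr => i _.
by rewrite mulrC.
Qed.

Lemma inner_V_ge0 u : 0 <= iV m x u u.
Proof.
by rewrite addr_ge0 ?inner_H_ge0//; apply: sumr_ge0 => i _; rewrite -expr2 sqr_ge0.
Qed.

Lemma norm_V_ge0 u : 0 <= norm_V u. Proof. exact: sqrtr_ge0. Qed.

Lemma norm_V_lin k u v : in_V u -> in_V v -> norm_V (k *: u + v) <= `|k| * norm_V u + norm_V v.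
Proof.
exact: (sip_normZ_D in_V_lin inner_V_lin (fun u v _ _ => inner_V_sym u v) (fun u _ => inner_V_ge0 u)).
Qed.

Lemma norm_V_Z k u : in_V u -> norm_V (k *: u) = `|k| * norm_V u.
Proof.
move=> uV; have V0 : in_V 0 by have := in_V_lin (-1) uV uV; rewrite scaleN1r addNr.
have I0 w : in_V w -> iV m x 0 w = 0.
  by move=> wV; have := inner_V_lin (-1) V0 V0 wV; rewrite scaler0 addr0; lra.
rewrite -[k *: u]addr0 /nV.
rewrite (sip_expand in_V_lin inner_V_lin (fun u v _ _ => inner_V_sym u v))//.
rewrite [iV m x u 0]inner_V_sym !I0// mulr0 !addr0 sqrtrM ?sqr_ge0//.
by rewrite sqrtr_sqr.
Qed.

Lemma norm_DD_le u : norm_H (D (D u)) <= norm_V u.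
Proof.
rewrite /nV /nH ler_wsqrtr// lerDl.
by apply: sumr_ge0 => i _; rewrite -expr2 sqr_ge0.
Qed.

Lemma jump_le u i : (1 <= i <= m)%N -> `|jump (D u) (x i)| <= norm_V u.
Proof.
move=> im; rewrite -sqrtr_sqr ler_wsqrtr// /iV.
rewrite (bigD1_seq i) ?mem_index_iota ?iota_uniq//=.
rewrite addrCA -expr2 lerDl addr_ge0 ?inner_H_ge0//.
by apply: sumr_ge0 => j _; rewrite -expr2 sqr_ge0.
Qed.

Let one_in : (1 <= 1 <= m.+1)%N := isT.

Lemma itg_in_H f : in_H f -> itg I f.
Proof. by move=> /in_HP; apply: sqi_itg; [exact: measurable_itv|exact: lebesgue_itv_lty]. Qed.

(** An element of V vanishes at 0 and is continuous across the cracks, hence it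
    is the primitive of its piecewise derivative on the whole of ]0, pi[. *)
Lemma in_V_traces u i : in_V u -> (i <= m)%N ->
  right_trace u (x i) = prim 0 (D u) (x i) /\ left_trace u (x i.+1) = prim 0 (D u) (x i.+1).
Proof.
move=> uV; have [uD _] := in_V_H1 uV; have Di := itg_in_H (in_V_DH uV).
have [_ u0 upi] := uV; rewrite jpE => uj.
have left_of j : (j <= m)%N -> right_trace u (x j) = prim 0 (D u) (x j) ->
    left_trace u (x j.+1) = prim 0 (D u) (x j.+1).
  move=> jm rj; have jm1 : (1 <= j.+1 <= m.+1)%N by [].
  have [_ ->] := sob_prim (x_lt jm1) (H1_sob uD jm1); rewrite /= rj.
  rewrite [RHS](@prim_split _ 0 pi _ (x j))//.
  - exact/x_ge0/leqW.
  - by rewrite ltW// x_incr.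
  - exact: x_le_pi.
elim: i => [|i IH] im.
  have r0 : right_trace u (x 0%N) = prim 0 (D u) (x 0%N) by rewrite x_first u0 prim_at.
  by split => //; exact: left_of.
have [_ li] := IH (ltnW im).
have ri : right_trace u (x i.+1) = prim 0 (D u) (x i.+1).
  have := uj i.+1 im; rewrite -jpE /Defs.jump => /eqP; rewrite subr_eq0 => /eqP ->.
  exact: li.
by split => //; exact: left_of.
Qed.

Lemma in_V_prim u : in_V u -> {ae mu, forall s, I s -> u s = prim 0 (D u) s}.
Proof.
move=> uV; have [uD _] := in_V_H1 uV; have Di := itg_in_H (in_V_DH uV).
apply: ae_pieces => -[//|i] im.
have [uE _] := sob_prim (x_lt im) (H1_sob uD im).
apply: filterS uE => s us si; rewrite us//=.
have [-> _] := in_V_traces uV (im : (i <= m)%N).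
move: si; rewrite /piece /= in_itv/= => /andP[xs sx].
rewrite [RHS](@prim_split _ 0 pi _ (x i))//.
- exact/x_ge0/leqW.
- exact: ltW.
- by rewrite ltW// (lt_le_trans sx)// x_le_pi.
Qed.

Lemma in_V_prim_pi u : in_V u -> prim 0 (D u) pi = 0.
Proof.
move=> uV; have [_ _ upi _] := uV.
by rewrite -x_last; have [_ <-] := in_V_traces uV (leqnn m); rewrite x_last.
Qed.

(** The continuous representative of u on [0, pi] is unique, and the primitive of
    D u is one. *)
Lemma delta_prim u a : in_V u -> 0 <= a -> a <= pi -> delta a u = prim 0 (D u) a.
Proof.
move=> uV a0 api; have Di := itg_in_H (in_V_DH uV).
have pi0 := pi_gt0 R.
have cP : {within `[0, pi], continuous (prim 0 (D u))} by exact: (prim_continuous (ltW pi0) Di).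
have Pu : {ae mu, forall s, `[0, pi]%classic s -> prim 0 (D u) s = u s}.
  have := ae_and (ae_and (ae_set1 0) (ae_set1 pi)) (in_V_prim uV).
  apply: filterS => s [[s0 spi] us] /=; rewrite in_itv/= => /andP[s0' spi'].
  rewrite us//= in_itv/= !lt_neqAle s0' spi' !andbT eq_sym.
  by apply/andP; split; apply/eqP.
rewrite /delta; case: xgetP => [_ -> [w [cw wu <-]]|/(_ (prim 0 (D u) a))]; last first.
  by apply: contra_notP => _; exists (prim 0 (D u)).
have wP : {ae mu, forall s, `]0, pi[%classic s -> w s = prim 0 (D u) s}.
  have := ae_and wu Pu; apply: filterS => s [h1 h2] sI.
  have sI' : `[0, pi]%classic s by move: s sI {h1 h2}; apply: subset_itv; rewrite bnd_simp.
  by rewrite h1// h2.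
have [wi w0 wpi] := (continuous_within_itvP w pi0).1 cw.
have [Pi P0 Ppi] := (continuous_within_itvP (prim 0 (D u)) pi0).1 cP.
move: a0; rewrite le_eqVlt => /predU1P[<-|a0]; first exact: cvg_right_ae_uniq pi0 wP w0 P0.
move: api; rewrite le_eqVlt => /predU1P[->|api]; first exact: cvg_left_ae_uniq pi0 wP wpi Ppi.
have aI : a \in `]0, pi[ by rewrite in_itv/= a0.
apply: (@cvg_right_ae_uniq _ w (prim 0 (D u)) a pi) => //.
- apply: filterS wP => s h sI; apply: h; move: s sI; apply: subset_itvr.
  by rewrite bnd_simp ltW.
- by apply: cvg_at_right_filter; exact: wi.
- by apply: cvg_at_right_filter; exact: Pi.
Qed.

Lemma sum_telescope (F G : nat -> R) :
  \sum_(1 <= i < m.+2) (F i - G i.-1) = F m.+1 - G 0%N + \sum_(1 <= i < m.+1) (F i - G i).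
Proof.
rewrite big_split/= sumrN big_add1/= big_nat_recr//= [X in _ - X]big_nat_recl//=.
rewrite big_split/= sumrN !big_add1/=; ring.
Qed.

(** Integration by parts on every piece; the boundary terms collect into the
    jumps of w at the cracks. *)
Lemma by_parts_V w g v : H1 w g -> in_V v ->
  inner_H g v + \sum_(1 <= i < m.+1) jump w (x i) * prim 0 (D v) (x i) = - inner_H w (D v).
Proof.
move=> wg vV; have [vD _] := in_V_H1 vV.
apply/eqP; rewrite -addr_eq0 addrAC; apply/eqP.
have E i : (1 <= i <= m.+1)%N ->
    \int[mu]_(s in piece x i) (g s * v s) + \int[mu]_(s in piece x i) (w s * D v s) =
    left_trace w (x i) * prim 0 (D v) (x i) - right_trace w (x i.-1) * prim 0 (D v) (x i.-1).
  move=> im; rewrite /piece (sob_by_parts (x_lt im) (H1_sob wg im) (H1_sob vD im)).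
  case: i im => // i im /=.
  by have [-> ->] := in_V_traces vV (im : (i <= m)%N).
rewrite -ipE /Defs.inner_H -big_split/=.
rewrite (eq_big_nat _ _ (F2 := fun i => left_trace w (x i) * prim 0 (D v) (x i) -
   right_trace w (x i.-1) * prim 0 (D v) (x i.-1))); last first.
  by move=> i im; rewrite -E.
rewrite (sum_telescope (fun i => left_trace w (x i) * prim 0 (D v) (x i))
   (fun i => right_trace w (x i) * prim 0 (D v) (x i))).
rewrite x_first x_last in_V_prim_pi// prim_at !mulr0 subrr add0r -big_split/=.
apply: big1 => i _; rewrite -jpE /Defs.jump; ring.
Qed.

(** Cauchy-Schwarz for the constant 1 and |u'|. *)
Lemma prim_D_le u s : in_V u -> 0 <= s -> s <= pi ->
  `|prim 0 (D u) s| <= norm_H (cst 1) * norm_H (D u).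
Proof.
move=> uV s0 spi; have DH := in_V_DH uV; have Di := itg_in_H DH.
apply: (le_trans (prim_bounded Di s0 spi)).
have aH : in_H (fun t => `|D u t|).
  have /in_HP[um ui] := DH; apply/in_HP; split; first exact: measurableT_comp.
  by apply: itg_eq ui => // t _; rewrite real_normK// num_real.
have -> : norm_H (D u) = norm_H (fun t => `|D u t|).
  rewrite /nH !inner_HE//; congr Num.sqrt; apply: eq_Rintegral => t _.
  by rewrite -!expr2 real_normK// num_real.
apply: le_trans (cauchy_schwarz_H (in_H_cst 1) aH); rewrite inner_HE//; last exact: in_H_cst.
apply: (le_trans _ (ler_norm _)); rewrite le_eqVlt; apply/orP; left; apply/eqP.
by apply: eq_Rintegral => t _; rewrite mul1r.
Qed.

Lemma norm_H_le_bound u (M : R) : in_H u -> 0 <= M -> {ae mu, forall s, I s -> `|u s| <= M} ->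
  norm_H u <= norm_H (cst 1) * M.
Proof.
move=> uH M0 uM; have c1 := norm_H_ge0 (cst 1).
rewrite -(ler_pXn2r (n := 2)) ?nnegrE ?norm_H_ge0 ?mulr_ge0//.
rewrite exprMn !norm_H_sqr !inner_HE//; [|exact: in_H_cst..].
rewrite -RintegralZr//; last by apply: sqiM => //; exact/in_HP/in_H_cst.
have cM : itg I (fun s => cst 1 s * cst 1 s * M ^+ 2).
  by apply: (itg_cst (1 * 1 * M ^+ 2)); [exact: measurable_itv|exact: lebesgue_itv_lty].
have uu : itg I (fun s => u s * u s) by apply: sqiM => //; exact/in_HP.
rewrite /Rintegral; apply: fine_le; [exact: (integrable_fin_num _ uu)|exact: (integrable_fin_num _ cM)|].
rewrite integral_mkcond [leRHS]integral_mkcond; apply: ge0_le_integral_ae.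
- by move=> s; rewrite /patch; case: ifP => // _; rewrite lee_fin -expr2 sqr_ge0.
- by move=> s; rewrite /patch; case: ifP => // _; rewrite lee_fin !mul1r sqr_ge0.
- apply: filterS uM => s h; rewrite /patch; case: ifPn => // /set_mem sI.
  rewrite lee_fin !mul1r -expr2 -[leLHS]real_normK ?num_real//.
  by rewrite ler_pXn2r ?nnegrE// h.
Qed.

(** c^2 + m c with c the H norm of the constant 1: the two terms bound the
    integral and the crack terms in [by_parts_V] applied to u' and u. *)
Definition poincare_cst : R := norm_H (cst 1) * norm_H (cst 1) + m%:R * norm_H (cst 1).

Lemma norm_H_le_D u : in_V u -> norm_H u <= norm_H (cst 1) * norm_H (cst 1) * norm_H (D u).
Proof.
move=> uV; rewrite -mulrA; apply: norm_H_le_bound; first exact: in_V_H.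
  by rewrite mulr_ge0// norm_H_ge0.
apply: filterS (in_V_prim uV) => s us sI; rewrite us//.
by move: sI; rewrite /= in_itv/= => /andP[s0 spi]; apply: prim_D_le => //; exact: ltW.
Qed.

(** [by_parts_V] with w = u' and v = u; S bounds u in the crack terms. *)
Lemma norm_D_sqr_le u (S : R) : in_V u ->
  (forall s, 0 <= s -> s <= pi -> `|prim 0 (D u) s| <= S) ->
  norm_H (D u) ^+ 2 <= norm_V u * norm_H u + m%:R * (norm_V u * S).
Proof.
move=> uV HS; have [uD uDD] := in_V_H1 uV.
rewrite norm_H_sqr.
have := by_parts_V uDD uV; move=> /(congr1 -%R); rewrite opprK => <-.
rewrite (le_trans (ler_norm _))// normrN (le_trans (ler_normD _ _))// lerD//.
  apply: (le_trans (cauchy_schwarz_H (in_V_DDH uV) (in_V_H uV))).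
  by rewrite ler_wpM2r ?norm_H_ge0// norm_DD_le.
apply: (le_trans (ler_norm_sum _ _ _)).
have -> : m%:R * (norm_V u * S) = \sum_(1 <= i < m.+1) (norm_V u * S).
  by rewrite sumr_const_nat subn1 mulr_natl.
rewrite big_nat_cond [leRHS]big_nat_cond; apply: ler_sum => i; rewrite andbT => im.
have im' : (i <= m.+1)%N by case/andP : im => _; exact: ltnW.
rewrite normrM ler_pM//; first exact: jump_le.
by apply: HS; [exact: x_ge0|exact: x_le_pi].
Qed.

Lemma norm_D_le u : in_V u -> norm_H (D u) <= poincare_cst * norm_V u.
Proof.
move=> uV; have P0 := norm_H_ge0 (D u); have c0 := norm_H_ge0 (cst 1).
have N0 := norm_V_ge0 u.
have HS s : 0 <= s -> s <= pi -> `|prim 0 (D u) s| <= norm_H (cst 1) * norm_H (D u).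
  exact: prim_D_le.
have := norm_D_sqr_le uV HS.
have := norm_H_le_D uV => hu.
rewrite /poincare_cst; set c := norm_H (cst 1) in c0 hu *; set P := norm_H (D u) in P0 hu *.
set N := norm_V u in N0 *; move=> h.
have {}h : P * P <= ((c * c + m%:R * c) * N) * P.
  rewrite -expr2 (le_trans h)//.
  have := ler_wpM2l N0 hu; lra.
have [P00|P_neq0] := eqVneq P 0.
  by rewrite P00 mulr_ge0// addr_ge0// mulr_ge0.
by rewrite -(ler_pM2r (_ : 0 < P))// lt_neqAle eq_sym P_neq0.
Qed.

Lemma norm_H_le u : in_V u -> norm_H u <= norm_H (cst 1) * norm_H (cst 1) * poincare_cst * norm_V u.
Proof.
move=> uV; apply: (le_trans (norm_H_le_D uV)).
by rewrite -[leRHS]mulrA ler_wpM2l ?norm_D_le// mulr_ge0// norm_H_ge0.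
Qed.

(** The square of u(s) is twice the integral of u u' over ]0, s[. *)
Lemma prim_D_sqr_le u s : in_V u -> 0 <= s -> s <= pi ->
  prim 0 (D u) s ^+ 2 <= 2 * (norm_H u * norm_H (D u)).
Proof.
move=> uV; rewrite le_eqVlt => /predU1P[<- _|s0 spi].
  by rewrite prim_at expr0n mulr_ge0// mulr_ge0// norm_H_ge0.
have DH := in_V_DH uV; have Di := itg_in_H DH; have uH := in_V_H uV.
have sub : `]0, s[%classic `<=` I by apply: subset_itvl; rewrite bnd_simp.
have Dis : itg `]0, s[%classic (D u) by apply: itgS Di.
have := prim_by_parts s0 Dis Dis.
have -> : \int[mu]_(t in `]0, s[) (D u t * prim 0 (D u) t) = \int[mu]_(t in `]0, s[) (prim 0 (D u) t * D u t).
  by apply: eq_Rintegral => t _; rewrite mulrC.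
have -> : \int[mu]_(t in `]0, s[) (prim 0 (D u) t * D u t) = \int[mu]_(t in `]0, s[) (u t * D u t).
  apply: eq_Rintegral_ae; apply: filterS (in_V_prim uV) => t h /sub tI.
  by rewrite h.
move=> E; have {E}-> : prim 0 (D u) s ^+ 2 = 2 * \int[mu]_(t in `]0, s[) (u t * D u t).
  by rewrite expr2; lra.
rewrite ler_pM2l//.
have /in_HP uI := uH; have /in_HP DI := DH.
have ui : itg I (fun t => u t * D u t) by exact: sqiM.
have uis : itg `]0, s[%classic (fun t => u t * D u t) by apply: itgS ui.
apply: (le_trans (ler_norm _)); apply: (le_trans (le_normr_Rintegral _ uis)) => //.
have aH f : in_H f -> in_H (fun t => `|f t|).
  move=> /in_HP[um uf]; apply/in_HP; split; first exact: measurableT_comp.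
  by apply: itg_eq uf => // t _; rewrite real_normK// num_real.
have nE f : in_H f -> norm_H f = norm_H (fun t => `|f t|).
  move=> fH; have := aH f fH => afH.
  rewrite /nH !inner_HE//; congr Num.sqrt; apply: eq_Rintegral => t _.
  by rewrite -!expr2 real_normK// num_real.
rewrite (nE u)// (nE (D u))//.
apply: le_trans (le_trans (ler_norm _) (cauchy_schwarz_H (aH _ uH) (aH _ DH))).
rewrite inner_HE; [|exact: aH..].
have := prim_split (itg_norm (measurable_itv _) ui) (ltW s0) spi (lexx pi).
have -> : \int[mu]_(t in I) (`|u t| * `|D u t|) = prim 0 (fun t => `|u t * D u t|) pi.
  by apply: eq_Rintegral => t _; rewrite normrM.
by move=> ->; rewrite lerDl; exact: Rintegral_ge0.
Qed.

(** With u bounded in H, the cube of the H norm of u' is of order two in the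
    norm of V: this makes the axial force integrable in time. *)
Lemma interpolation u (M : R) : in_V u -> norm_H u <= M ->
  norm_H (D u) ^+ 3 <= 1 + (4 * M ^+ 2 + 8 * m%:R ^+ 2 * M) * norm_V u ^+ 2.
Proof.
move=> uV uM; have P0 := norm_H_ge0 (D u); have N0 := norm_V_ge0 u.
have M0 : 0 <= M by exact: le_trans (norm_H_ge0 u) uM.
(* With S^2 = 2 M |u'| as a bound of u^2, [norm_D_sqr_le] reads
   |u'|^2 <= N M + m N S. One of the two terms is at least half of the left-hand
   side; the first case bounds |u'|^4 directly, the second after division by |u'|. *)
pose S := Num.sqrt (2 * (M * norm_H (D u))).
have S0 : 0 <= S by exact: sqrtr_ge0.
have MP : 0 <= 2 * (M * norm_H (D u)) by rewrite mulr_ge0// mulr_ge0.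
have S2 : S ^+ 2 = 2 * (M * norm_H (D u)) by rewrite sqr_sqrtr.
have HS s : 0 <= s -> s <= pi -> `|prim 0 (D u) s| <= S.
  move=> s0 spi; rewrite -sqrtr_sqr ler_wsqrtr// (le_trans (prim_D_sqr_le uV s0 spi))//.
  by rewrite ler_pM2l// ler_wpM2r.
have := norm_D_sqr_le uV HS.
set P := norm_H (D u) in P0 S2 *; set N := norm_V u in N0 *; move=> h.
have {h} : P ^+ 2 <= N * M + m%:R * (N * S).
  by rewrite (le_trans h)// lerD2r ler_wpM2l.
have m0 : 0 <= m%:R :> R by [].
move: (m%:R : R) m0 S S0 S2 {MP HS} => c c0 S S0 S2 h.
have P3 : P ^+ 3 = P * P ^+ 2 by rewrite exprS.
have P4 : P ^+ 4 = P ^+ 2 * P ^+ 2 by rewrite -exprD.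
have K0 : 0 <= 8 * c ^+ 2 * M * N ^+ 2.
  by rewrite !mulr_ge0// ?sqr_ge0.
have K1 : 0 <= 4 * M ^+ 2 * N ^+ 2 by rewrite !mulr_ge0// ?sqr_ge0.
have [h1|h1] := leP (P ^+ 2) (2 * (N * M)).
  have H4 : P ^+ 4 <= 4 * M ^+ 2 * N ^+ 2.
    rewrite P4 (_ : 4 * M ^+ 2 * N ^+ 2 = (2 * (N * M)) * (2 * (N * M))); last by ring.
    by rewrite ler_pM ?sqr_ge0.
  have H3 : P ^+ 3 <= 1 + P ^+ 4.
    rewrite P4 P3; have := sqr_ge0 (P - 2^-1); have := sqr_ge0 P.
    have [P1|P1] := leP P 1; nra.
  by rewrite mulrDl; lra.
have h2 : P ^+ 2 <= 2 * (c * (N * S)) by lra.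
have H4 : P ^+ 4 <= 8 * c ^+ 2 * M * N ^+ 2 * P.
  rewrite P4; have : P ^+ 2 * P ^+ 2 <= (2 * (c * (N * S))) * (2 * (c * (N * S))).
    by rewrite ler_pM ?sqr_ge0.
  rewrite (_ : 2 * _ * _ = 4 * c ^+ 2 * N ^+ 2 * S ^+ 2); last by ring.
  by rewrite S2 => H; apply: (le_trans H); rewrite le_eqVlt; apply/orP; left; apply/eqP; ring.
have H3 : P ^+ 3 <= 8 * c ^+ 2 * M * N ^+ 2.
  have [->|Pn0] := eqVneq P 0; first by rewrite expr0n.
  by rewrite -(ler_pM2r (_ : 0 < P)) -?exprSr// lt_neqAle eq_sym Pn0.
by rewrite mulrDl; lra.
Qed.

(** * Elastic form, axial force and Lagrangian *)
Section Elastic.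
Variable theta : nat -> R.

Definition elastic u v : R := inner_H (D (D u)) (D (D v)) +
  \sum_(1 <= i < m.+1) (theta i)^-1 * jump (D u) (x i) * jump (D v) (x i).

Lemma opAE u v : opA m x theta u v = elastic u v.
Proof. by rewrite /opA /elastic ipE dvE jpE. Qed.

Lemma elastic_lin k u v w : in_V u -> in_V v -> in_V w -> elastic (k *: u + v) w = k * elastic u w + elastic v w.
Proof.
move=> uV vV wV; rewrite /elastic innerDD_lin//.
have -> : \sum_(1 <= i < m.+1) (theta i)^-1 * jump (D (k *: u + v)) (x i) * jump (D w) (x i) =
   k * (\sum_(1 <= i < m.+1) (theta i)^-1 * jump (D u) (x i) * jump (D w) (x i)) +
   \sum_(1 <= i < m.+1) (theta i)^-1 * jump (D v) (x i) * jump (D w) (x i).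
  rewrite mulr_sumr -big_split/=; apply: eq_big_nat => i im.
  by rewrite jumpD_lin//; ring.
by ring.
Qed.

Lemma elastic_sym u v : elastic u v = elastic v u.
Proof.
by rewrite /elastic inner_H_sym; congr (_ + _); apply: eq_bigr => i _; rewrite -!mulrA [_ * jump _ _]mulrC.
Qed.

Definition elastic_cst : R := 1 + \sum_(1 <= i < m.+1) `|(theta i)^-1|.

Lemma elastic_le u v : in_V u -> in_V v -> `|elastic u v| <= elastic_cst * norm_V u * norm_V v.
Proof.
move=> uV vV; rewrite /elastic /elastic_cst -mulrA mulrDl mul1r (le_trans (ler_normD _ _))// lerD//.
  apply: (le_trans (cauchy_schwarz_H (in_V_DDH uV) (in_V_DDH vV))).
  by rewrite ler_pM ?norm_H_ge0// norm_DD_le.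
apply: (le_trans (ler_norm_sum _ _ _)); rewrite mulr_suml.
rewrite big_nat_cond [leRHS]big_nat_cond; apply: ler_sum => i; rewrite andbT => im.
by rewrite -mulrA normrM ler_wpM2l// normrM ler_pM// jump_le.
Qed.

Lemma elastic_cst_ge0 : 0 <= elastic_cst.
Proof. by rewrite addr_ge0// sumr_ge0. Qed.

End Elastic.

(** The axial force acts through the H_0^1 pairing of the slopes. *)
Lemma axial_pairing u v : in_V u -> in_V v ->
  (embed_H m x (D (D u)) + \sum_(1 <= i < m.+1) jump (D u) (x i) *: delta (x i)) v =
  - inner_H (D u) (D v).
Proof.
move=> uV vV; have [_ uDD] := in_V_H1 uV; rewrite -(by_parts_V uDD vV).
rewrite !fctE /embed_H ipE; congr (_ + _).
have E (l : seq nat) (F : nat -> (R -> R) -> R) :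
    (\sum_(i <- l) F i) v = \sum_(i <- l) F i v.
  by elim: l => [|i l IH]; rewrite ?big_nil// !big_cons -IH.
rewrite E; apply: eq_big_nat => i /andP[_ im].
rewrite fctE /GRing.scale/= delta_prim//; first exact/x_ge0/ltnW.
exact/x_le_pi/ltnW.
Qed.

(** Each energy is a polynomial of degree at most four in the size of the
    perturbation, by bilinearity. *)
Lemma lagrangian_expand (theta : nat -> R) (beta : R) (q u w v : R -> R) (r s : R) :
  in_H q -> in_V u -> in_H w -> in_V v ->
  lagrangian m x theta beta q (u + r *: v) (w + s *: v) - lagrangian m x theta beta q u w =
  s * inner_H w v + 2^-1 * s ^+ 2 * inner_H v v
  - r * elastic theta u v - 2^-1 * r ^+ 2 * elastic theta v v
  - (2 * pi)^-1 * (2 * (beta + 2^-1 * norm_H (D u) ^+ 2) * r * inner_H (D u) (D v)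
      + (beta + 2^-1 * norm_H (D u) ^+ 2) * r ^+ 2 * inner_H (D v) (D v)
      + (r * inner_H (D u) (D v) + 2^-1 * r ^+ 2 * inner_H (D v) (D v)) ^+ 2)
  + r * inner_H q v.
Proof.
move=> qH uV wH vV; have vH := in_V_H vV; have uH := in_V_H uV.
rewrite /lagrangian /kinetic_energy /bending_energy /axial_energy /external_work.
rewrite !nHE ipE dvE jpE.
have bE y : norm_H (D (D y)) ^+ 2 + \sum_(1 <= i < m.+1) (theta i)^-1 * `|jump (D y) (x i)| ^+ 2 = elastic theta y y.
  rewrite norm_H_sqr /elastic; congr (_ + _); apply: eq_bigr => i _.
  by rewrite real_normK ?num_real// expr2 mulrA.
rewrite !bE ![_ + _ *: v]addrC.
have EH y : in_H y -> norm_H (s *: v + y) ^+ 2 = s ^+ 2 * inner_H v v + 2 * s * inner_H v y + inner_H y y.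
  move=> yH; rewrite norm_H_sqr.
  exact: (sip_expand in_H_lin inner_H_lin (fun u v _ _ => inner_H_sym u v)).
have EA : elastic theta (r *: v + u) (r *: v + u) = r ^+ 2 * elastic theta v v + 2 * r * elastic theta v u + elastic theta u u.
  exact: (sip_expand in_V_lin (@elastic_lin theta) (fun u v _ _ => elastic_sym theta u v)).
have ED : norm_H (D (r *: v + u)) ^+ 2 = r ^+ 2 * inner_H (D v) (D v) + 2 * r * inner_H (D v) (D u) + inner_H (D u) (D u).
  rewrite norm_H_sqr.
  exact: (@sip_expand _ _ in_V (fun a b => inner_H (D a) (D b)) in_V_lin innerD_lin (fun a b _ _ => inner_H_sym (D a) (D b))).
rewrite EH// EA ED inner_H_linr// norm_H_sqr norm_H_sqr (inner_H_sym v w) (elastic_sym theta v u) (inner_H_sym (D v) (D u)).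
set a1 := inner_H w v; set a2 := inner_H v v; set a3 := inner_H w w.
set a4 := elastic theta v v; set a5 := elastic theta u v; set a6 := elastic theta u u.
set a7 := inner_H (D v) (D v); set a8 := inner_H (D u) (D v); set a9 := inner_H (D u) (D u).
set b1 := inner_H q v; set b2 := inner_H q u.
set p2 := (2 * pi)^-1.
move: a1 a2 a3 a4 a5 a6 a7 a8 a9 b1 b2 p2 => a1 a2 a3 a4 a5 a6 a7 a8 a9 b1 b2 p2.
by field.
Qed.

(** * Test functions supported in one piece *)
Section OnePiece.
Variable i : nat.
Hypothesis im : (1 <= i <= m.+1)%N.

Lemma piece_disj j s : (1 <= j <= m.+1)%N -> piece x j s -> piece x i s -> j = i.
Proof.
move=> jm; rewrite /piece /= !in_itv/= => /andP[j1 j2] /andP[i1 i2].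
have [ij|ji|//] := ltngtP i j.
- have : x i <= x j.-1.
    apply: x_mono; first by move: ij; case: j jm j1 j2.
    by case/andP : jm => _; apply: leq_trans; exact: leq_pred.
  by move=> h; have := lt_le_trans i2 h; rewrite ltNge (ltW j1).
- have : x j <= x i.-1.
    apply: x_mono; first by move: ji; case: i im i1 i2.
    by case/andP : im => _; apply: leq_trans; exact: leq_pred.
  by move=> h; have := lt_le_trans j2 h; rewrite ltNge (ltW i1).
Qed.

Lemma patch_piece (q : R -> R) j s : (1 <= j <= m.+1)%N -> piece x j s ->
  (q \_ (piece x i)) s = if j == i then q s else 0.
Proof.
move=> jm js; rewrite /patch; case: ifPn => [|].
  by rewrite inE => /(piece_disj jm js) ->; rewrite eqxx.
rewrite notin_setE => nis; case: eqP => // ji; case: nis.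
by rewrite -ji.
Qed.

Lemma patch_H1 (q q1 : R -> R) : (forall s, is_derive s 1 q (q1 s)) -> continuous q1 ->
  H1 (q \_ (piece x i)) (q1 \_ (piece x i)) /\
  forall j, (1 <= j <= m.+1)%N ->
    right_trace (q \_ (piece x i)) (x j.-1) = (if j == i then q (x j.-1) else 0) /\
    left_trace (q \_ (piece x i)) (x j) = (if j == i then q (x j) else 0).
Proof.
move=> dq cq1.
have S j : (1 <= j <= m.+1)%N -> exists f g : R -> R,
   [/\ sob (x j.-1) (x j) f g, right_trace f (x j.-1) = (if j == i then q (x j.-1) else 0),
       left_trace f (x j) = (if j == i then q (x j) else 0),
       (forall s, piece x j s -> (q \_ (piece x i)) s = f s) &
       (forall s, piece x j s -> (q1 \_ (piece x i)) s = g s)].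
  move=> jm; have [ji|ji] := eqVneq j i.
    exists q, q1; have [h1 h2 h3] := sob_derive (x_lt jm) dq cq1.
    by split => // s js; rewrite (patch_piece _ jm js) ji eqxx.
  exists (cst 0), (cst 0).
  have d0 s : is_derive s 1 (cst 0 : R -> R) (cst 0 s) by exact: is_derive_cst.
  have c0 : continuous (cst 0 : R -> R) by move=> s; exact: cvg_cst.
  have [h1 h2 h3] := sob_derive (x_lt jm) d0 c0.
  by split => // s js; rewrite (patch_piece _ jm js) (negbTE ji).
have sqi_ext j f g : (forall s, piece x j s -> f s = g s) -> sqi (piece x j) g -> in_L2 (piece x j) f.
  move=> fg [gm gi]; apply/in_L2P; first exact: measurable_itv.
  split; first by apply: eq_measurable_fun gm => s; rewrite inE => /fg.
  by apply: itg_eq gi; [exact: measurable_itv|move=> s /fg ->].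
split.
  split; first by move=> j jm; have [f [g [[sf _ _] _ _ qf _]]] := S j jm; exact: sqi_ext qf sf.
  split; first by move=> j jm; have [f [g [[_ sg _] _ _ _ qg]]] := S j jm; exact: sqi_ext qg sg.
  move=> j jm; have [f [g [[_ _ fg] _ _ qf qg]]] := S j jm.
  by apply: eq_weak_derivative fg; apply: aeW => s js; [rewrite qf|rewrite qg].
move=> j jm; have [f [g [sfg <- <- qf _]]] := S j jm.
apply: (eq_traces (x_lt jm) sfg).
by apply: aeW => s js; rewrite qf.
Qed.

(** The values of q vanish at both ends, so that the extension by zero is
    continuous; its slope may jump. *)
Lemma patch_in_V (q q1 q2 : R -> R) : (forall s, is_derive s 1 q (q1 s)) ->
  (forall s, is_derive s 1 q1 (q2 s)) -> continuous q2 -> q (x i.-1) = 0 -> q (x i) = 0 ->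
  let v := q \_ (piece x i) in
  [/\ in_V v, {ae mu, forall s, I s -> D (D v) s = (q2 \_ (piece x i)) s} &
    forall j, (1 <= j <= m)%N ->
      jump (D v) (x j) = (if j.+1 == i then q1 (x j) else 0) - (if j == i then q1 (x j) else 0)].
Proof.
move=> dq dq1 cq2 qa qb v.
have cq1 : continuous q1.
  by move=> s; apply: differentiable_continuous; apply/derivable1_diffP; have [] := dq1 s.
have [vD vtr] := patch_H1 dq cq1; have [vDD Dtr] := patch_H1 dq1 cq2.
have q0 j : (if j == i then q (x j.-1) else 0) = 0 by case: eqP => // ->.
have q0' j : (if j == i then q (x j) else 0) = 0 by case: eqP => // ->.
have vV : in_V v.
  apply: (in_V_intro vD vDD).
  - by have [] := vtr 1%N isT; rewrite /= x_first => -> _; have := q0 1%N; rewrite /= x_first.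
  - by have [] := vtr m.+1; rewrite ?leqnn// x_last => _ ->; have := q0' m.+1; rewrite x_last.
  - move=> j /andP[j1 jm]; rewrite -jpE /Defs.jump.
    have [-> _] := vtr j.+1 jm; have [|_ ->] := vtr j; first by rewrite j1 leqW.
    by rewrite q0 q0' subrr.
have [_ Dv] := D_spec (proj2 vD).
have vDH := in_V_DH vV.
have [_ vDD'] := in_V_H1 vV.
split => //.
  apply: (@D_uniq (q1 \_ (piece x i))); last by have [] := vDD.
  have [_ h] := vDD'; apply: is_D_ae h; [exact: in_V_DDH|exact: Dv|exact: aeW].
have Dv' : {ae mu, forall s, I s -> (q1 \_ (piece x i)) s = D v s}.
  by apply: filterS Dv => s h /h.
move=> j jm; have [-> _] := jump_ae vDD Dv' jm.
move/andP : jm => [j1 jm]; rewrite -jpE /Defs.jump.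
have [-> _] := Dtr j.+1 jm; have [|_ ->] := Dtr j; first by rewrite j1 leqW.
by [].
Qed.

Lemma inner_H_patch w (q : R -> R) : inner_H w (q \_ (piece x i)) = \int[mu]_(s in piece x i) (w s * q s).
Proof.
rewrite -ipE /Defs.inner_H (bigD1_seq i) ?mem_index_iota ?iota_uniq//=.
rewrite big1_seq ?addr0.
  by apply: eq_Rintegral => s; rewrite inE => si; rewrite (patch_piece _ im si) eqxx.
move=> j /andP[ji]; rewrite mem_index_iota ltnS => jm.
rewrite (@eq_Rintegral _ _ _ _ _ (cst 0)); first by rewrite Rintegral_cst ?mul0r//; exact: measurable_itv.
by move=> s; rewrite inE => sj; rewrite (patch_piece _ jm sj) (negbTE ji) mulr0.
Qed.

End OnePiece.

(** * Regularity and crack conditions in the domain of A *)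
Section DomainA.
Variables (theta : nat -> R) (u f : R -> R).
Hypothesis theta_gt0 : forall i, (1 <= i <= m)%N -> 0 < theta i.
Hypothesis uV : in_V u.
Hypothesis fH : in_H f.
Hypothesis uf : forall v, in_V v -> elastic theta u v = inner_H f v.

(** Testing with functions supported in one piece: u'' has the second
    distributional derivative f there. *)
Lemma DDu_weak_derivative i : (1 <= i <= m.+1)%N -> exists c,
  weak_derivative (x i.-1) (x i) (D (D u)) (fun s => c + prim (x i.-1) f s).
Proof.
move=> im; have fi := itg_in_H fH; have wi := itg_in_H (in_V_DDH uV).
have sub g : itg I g -> itg `](x i.-1), (x i)[%classic g.
  by apply: itgS; [exact: measurable_itv|exact: measurable_itv|exact: piece_sub].
apply: (weak_derivative2 (x_lt im) (sub _ wi) (sub _ fi)) => phi tphi.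
have tphi1 := test_derive1 tphi; have tphi2 := test_derive1 tphi1.
have out psi s : test_function (x i.-1) (x i) psi -> ~ piece x i s -> psi s = 0.
  by move=> [_ [K [_ Ki K0]]] si; apply: K0 => /Ki.
have [sphi _] := tphi; have [sphi1 _] := tphi1.
have ea : ~ piece x i (x i.-1) by rewrite /piece /= in_itv/= ltxx.
have eb : ~ piece x i (x i) by rewrite /piece /= in_itv/= ltxx andbF.
have [cphi2 _] := test_bounded tphi2.
have [phiV DDphi jphi] := patch_in_V im (fun s => smooth_is_derive s sphi)
  (fun s => smooth_is_derive s sphi1) cphi2 (out _ _ tphi ea) (out _ _ tphi eb).
have := uf phiV; rewrite /elastic (inner_H_aer _ DDphi) !(inner_H_patch im) => <-.
rewrite -[LHS]addr0; congr (_ + _); symmetry.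
apply: big1_seq => j; rewrite mem_index_iota ltnS => /andP[_ jm]; rewrite jphi//.
have -> : (if j.+1 == i then derive1 phi (x j) else 0) = 0.
  by case: eqP => // ji; apply: (out _ _ tphi1); rewrite -[j]/(j.+1.-1) ji.
have -> : (if j == i then derive1 phi (x j) else 0) = 0.
  by case: eqP => // ji; apply: (out _ _ tphi1); rewrite ji.
by rewrite subrr mulr0.
Qed.

(** The functions of [DDu_weak_derivative] are glued together; f in H makes
    each of them bounded, so that the result is in H. *)
Lemma DDu_H2 : exists w1, H1 (D (D u)) w1 /\ H1 w1 f.
Proof.
have wH := in_V_DDH uV.
have ex i : exists ci, (1 <= i <= m.+1)%N ->
    weak_derivative (x i.-1) (x i) (D (D u)) (fun s => ci + prim (x i.-1) f s).
  have [im|_] := boolP (1 <= i <= m.+1)%N; last by exists 0.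
  by have [c Hc] := DDu_weak_derivative im; exists c.
have [c Hc] := choice ex.
pose p i : R -> R := fun s => c i + prim (x i.-1) f s.
pose w1 s := \sum_(1 <= i < m.+2) (p i \_ (piece x i)) s.
have w1E i s : (1 <= i <= m.+1)%N -> piece x i s -> w1 s = p i s.
  move=> im si; rewrite /w1 (bigD1_seq i) ?mem_index_iota ?iota_uniq//=.
  rewrite (patch_piece im _ im si) eqxx big1_seq ?addr0// => j /andP[ji].
  rewrite mem_index_iota ltnS => jm; rewrite (patch_piece jm _ im si).
  by rewrite eq_sym (negbTE ji).
have fi i : (1 <= i <= m.+1)%N -> itg (piece x i) f.
  by move=> im; apply: itgS (itg_in_H fH); [exact: measurable_itv|exact: measurable_itv|exact: piece_sub].
have pL i : (1 <= i <= m.+1)%N -> sqi (piece x i) (p i).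
  move=> im; apply: (@sqi_bounded _ _ _ (`|c i| + \int[mu]_(t in piece x i) `|f t|)).
  - exact: measurable_itv.
  - exact: lebesgue_itv_lty.
  - by apply: measurable_funD => //; exact: itg_meas (prim_itg (fi _ im)).
  - move=> s si; rewrite (le_trans (ler_normD _ _))// lerD2l.
    move: si; rewrite /piece /= in_itv/= => /andP[/ltW h1 /ltW h2].
    exact: prim_bounded (fi i im) h1 h2.
have w1H : in_H w1.
  move=> i im; have [gm gi] := pL i im; apply/in_L2P; first exact: measurable_itv.
  split; first by apply: eq_measurable_fun gm => s; rewrite inE => /(w1E _ _ im).
  by apply: itg_eq gi; [exact: measurable_itv|move=> s /(w1E _ _ im) ->].
exists w1; split; (split; [assumption|split; [assumption|]]) => i im.
  by apply: eq_weak_derivative (Hc i im); apply: aeW => s // /(w1E _ _ im) ->.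
apply: eq_weak_derivative (weak_derivative_prim (c i) (x_lt im) (fi i im)); apply: aeW => s //.
by move=> /(w1E _ _ im) ->.
Qed.

Lemma fourth_derivative : {ae mu, forall s, I s -> D (D (D (D u))) s = f s}.
Proof.
have [w1 [[wH ww1] [w1H w1f]]] := DDu_H2.
have [wD Dw] := D_spec ww1.
have fDH : in_H (D (D (D u))) by have [] := wD.
have Dwf : is_D (D (D (D u))) f.
  by apply: is_D_ae w1f; [exact: fH|apply: filterS Dw => s h /h|exact: aeW].
by have [] := D_spec Dwf.
Qed.

Lemma is_derive_subl a s : is_derive s 1 (fun s : R => s - a) 1.
Proof.
by apply: (is_derive_eq (is_derive_add (is_derive_id s 1) (is_derive_cst (- a) s 1))); rewrite addr0.
Qed.

Lemma is_derive_subr b s : is_derive s 1 (fun s : R => b - s) (-1).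
Proof.
apply: (is_derive_eq (is_derive_add (is_derive_cst b s 1) (is_deriveN (is_derive_id s 1)))).
by rewrite add0r.
Qed.

(** The natural condition at a crack: test with the function of one piece that
    has slope 1 on the right of x i and vanishes to second order at the other end. *)
Lemma jump_condition i : (1 <= i <= m)%N ->
  jump (D u) (x i) = theta i * right_trace (D (D u)) (x i).
Proof.
move=> /andP[i1 im]; have im1 : (1 <= i.+1 <= m.+1)%N by [].
have [w1 [ww1 w1f]] := DDu_H2.
set a := x i; set b := x i.+1; have ab : a < b by exact: x_incr.
pose K := ((b - a) ^+ 2)^-1.
have ba0 : b - a != 0 by rewrite subr_eq0 gt_eqF.
pose q s := K * ((s - a) * ((b - s) * (b - s))).
pose q1 s := K * ((b - s) * (b - s) - 2 * ((s - a) * (b - s))).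
pose q2 s := K * (- 4 * (b - s) + 2 * (s - a)).
have dq s : is_derive s 1 q (q1 s).
  apply: (is_derive_eq (is_derive_scal K (is_derive_mul (is_derive_subl a s)
    (is_derive_mul (is_derive_subr b s) (is_derive_subr b s))))).
  by rewrite /q1; ring.
have dq1 s : is_derive s 1 q1 (q2 s).
  rewrite /q1; under eq_fun do rewrite -mulNr.
  apply: (is_derive_eq (is_derive_scal K (is_derive_add
    (is_derive_mul (is_derive_subr b s) (is_derive_subr b s))
    (is_derive_scal (- 2) (is_derive_mul (is_derive_subl a s) (is_derive_subr b s)))))).
  by rewrite /q2; ring.
have dq2 s : is_derive s 1 q2 (6 * K).
  rewrite /q2; apply: (is_derive_eq (is_derive_scal K (is_derive_add
    (is_derive_scal (- 4) (is_derive_subr b s)) (is_derive_scal 2 (is_derive_subl a s))))).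
  by ring.
have dcont (g : R -> R) (dg : R -> R) : (forall s, is_derive s 1 g (dg s)) -> continuous g.
  by move=> h s; apply: differentiable_continuous; apply/derivable1_diffP; have [] := h s.
have cq2 := dcont _ _ dq2; have cq1 := dcont _ _ dq1.
have qa : q a = 0 by rewrite /q subrr mul0r mulr0.
have qb : q b = 0 by rewrite /q subrr !mulr0.
have q1a : q1 a = 1 by rewrite /q1 /K; field.
have q1b : q1 b = 0 by rewrite /q1 subrr !mulr0 subrr mulr0.
have [vV DDv jv] := patch_in_V im1 dq dq1 cq2 qa qb.
have := uf vV; rewrite /elastic (inner_H_aer _ DDv) !(inner_H_patch im1).
have [sq _ _] := sob_derive (x_lt im1) dq cq1.
have [sq1 tq1a tq1b] := sob_derive (x_lt im1) dq1 cq2.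
have [_ tqa tqb] := sob_derive (x_lt im1) dq cq1.
have E1 := sob_by_parts (x_lt im1) (H1_sob ww1 im1) sq1.
have E2 := sob_by_parts (x_lt im1) (H1_sob w1f im1) sq.
move: E1 E2; rewrite /= tq1a tq1b tqa tqb -/a -/b qa qb q1a q1b !mulr0 mulr1 subrr sub0r.
rewrite -/(piece x i.+1) => E1 E2.
have -> : \sum_(1 <= j < m.+1) (theta j)^-1 * jump (D u) (x j) * jump (D (q \_ (piece x i.+1))) (x j)
    = (theta i)^-1 * jump (D u) a.
  rewrite (bigD1_seq i) ?mem_index_iota ?iota_uniq ?i1//=.
  rewrite jv ?i1// eqxx [i == i.+1]eqn_leq ltnn andbF q1a subr0 mulr1.
  rewrite big1_seq ?addr0// => j /andP[ji]; rewrite mem_index_iota ltnS => jm.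
  rewrite jv// eqSS (negbTE ji).
  have -> : (if j == i.+1 then q1 (x j) else 0) = 0 by case: eqP => // ->.
  by rewrite subrr mulr0.
move=> E; have th0 : theta i != 0 by rewrite gt_eqF// theta_gt0// i1.
have {E} : (theta i)^-1 * jump (D u) a = right_trace (D (D u)) a by lra.
by move=> <-; rewrite mulrA mulfV// mul1r.
Qed.

End DomainA.

(** * Functionals on V *)
Lemma in_V0 : in_V 0.
Proof.
have d0 s : is_derive s 1 (cst 0 : R -> R) (cst 0 s) by exact: is_derive_cst.
have c0 : continuous (cst 0 : R -> R) by move=> s; exact: cvg_cst.
have [+ _ _] := patch_in_V one_in d0 d0 c0 erefl erefl.
by rewrite (_ : _ \_ _ = 0)//; apply/funext => s; rewrite /patch; case: ifP.
Qed.

(** A family of functionals r t that is approximated in norm by the members of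
    a countable family G: countably many test functions, almost norming for
    the members of G, decide whether r t vanishes, so that the exceptional
    null set can be chosen independently of the test function. *)
Lemma vanish_ae_uniformly (K : nat -> finType) (G : forall n, K n -> (R -> R) -> R)
    (A : set R) (r : R -> (R -> R) -> R) :
  (forall v, in_V v -> {ae mu, forall t, A t -> r t v = 0}) ->
  {ae mu, forall t, A t -> (forall k v, in_V v -> r t (k *: v) = k * r t v) /\
    exists (k : forall n, K n) (e : nat -> R), e n @[n --> \oo] --> (0 : R) /\
      forall n v, in_V v -> `|G n (k n) v - r t v| <= e n * norm_V v} ->
  {ae mu, forall t, A t -> forall v, in_V v -> r t v = 0}.
Proof.
move=> r0 rG.
pose w n (k : K n) j := xget 0 [set v | [/\ in_V v, norm_V v <= 1 & j.+1%:R^-1 < `|G n k v|]].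
have wV n (k : K n) j : in_V (w n k j).
  by rewrite /w; case: xgetP => [v _ []//|_]; exact: in_V0.
have all0 : {ae mu, forall t, forall n, forall (k : K n), forall j, A t -> r t (w n k j) = 0}.
  apply: ae_countable => n; apply: ae_countable => k; apply: ae_countable => j.
  exact: r0.
have := ae_and all0 rG; apply: filterS => t [w0 H] tA v vV.
have [rZ [k [e [e0 Ge]]]] := H tA.
apply: contrapT => /eqP rv.
wlog v1 : v vV rv / norm_V v <= 1.
  move=> wl; have v0 : 0 < 1 + norm_V v by rewrite ltr_wpDr ?norm_V_ge0.
  apply: (wl ((1 + norm_V v)^-1 *: v)); first exact: (S_scal in_V0 in_V_lin).
    by rewrite rZ// mulf_neq0// invr_neq0// gt_eqF.
  rewrite norm_V_Z// ger0_norm ?invr_ge0 ?(ltW v0)//.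
  by rewrite mulrC ler_pdivrMr// mul1r lerDr.
have rv0 : 0 < `|r t v| / 2 by rewrite divr_gt0 ?normr_gt0.
have [j jr] : exists j : nat, j.+1%:R^-1 < `|r t v| / 2.
  have /cvgrPdist_lt /(_ _ rv0) [j _ /(_ j (leqnn j))] := @cvg_harmonic R.
  by rewrite sub0r normrN ger0_norm ?invr_ge0// => h; exists j.
have j0 : 0 < (j.+1%:R)^-1 :> R by rewrite invr_gt0.
have [n] : exists n, e n < j.+1%:R^-1.
  have /cvgrPdist_lt /(_ _ j0) [n _ /(_ n (leqnn n))] := e0.
  by rewrite sub0r normrN => h; exists n; apply: le_lt_trans h; exact: ler_norm.
move=> en.
(* On the unit ball G n (k n) differs from r t by less than 1 / (j + 1), which
   is less than half of |r t v|: then w n (k n) j, where r t vanishes, cannot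
   exist as an almost norming vector, although v provides one. *)
have bound u : in_V u -> norm_V u <= 1 -> `|G n (k n) u - r t u| < j.+1%:R^-1.
  move=> uV u1; apply: (le_lt_trans (Ge n u uV)).
  have N0 := norm_V_ge0 u; have [e_ge0|/ltW e_le0] := leP 0 (e n).
    by apply: le_lt_trans en; rewrite ler_piMr.
  by apply: le_lt_trans j0; exact: mulr_le0_ge0.
have [wnV wn1 wnG] : [/\ in_V (w n (k n) j), norm_V (w n (k n) j) <= 1 & j.+1%:R^-1 < `|G n (k n) (w n (k n) j)|].
  rewrite /w; case: xgetP => [u _ //|/(_ v)]; case; split => //.
  move: (bound v vV v1) (ler_normB (G n (k n) v) (G n (k n) v - r t v)) jr.
  rewrite subKr; move: (_^-1) `|G n (k n) v - r t v| => h d; lra.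
by have := bound _ wnV wn1; rewrite w0// subr0 => /(lt_trans wnG); rewrite ltxx.
Qed.

Section DualSpace.

Local Notation in_V' := (in_V' m x).
Local Notation norm_V' := (norm_V' m x).
Implicit Types (F G : (R -> R) -> R).

Lemma V'_lin_fun F k u v : in_V' F -> in_V u -> in_V v -> F (k *: u + v) = k * F u + F v.
Proof. by move=> [FL _]; exact: FL. Qed.

Lemma V'_fun0 F : in_V' F -> F 0 = 0.
Proof. by move=> FV; have := V'_lin_fun (-1) FV in_V0 in_V0; rewrite scaler0 addr0; lra. Qed.

Lemma V'_scal F k u : in_V' F -> in_V u -> F (k *: u) = k * F u.
Proof.
by move=> FV uV; have := V'_lin_fun k FV uV in_V0; rewrite !addr0 V'_fun0// addr0.
Qed.

Lemma in_V'0 : in_V' 0.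
Proof.
split; first by move=> a u v _ _; rewrite !fctE mulr0 addr0.
by exists 0 => v _; rewrite [0 v](_ : _ = 0 :> R)// normr0 mul0r.
Qed.

Lemma in_V'_lin k F G : in_V' F -> in_V' G -> in_V' (k *: F + G).
Proof.
move=> [FL [CF FC]] [GL [CG GC]]; split.
  by move=> a u v uV vV; rewrite !fctE /GRing.scale/= FL// GL//; ring.
exists (`|k| * CF + CG) => v vV; rewrite !fctE /GRing.scale/=.
rewrite (le_trans (ler_normD _ _))// mulrDl lerD ?GC// normrM -mulrA ler_wpM2l//.
exact: FC.
Qed.

Let ball F := [set `|F v| | v in [set v | in_V v /\ Defs.norm_V m x v <= 1]].

Let ball0 F : ball F `|F 0|.
Proof.
exists 0 => //; split; first exact: in_V0.
have := norm_V_Z 0 in_V0; rewrite scaler0 normr0 mul0r nVE => ->; exact: ler01.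
Qed.

Let ball_ub F : in_V' F -> has_ubound (ball F).
Proof.
move=> [_ [C FC]]; exists `|C| => _ [v [vV v1] <-]; rewrite (le_trans (FC v vV))//.
rewrite (le_trans (ler_norm _))// normrM -[leRHS]mulr1 ler_wpM2l//.
by rewrite ger0_norm// nVE norm_V_ge0.
Qed.

Lemma norm_V'_ge0 F : 0 <= norm_V' F.
Proof.
rewrite /norm_V' -/(ball F); have [ub|nub] := pselect (has_ubound (ball F)).
  by apply: (le_trans (normr_ge0 (F 0))); apply: ub_le_sup => //; exact: ball0.
by rewrite sup_out// => -[].
Qed.

(** Scaling v to norm 1; a vector of norm 0 is killed by boundedness. *)
Lemma V'_le F v : in_V' F -> in_V v -> `|F v| <= norm_V' F * norm_V v.
Proof.
move=> FV vV; have [v0|v0] := eqVneq (norm_V v) 0.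
  by have [_ [C /(_ v vV)]] := FV; rewrite nVE v0 !mulr0.
have vgt0 : 0 < norm_V v by rewrite lt_neqAle eq_sym v0 norm_V_ge0.
rewrite -ler_pdivrMr// mulrC -[X in X * _]gtr0_norm ?invr_gt0// -normrM -V'_scal//.
apply: ub_le_sup; first exact: ball_ub.
exists ((norm_V v)^-1 *: v) => //; split; first by rewrite -[_ *: _]addr0; apply: in_V_lin => //; exact: in_V0.
by rewrite nVE norm_V_Z// gtr0_norm ?invr_gt0// mulVf.
Qed.

Lemma norm_V'_lin k F G : in_V' F -> in_V' G ->
  norm_V' (k *: F + G) <= `|k| * norm_V' F + norm_V' G.
Proof.
move=> FV GV; apply: ge_sup; first by exists `|(k *: F + G) 0|; exact: ball0.
move=> _ [v [vV v1] <-]; rewrite !fctE /GRing.scale/=.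
rewrite (le_trans (ler_normD _ _))// lerD//.
  rewrite normrM ler_wpM2l// (le_trans (V'_le FV vV))// -[leRHS]mulr1.
  by rewrite ler_wpM2l ?norm_V'_ge0// -nVE.
rewrite (le_trans (V'_le GV vV))// -[leRHS]mulr1.
by rewrite ler_wpM2l ?norm_V'_ge0// -nVE.
Qed.

Definition embed_cst : R := norm_H (cst 1) * norm_H (cst 1) * poincare_cst.

Lemma inner_H_le u v : in_H u -> in_V v -> `|inner_H u v| <= embed_cst * norm_H u * norm_V v.
Proof.
move=> uH vV; rewrite (le_trans (cauchy_schwarz_H uH (in_V_H vV)))//.
by rewrite mulrAC [leRHS]mulrC ler_wpM2l ?norm_H_ge0// norm_H_le.
Qed.

Lemma embed_in_V' u : in_H u -> in_V' (embed_H m x u).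
Proof.
move=> uH; rewrite /embed_H ipE; split.
  by move=> a v w vV wV; rewrite inner_H_linr//; exact: in_V_H.
by exists (embed_cst * norm_H u) => v vV; rewrite nVE; exact: inner_H_le.
Qed.

End DualSpace.

(** * Boundedness in H of the motion *)
Section Evolution.
Variables (T : R) (y yt : R -> R -> R).
Hypothesis T_gt0 : 0 < T.
Hypothesis y_V : bochner_L2 in_V norm_V T y.
Hypothesis yt_H : bochner_L2 in_H norm_H T yt.
Hypothesis y_yt : time_derivative in_H norm_H T y yt.
Local Notation IT := (`]0, T[%classic : set R).

Lemma ae_in_V : {ae mu, forall t, IT t -> in_V (y t)}.
Proof. by have [+ _ _] := y_V. Qed.

Lemma inner_H_cont v : in_H v -> norm_continuous in_H norm_H (fun u => inner_H u v).
Proof.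
move=> vH; apply: (bounded_continuous in_H_lin norm_H_ge0 (C := norm_H v)).
  by move=> k u w uH wH; exact: inner_H_lin.
by move=> u uH; rewrite mulrC cauchy_schwarz_H.
Qed.

(** V embeds continuously in H. *)
Lemma inner_H_contV v : in_H v -> norm_continuous in_V norm_V (fun u => inner_H u v).
Proof.
move=> vH; apply: (bounded_continuous in_V_lin norm_V_ge0 (C := embed_cst * norm_H v)).
  by move=> k u w uV wV; apply: inner_H_lin => //; exact: in_V_H.
by move=> u uV; rewrite inner_H_sym inner_H_le.
Qed.

Lemma norm_H_contV : norm_continuous in_V norm_V norm_H.
Proof.
apply: (norm_continuous_le in_V_lin in_V_H norm_H_ge0 (C := embed_cst)).
  by move=> u uV; rewrite norm_H_le.
exact: norm_continuousN in_H_lin norm_H_ge0 norm_H_lin.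
Qed.

Lemma le_1_sqr (a : R) : a <= 1 + a ^+ 2. Proof. nra. Qed.

Lemma inner_yt_itg v : in_H v ->
  exists2 g, itg IT g & {ae mu, forall t, IT t -> inner_H (yt t) v = g t}.
Proof.
move=> vH; have [ytH _ _] := yt_H.
apply: (bochner_L2_integrable in_H0 in_H_lin norm_H_ge0 norm_H_lin yt_H (inner_H_cont vH) (C := norm_H v)).
apply: filterS ytH => t h /h ytH'; rewrite (le_trans (cauchy_schwarz_H ytH' vH))// mulrC.
by rewrite ler_wpM2l ?norm_H_ge0// le_1_sqr.
Qed.

Lemma inner_y_itg v : in_H v ->
  exists2 g, itg IT g & {ae mu, forall t, IT t -> inner_H (y t) v = g t}.
Proof.
move=> vH.
apply: (bochner_L2_integrable in_V0 in_V_lin norm_V_ge0 norm_V_lin y_V (inner_H_contV vH) (C := embed_cst * norm_H v)).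
apply: filterS ae_in_V => t h /h yV; rewrite inner_H_sym (le_trans (inner_H_le vH yV))//.
rewrite ler_wpM2l ?le_1_sqr// mulr_ge0 ?norm_H_ge0// mulr_ge0 ?mulr_ge0 ?norm_H_ge0//.
by rewrite addr_ge0 ?mulr_ge0 ?norm_H_ge0.
Qed.

(** The weak derivative of (y, d) is (yt, d), bounded by |yt| |d|, so that (y, d)
    is a constant up to |d| times the integral of |yt|. *)
Lemma y_near_constant : exists2 K : R, 0 <= K & forall d, in_H d -> exists c,
  {ae mu, forall t, IT t -> `|inner_H (y t) d - c| <= K * norm_H d}.
Proof.
have [n ni nE] : exists2 g, itg IT g & {ae mu, forall t, IT t -> norm_H (yt t) = g t}.
  apply: (bochner_L2_integrable in_H0 in_H_lin norm_H_ge0 norm_H_lin yt_H (norm_continuousN in_H_lin norm_H_ge0 norm_H_lin) (C := 1)).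
  by apply: aeW => t _; rewrite mul1r ger0_norm ?norm_H_ge0// le_1_sqr.
exists (\int[mu]_(t in IT) n t).
  rewrite (_ : Rintegral _ _ _ = \int[mu]_(t in IT) norm_H (yt t)).
    by apply: Rintegral_ge0 => t _; exact: norm_H_ge0.
  by apply: eq_Rintegral_ae; apply: filterS nE => t h /h.
move=> d dH.
have [g1 g1i g1E] := inner_y_itg dH; have [g2 g2i g2E] := inner_yt_itg dH.
have [ytH _ _] := yt_H.
have W : weak_derivative 0 T g1 g2.
  have := @time_derivative_weak _ _ in_H norm_H in_H0 in_H_lin norm_H_ge0 T y yt
    (fun u => inner_H u d) (norm_H d) _ _ _ _ y_yt.
  move=> H; apply: (eq_weak_derivative g1E g2E); apply: H.
  - by apply: filterS ae_in_V => t h /h; exact: in_V_H.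
  - by apply: filterS ytH => t h /h.
  - by move=> k u w uH wH; exact: inner_H_lin.
  - by move=> u uH; rewrite mulrC cauchy_schwarz_H.
have [c Hc] := weak_derivative_primE T_gt0 g1i g2i W.
exists c; have := ae_and g1E Hc; apply: filterS => t [h1 Hct] tT.
rewrite h1// Hct// addrC addKr; move: (tT); rewrite /= in_itv/= => /andP[t0 tT'].
rewrite (le_trans (prim_bounded g2i (ltW t0) (ltW tT')))//.
have ndi : itg IT (fun t => norm_H d * n t) by apply: itgZ.
have g2n := itg_norm (measurable_itv _) g2i.
rewrite mulrC -RintegralZl//; rewrite /Rintegral.
apply: fine_le; [exact: (@integrable_fin_num _ _ _ mu IT (measurable_itv _) _ g2n)|exact: (@integrable_fin_num _ _ _ mu IT (measurable_itv _) _ ndi)|].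
have ge0 : {ae mu, forall s, IT s -> `|g2 s| <= norm_H d * n s}.
  have := ae_and g2E (ae_and nE ytH); apply: filterS => s [e1 [e2 e3]] sT.
  by rewrite -e1// -e2// mulrC cauchy_schwarz_H//; exact: e3.
rewrite integral_mkcond [leRHS]integral_mkcond.
apply: (@le_trans _ _ (\int[mu]_s ((fun s => `|norm_H d * n s|%:E) \_ IT) s)%E).
  apply: ge0_le_integral_ae.
  - by move=> s; rewrite /patch; case: ifP => // _; rewrite lee_fin.
  - by move=> s; rewrite /patch; case: ifP => // _; rewrite lee_fin.
  - apply: filterS ge0 => s h; rewrite /patch; case: ifPn => // /set_mem sT.
    by rewrite lee_fin (le_trans (h sT))// ler_norm.
rewrite le_eqVlt; apply/orP; left; apply/eqP; rewrite -!integral_mkcond.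
apply: eq_integral_ae; apply: filterS nE => s h sT; rewrite ger0_norm//.
by rewrite -h// mulr_ge0 ?norm_H_ge0.
Qed.

(** Testing with the countably many values of the simple functions that
    approximate y avoids a null set for every direction. At almost every t the
    product of y(t) with such a value d is within 2 K |d| of its value at a
    fixed time s0; letting d tend to y(t) gives |y(t)| <= |y(s0)| + 2 K. *)
Lemma y_bounded : exists M, {ae mu, forall t, IT t -> norm_H (y t) <= M}.
Proof.
have [_ [h hy] _] := y_V; have [K K0 HK] := y_near_constant.
have dV n (b : pattern (h n)) : in_V (sf_value b) by exact: (sf_value_in in_V0 in_V_lin).
have ex n : exists c : pattern (h n) -> R, forall b,
    {ae mu, forall t, IT t -> `|inner_H (y t) (sf_value b) - c b| <= K * norm_H (sf_value b)}.
  exists (fun b => projT1 (cid (HK _ (in_V_H (dV n b))))) => b.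
  exact: (projT2 (cid (HK _ (in_V_H (dV n b))))).
have {ex} [c Hc] : exists c : forall n, pattern (h n) -> R, forall n b,
    {ae mu, forall t, IT t -> `|inner_H (y t) (sf_value b) - c n b| <= K * norm_H (sf_value b)}.
  by exists (fun n => projT1 (cid (ex n))) => n b; exact: (projT2 (cid (ex n))).
have good : {ae mu, forall t, IT t -> [/\ in_V (y t),
    norm_V (sf_eval (h n) t - y t) @[n --> \oo] --> (0 : R) &
    forall n b, `|inner_H (y t) (sf_value b) - c n b| <= K * norm_H (sf_value (h := h n) b)]}.
  have H : {ae mu, forall t, forall n, forall b, IT t ->
      `|inner_H (y t) (sf_value b) - c n b| <= K * norm_H (sf_value (h := h n) b)}.
    by apply: ae_countable => n; apply: ae_countable => b; exact: Hc.
  have := ae_and ae_in_V (ae_and hy H); apply: filterS => t [h1 [h2 h3]] tT.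
  by split; [exact: h1|exact: h2|move=> n b; exact: h3].
have [s0 s0T [_ [s0V _ s0b]]] := ae_in_itv T_gt0 (filterS (fun t H (tT : IT t) => conj tT (H tT)) good).
exists (norm_H (y s0) + 2 * K); apply: filterS good => t H /H [tV ht tb].
have tH := in_V_H tV; have s0H := in_V_H s0V.
have dtV n : in_V (sf_eval (h n) t) by exact: (sf_eval_in in_V0 in_V_lin).
have bnd n : inner_H (sf_eval (h n) t) (y t) <= (norm_H (y s0) + 2 * K) * norm_H (sf_eval (h n) t).
  have := tb n (sf_pattern (h n) t); have := s0b n (sf_pattern (h n) t).
  rewrite -sf_evalE => h1 h2; have h3 := cauchy_schwarz_H s0H (in_V_H (dtV n)).
  rewrite inner_H_sym mulrDl; move: h1 h2 h3.
  rewrite !ler_norml => /andP[a1 a2] /andP[a3 a4] /andP[a5 a6]; lra.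
have c1 := inner_H_contV tH dtV tV ht.
have c2 : norm_H (sf_eval (h n) t) @[n --> \oo] --> norm_H (y t).
  exact: (norm_H_contV dtV tV ht).
have : inner_H (y t) (y t) <= (norm_H (y s0) + 2 * K) * norm_H (y t).
  by apply: (ler_cvg_to c1 (cvgM (cvg_cst (norm_H (y s0) + 2 * K)) c2)); apply: nearW.
rewrite -norm_H_sqr expr2 => le.
have [->|n0] := eqVneq (norm_H (y t)) 0.
  by rewrite addr_ge0 ?norm_H_ge0// mulr_ge0.
by rewrite -(ler_pM2r (_ : 0 < norm_H (y t)))// lt_neqAle eq_sym n0 norm_H_ge0.
Qed.

(** * First variation of the action *)
Section Hamilton.
Local Notation in_V' := (Defs.in_V' m x).
Local Notation norm_V' := (Defs.norm_V' m x).
Variables (theta : nat -> R) (cd beta : R) (p : R -> R -> R) (ytt : R -> (R -> R) -> R).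
Hypothesis p_H : bochner_L2 in_H norm_H T p.
Hypothesis ytt_V' : bochner_L2 in_V' norm_V' T ytt.
Hypothesis yt_ytt : time_derivative in_V' norm_V' T (fun t => embed_H m x (yt t)) ytt.
Hypothesis hamilton : extended_hamilton m x theta T beta cd p y yt.
Local Notation elastic := (elastic theta).

Definition axial u : R := beta + 2^-1 * norm_H (D u) ^+ 2.

Lemma norm_D_lin k u v : in_V u -> in_V v ->
  norm_H (D (k *: u + v)) <= `|k| * norm_H (D u) + norm_H (D v).
Proof.
exact: (@sip_normZ_D _ _ in_V (fun a b => inner_H (D a) (D b)) in_V_lin innerD_lin
  (fun a b _ _ => inner_H_sym (D a) (D b)) (fun a _ => inner_H_ge0 (D a))).
Qed.

Lemma norm_D_cont : norm_continuous in_V norm_V (fun u => norm_H (D u)).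
Proof.
have c := @norm_continuousN _ _ in_V (fun u => norm_H (D u)) in_V_lin (fun u => norm_H_ge0 (D u)) norm_D_lin.
have sub u : in_V u -> in_V u by [].
exact: (norm_continuous_le in_V_lin sub (fun u => norm_H_ge0 (D u)) norm_D_le c).
Qed.

Lemma axial_cont : norm_continuous in_V norm_V axial.
Proof.
move=> u_ u Su_ Su c; apply: cvgD; first exact: cvg_cst.
apply: cvgM; first exact: cvg_cst.
by apply: cvg_pow; exact: norm_D_cont c.
Qed.

Lemma poincare_cst_ge0 : 0 <= poincare_cst.
Proof. by rewrite addr_ge0 ?mulr_ge0 ?norm_H_ge0. Qed.

Lemma innerD_le u v : in_V u -> in_V v ->
  `|inner_H (D u) (D v)| <= poincare_cst * norm_H (D v) * norm_V u.
Proof.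
move=> uV vV; rewrite (le_trans (cauchy_schwarz_H (in_V_DH uV) (in_V_DH vV)))//.
by rewrite mulrAC ler_wpM2r ?norm_H_ge0// norm_D_le.
Qed.

Lemma innerD_cont v : in_V v -> norm_continuous in_V norm_V (fun u => inner_H (D u) (D v)).
Proof.
move=> vV; apply: (bounded_continuous in_V_lin norm_V_ge0 (C := poincare_cst * norm_H (D v))).
  by move=> k u w uV wV; exact: innerD_lin.
by move=> u uV; exact: innerD_le.
Qed.

Lemma elastic_cont v : in_V v -> norm_continuous in_V norm_V (fun u => elastic u v).
Proof.
move=> vV; apply: (bounded_continuous in_V_lin norm_V_ge0 (C := elastic_cst theta * norm_V v)).
  by move=> k u w uV wV; exact: elastic_lin.
by move=> u uV; rewrite mulrAC elastic_le.
Qed.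

(** Strong measurability of y makes Psi (y t) measurable up to a null set, and
    the growth bound makes it integrable. *)
Lemma y_itg (Psi : (R -> R) -> R) (C : R) : norm_continuous in_V norm_V Psi ->
  {ae mu, forall t, IT t -> in_V (y t) -> `|Psi (y t)| <= C * (1 + norm_V (y t) ^+ 2)} ->
  exists2 g, itg IT g & {ae mu, forall t, IT t -> Psi (y t) = g t}.
Proof.
move=> cPsi PsiC.
apply: (bochner_L2_integrable in_V0 in_V_lin norm_V_ge0 norm_V_lin y_V cPsi (C := C)).
have := ae_and ae_in_V PsiC; apply: filterS => t [h1 h2] tT.
by apply: h2 => //; exact: h1.
Qed.

Lemma le_lin_sqr (C a : R) : 0 <= C -> C * a <= C * (1 + a ^+ 2).
Proof. by move=> C0; rewrite ler_wpM2l// le_1_sqr. Qed.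

Lemma axial_y_itg : exists2 g, itg IT g & {ae mu, forall t, IT t -> axial (y t) = g t}.
Proof.
apply: (y_itg (C := `|beta| + poincare_cst ^+ 2) axial_cont); apply: aeW => t _ tV.
have P0 := norm_H_ge0 (D (y t)); have C0 := poincare_cst_ge0.
rewrite /axial (le_trans (ler_normD _ _))// [leRHS]mulrDl lerD//.
  by rewrite ler_peMr// lerDl sqr_ge0.
rewrite ger0_norm; last by rewrite mulr_ge0// sqr_ge0.
have h : norm_H (D (y t)) ^+ 2 <= (poincare_cst * norm_V (y t)) ^+ 2.
  by rewrite ler_pXn2r ?nnegrE ?norm_D_le// mulr_ge0// norm_V_ge0.
rewrite exprMn in h; have := sqr_ge0 poincare_cst; have := sqr_ge0 (norm_V (y t)); nra.
Qed.

(** The cubic term is controlled by [interpolation], since y is bounded in H. *)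
Lemma axial_innerD_y_itg v : in_V v ->
  exists2 g, itg IT g & {ae mu, forall t, IT t -> axial (y t) * inner_H (D (y t)) (D v) = g t}.
Proof.
move=> vV; have [M HM] := y_bounded.
have cPsi : norm_continuous in_V norm_V (fun u => axial u * inner_H (D u) (D v)).
  by move=> u_ u Su_ Su c; apply: cvgM; [exact: axial_cont c|exact: innerD_cont c].
pose K := 4 * M ^+ 2 + 8 * m%:R ^+ 2 * M.
apply: (y_itg (C := norm_H (D v) * (`|beta| * poincare_cst + 2^-1 * (1 + `|K|))) cPsi).
apply: filterS HM => t HMt tT tV.
have P0 := norm_H_ge0 (D (y t)); have C0 := poincare_cst_ge0; have Q0 := norm_H_ge0 (D v).
have N0 := norm_V_ge0 (y t).
have h1 := cauchy_schwarz_H (in_V_DH tV) (in_V_DH vV).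
have h2 := interpolation tV (HMt tT); rewrite -/K in h2.
have h3 := norm_D_le tV.
rewrite normrM; apply: (@le_trans _ _ ((`|beta| + 2^-1 * norm_H (D (y t)) ^+ 2) * (norm_H (D (y t)) * norm_H (D v)))).
  rewrite ler_pM// /axial (le_trans (ler_normD _ _))// lerD2l ger0_norm//.
  by rewrite mulr_ge0// sqr_ge0.
rewrite [leLHS](_ : _ = norm_H (D v) * (`|beta| * norm_H (D (y t)) + 2^-1 * norm_H (D (y t)) ^+ 3)); last first.
  by rewrite [_ ^+ 3]exprSr; ring.
rewrite -mulrA ler_wpM2l// [leRHS]mulrDl lerD//.
  rewrite -mulrA ler_wpM2l// (le_trans h3)//.
  by rewrite le_lin_sqr.
rewrite -mulrA ler_wpM2l// (le_trans h2)//.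
have := ler_norm K; have := sqr_ge0 (norm_V (y t)); have := normr_ge0 K.
move: (norm_V (y t) ^+ 2) `|K| => a b b0 a0 Kb.
have := ler_wpM2r a0 Kb; lra.
Qed.

Lemma itg_mul_cont (b g : R -> R) : (exists M, forall t, `|b t| <= M) -> continuous b ->
  itg IT g -> itg IT (fun t => b t * g t).
Proof.
move=> [M HM] cb gi; apply: (@itg_mulb _ _ _ _ M) => //.
by apply: measurable_funTS; exact: continuous_measurable_fun.
Qed.

Lemma test_pow (zeta : R -> R) n : test_function 0 T zeta ->
  (exists M, forall t, `|zeta t ^+ n| <= M) /\ continuous (fun t => zeta t ^+ n).
Proof.
move=> /test_bounded[cz [M HM]]; split.
  by exists (M ^+ n) => t; rewrite normrX lerXn2r ?nnegrE// (le_trans _ (HM t)).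
by move=> t; apply: cvg_pow; exact: cz.
Qed.

(** The first variation: the integrand is a polynomial in alpha with integrable
    coefficients, and its linear coefficient is the weak form of the equation. *)
Lemma weak_equation (v : R -> R) (zeta : R -> R) (g1 g2 g4 g5 g6 g7 g8 : R -> R) :
  in_V v -> test_function 0 T zeta ->
  itg IT g1 -> {ae mu, forall t, IT t -> inner_H (yt t) v = g1 t} ->
  itg IT g2 -> {ae mu, forall t, IT t -> inner_H (p t) v = g2 t} ->
  itg IT g4 -> {ae mu, forall t, IT t -> elastic (y t) v = g4 t} ->
  itg IT g5 -> {ae mu, forall t, IT t -> inner_H (D (y t)) (D v) = g5 t} ->
  itg IT g6 -> {ae mu, forall t, IT t -> axial (y t) * inner_H (D (y t)) (D v) = g6 t} ->
  itg IT g7 -> {ae mu, forall t, IT t -> axial (y t) = g7 t} ->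
  itg IT g8 -> {ae mu, forall t, IT t -> inner_H (D (y t)) (D v) ^+ 2 = g8 t} ->
  \int[mu]_(t in IT) (derive1 zeta t * g1 t + zeta t * (g2 t - g4 t - pi^-1 * g6 t)) -
  cd * \int[mu]_(t in IT) (zeta t * g1 t) = 0.
Proof.
move=> vV tz g1i g1E g2i g2E g4i g4E g5i g5E g6i g6E g7i g7E g8i g8E.
have mT : measurable IT by exact: measurable_itv.
have tz' := test_derive1 tz; have [sz [K [_ KT K0]]] := tz.
have z0 : zeta 0 = 0 by apply: K0 => /KT; rewrite /= in_itv/= ltxx.
have zT : zeta T = 0 by apply: K0 => /KT; rewrite /= in_itv/= ltxx andbF.
have := hamilton (lexx 0) T_gt0 (lexx T) vV sz z0 zT.
rewrite /is_first_variation.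
pose c := inner_H (D v) (D v); pose k := (2 * pi)^-1 : R.
(* The coefficients of alpha, ..., alpha^4 in the integrand. *)
pose q1 t := derive1 zeta t * g1 t + zeta t * (g2 t - g4 t - pi^-1 * g6 t).
pose q2 t := derive1 zeta t ^+ 2 * (2^-1 * inner_H v v)
  + zeta t ^+ 2 * (- (2^-1 * elastic v v) - k * (c * g7 t + g8 t)).
pose q3 t := zeta t ^+ 3 * (- (k * c) * g5 t).
pose q4 t := zeta t ^+ 4 * (- (k * 4^-1 * c ^+ 2)).
have zmul b n g : test_function 0 T b -> itg IT g -> itg IT (fun t => b t ^+ n * g t).
  by move=> tb gi; have [h1 h2] := test_pow n tb; exact: itg_mul_cont.
have zmul1 b g : test_function 0 T b -> itg IT g -> itg IT (fun t => b t * g t).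
  by move=> tb gi; exact: (zmul b 1%N g tb gi).
have ci e : itg IT (fun=> e) by apply: itg_cst => //; exact: lebesgue_itv_lty.
have q1i : itg IT q1.
  apply: itgD => //; first exact: zmul1.
  by apply: zmul1 => //; apply: itgB => //; [exact: itgB|exact: itgZ].
have q2i : itg IT q2.
  apply: itgD => //; first by apply: zmul => //; exact: ci.
  have h := itgB mT (ci (- (2^-1 * elastic v v))) (itgZ k mT (itgD mT (itgZ c mT g7i) g8i)).
  exact: zmul 2 _ tz h.
have q3i : itg IT q3 by apply: zmul => //; exact: itgZ.
have q4i : itg IT q4 by apply: zmul => //; exact: ci.
have closed f : \int[mu]_(t in `[0, T]) f t = \int[mu]_(t in IT) f t.
  exact: (Rintegral_bnd 0 T true false f).
pose I1 := \int[mu]_(t in IT) q1 t; pose I2 := \int[mu]_(t in IT) q2 t.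
pose I3 := \int[mu]_(t in IT) q3 t; pose I4 := \int[mu]_(t in IT) q4 t.
have [ytH _ _] := yt_H; have [pH _ _] := p_H.
have expand alpha : \int[mu]_(t in `[0, T])
      (lagrangian m x theta beta (p t) (y t + (alpha * zeta t) *: v)
                             (yt t + (alpha * derive1 zeta t) *: v) -
       lagrangian m x theta beta (p t) (y t) (yt t)) =
    alpha * I1 + (alpha ^+ 2 * I2 + (alpha ^+ 3 * I3 + alpha ^+ 4 * I4)).
  rewrite closed.
  transitivity (\int[mu]_(t in IT) (alpha * q1 t + (alpha ^+ 2 * q2 t + (alpha ^+ 3 * q3 t + alpha ^+ 4 * q4 t)))).
    apply: eq_Rintegral_ae.
    have H := ae_and g7E (ae_and g8E (ae_and ae_in_V (ae_and ytH pH))).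
    have := ae_and g1E (ae_and g2E (ae_and g4E (ae_and g5E (ae_and g6E H)))).
    apply: filterS => t [e1 [e2 [e4 [e5 [e6 [e7 [e8 [yV [ytH' pH']]]]]]]]] tT.
    rewrite lagrangian_expand//; [|exact: pH'|exact: yV|exact: ytH'].
    rewrite /q1 /q2 /q3 /q4 -e1// -e2// -e4// -e5// -e6// -e7// -e8// /k /axial -/c.
    have pi0 : (pi : R) != 0 by rewrite gt_eqF// pi_gt0.
    move: (inner_H (yt t) v) (inner_H v v) (elastic (y t) v) (elastic v v) (norm_H (D (y t)))
      (inner_H (D (y t)) (D v)) (inner_H (p t) v) => a1 a2 a3 a4 a5 a6 a7.
    move: (pi : R) pi0 => Pi Pi0; move: (derive1 zeta t) (zeta t) (c) => dz z e.
    by field.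
  have q34 := itgD mT (itgZ (alpha ^+ 3) mT q3i) (itgZ (alpha ^+ 4) mT q4i).
  have q234 := itgD mT (itgZ (alpha ^+ 2) mT q2i) q34.
  have q1' := itgZ alpha mT q1i; have q2' := itgZ (alpha ^+ 2) mT q2i.
  have q3' := itgZ (alpha ^+ 3) mT q3i; have q4' := itgZ (alpha ^+ 4) mT q4i.
  rewrite (@RintegralD _ _ _ mu IT _ _ mT q1' q234) (@RintegralD _ _ _ mu IT _ _ mT q2' q34).
  rewrite (@RintegralD _ _ _ mu IT _ _ mT q3' q4').
  rewrite (@RintegralZl _ _ _ mu IT _ alpha mT q1i) (@RintegralZl _ _ _ mu IT _ (alpha ^+ 2) mT q2i).
  by rewrite (@RintegralZl _ _ _ mu IT _ (alpha ^+ 3) mT q3i) (@RintegralZl _ _ _ mu IT _ (alpha ^+ 4) mT q4i).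
set damp := cd * _.
have damp_eq : damp = cd * \int[mu]_(t in IT) (zeta t * g1 t).
  rewrite /damp closed ipE; congr (_ * _); apply: eq_Rintegral_ae.
  by apply: filterS g1E => t h /h ->; rewrite mulrC.
rewrite -damp_eq -/q1 -/I1 => lim0.
have lim1 : (fun alpha : R => I1 + (alpha * I2 + (alpha ^+ 2 * I3 + alpha ^+ 3 * I4)) - damp) @ 0^'+ --> I1 - damp.
  apply: cvg_at_right_filter.
  have -> : I1 - damp = I1 + (0 * I2 + (0 ^+ 2 * I3 + 0 ^+ 3 * I4)) - damp.
    by rewrite !expr0n/= !mul0r !addr0.
  apply: cvgB; last exact: cvg_cst.
  apply: cvgD; first exact: cvg_cst.
  apply: cvgD; first by apply: cvgM; [exact: cvg_id|exact: cvg_cst].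
  by apply: cvgD; apply: cvgM; do ?[exact: cvg_cst|apply: cvg_pow; exact: cvg_id].
apply: (@cvg_unique _ (@Rhausdorff R) _ _ _ _ lim1) => //=.
apply: cvg_trans lim0; apply: near_eq_cvg; near=> alpha.
have a0 : alpha != 0 by rewrite gt_eqF//; near: alpha; exact: nbhs_right_gt.
by rewrite /= expand; field.
Unshelve. all: end_near. Qed.

(** The equation tested against v, for a state (u, w), a load q and an inertia F. *)
Definition residual (F : (R -> R) -> R) (u w q v : R -> R) : R :=
  F v + elastic u v + pi^-1 * (axial u * inner_H (D u) (D v)) + cd * inner_H w v - inner_H q v.

(** [weak_equation] for all test functions zeta, where the integral of
    zeta' (yt, v) is minus that of zeta ytt(v). *)
Lemma equation_along v : in_V v ->
  {ae mu, forall t, IT t -> residual (ytt t) (y t) (yt t) (p t) v = 0}.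
Proof.
move=> vV; have vH := in_V_H vV.
have mT : measurable IT by exact: measurable_itv.
have [ytH _ _] := yt_H; have [pH _ _] := p_H; have [yttV _ _] := ytt_V'.
have [g1 g1i g1E] := inner_yt_itg vH.
have [g2 g2i g2E] : exists2 g, itg IT g & {ae mu, forall t, IT t -> inner_H (p t) v = g t}.
  apply: (bochner_L2_integrable in_H0 in_H_lin norm_H_ge0 norm_H_lin p_H (inner_H_cont vH) (C := norm_H v)).
  apply: filterS pH => t h /h pH'; rewrite (le_trans (cauchy_schwarz_H pH' vH))// mulrC.
  by rewrite ler_wpM2l ?norm_H_ge0// le_1_sqr.
have cV : norm_continuous in_V' norm_V' (fun F => F v).
  apply: (bounded_continuous in_V'_lin norm_V'_ge0 (C := norm_V v)) => [k F G FV GV|F FV].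
    by [].
  by rewrite mulrC V'_le.
have [g3 g3i g3E] : exists2 g, itg IT g & {ae mu, forall t, IT t -> ytt t v = g t}.
  apply: (bochner_L2_integrable in_V'0 in_V'_lin norm_V'_ge0 norm_V'_lin ytt_V' cV (C := norm_V v)).
  apply: filterS yttV => t h /h yttV'; rewrite (le_trans (V'_le yttV' vV))// mulrC.
  by rewrite ler_wpM2l ?norm_V_ge0// le_1_sqr.
have [g4 g4i g4E] : exists2 g, itg IT g & {ae mu, forall t, IT t -> elastic (y t) v = g t}.
  apply: (y_itg (C := elastic_cst theta * norm_V v) (elastic_cont vV)); apply: aeW => t _ tV.
  rewrite (le_trans (elastic_le theta tV vV))// mulrAC.
  by rewrite le_lin_sqr// mulr_ge0 ?elastic_cst_ge0 ?norm_V_ge0.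
have C0 := poincare_cst_ge0; have CD0 : 0 <= poincare_cst * norm_H (D v).
  by rewrite mulr_ge0 ?norm_H_ge0.
have [g5 g5i g5E] : exists2 g, itg IT g &
    {ae mu, forall t, IT t -> inner_H (D (y t)) (D v) = g t}.
  apply: (y_itg (C := poincare_cst * norm_H (D v)) (innerD_cont vV)); apply: aeW => t _ tV.
  by rewrite (le_trans (innerD_le tV vV))// le_lin_sqr.
have [g6 g6i g6E] := axial_innerD_y_itg vV; have [g7 g7i g7E] := axial_y_itg.
have [g8 g8i g8E] : exists2 g, itg IT g &
    {ae mu, forall t, IT t -> inner_H (D (y t)) (D v) ^+ 2 = g t}.
  have c2 : norm_continuous in_V norm_V (fun u => inner_H (D u) (D v) ^+ 2).
    by move=> u_ u Su_ Su c; apply: cvg_pow; exact: innerD_cont c.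
  apply: (y_itg (C := (poincare_cst * norm_H (D v)) ^+ 2) c2).
  apply: aeW => t _ tV; rewrite normrX.
  apply: (@le_trans _ _ ((poincare_cst * norm_H (D v) * norm_V (y t)) ^+ 2)).
    by rewrite lerXn2r ?nnegrE ?innerD_le// mulr_ge0// norm_V_ge0.
  by rewrite exprMn ler_wpM2l ?sqr_ge0// lerDr.
have W : weak_derivative 0 T g1 g3.
  have := @time_derivative_weak _ _ in_V' norm_V' in_V'0 in_V'_lin norm_V'_ge0 T
    (fun t => embed_H m x (yt t)) ytt (fun F => F v) (norm_V v) _ _ _ _ yt_ytt.
  rewrite /embed_H ipE => H; apply: (eq_weak_derivative g1E g3E); apply: H.
  - by apply: filterS ytH => t h /h ytH'; have := embed_in_V' ytH'; rewrite /embed_H ipE.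
  - by apply: filterS yttV => t h /h.
  - by [].
  - by move=> F FV; rewrite mulrC V'_le.
pose g t := g3 t + (- 1 * (g2 t - g4 t - pi^-1 * g6 t) + cd * g1 t).
have h1 := itgB mT (itgB mT g2i g4i) (itgZ pi^-1 mT g6i).
have gi : itg IT g by exact: (itgD mT g3i (itgD mT (itgZ (- 1) mT h1) (itgZ cd mT g1i))).
have g0 : {ae mu, forall s, IT s -> g s = 0}.
  apply: fundamental_lemma gi _ => phi tphi.
  have E := weak_equation vV tphi g1i g1E g2i g2E g4i g4E g5i g5E g6i g6E g7i g7E g8i g8E.
  have W' := W phi tphi.
  have a1 := itg_mul_test g1i (test_derive1 tphi); have a3 := itg_mul_test g3i tphi.
  have ah := itg_mul_test h1 tphi; have b1 := itg_mul_test g1i tphi.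
  have b1' := itgZ cd mT b1; have ah' := itgZ (- 1) mT ah.
  have Eq : \int[mu]_(s in IT) (derive1 phi s * g1 s + phi s * (g2 s - g4 s - pi^-1 * g6 s)) =
      \int[mu]_(s in IT) (g1 s * derive1 phi s) + \int[mu]_(s in IT) ((g2 s - g4 s - pi^-1 * g6 s) * phi s).
    rewrite -(@RintegralD _ _ _ mu IT _ _ mT a1 ah); apply: eq_Rintegral => s _.
    by rewrite mulrC; congr (_ + _); rewrite mulrC.
  have Ec : \int[mu]_(s in IT) (phi s * g1 s) = \int[mu]_(s in IT) (g1 s * phi s).
    by apply: eq_Rintegral => s _; rewrite mulrC.
  rewrite Eq W' Ec in E.
  have -> : \int[mu]_(s in IT) (g s * phi s) = \int[mu]_(s in IT) (g3 s * phi s +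
      (- 1 * ((g2 s - g4 s - pi^-1 * g6 s) * phi s) + cd * (g1 s * phi s))).
    by apply: eq_Rintegral => s _; rewrite /g; ring.
  rewrite (@RintegralD _ _ _ mu IT _ _ mT a3 (itgD mT ah' b1')) (@RintegralD _ _ _ mu IT _ _ mT ah' b1').
  rewrite (@RintegralZl _ _ _ mu IT _ (- 1) mT ah) (@RintegralZl _ _ _ mu IT _ cd mT b1).
  by move: E; lra.
have H := ae_and g4E (ae_and g6E g0); have := ae_and g1E (ae_and g2E (ae_and g3E H)).
apply: filterS => t [e1 [e2 [e3 [e4 [e6 e0]]]]] tT.
by have := e0 tT; rewrite /residual e1// e2// e3// e4// e6// /g => <-; ring.
Qed.

Lemma innerD_le2 u v : in_V u -> in_V v ->
  `|inner_H (D u) (D v)| <= poincare_cst * poincare_cst * norm_V u * norm_V v.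
Proof.
move=> uV vV; rewrite (le_trans (innerD_le uV vV))//.
have := ler_wpM2l (mulr_ge0 poincare_cst_ge0 (norm_V_ge0 u)) (norm_D_le vV).
by rewrite mulrAC => /le_trans -> //; rewrite le_eqVlt; apply/orP; left; apply/eqP; ring.
Qed.

(** The modulus of continuity of the residual in its four arguments. *)
Definition residual_dist (F F' : (R -> R) -> R) (u u' w w' q q' : R -> R) : R :=
  norm_V' (F' - F) + elastic_cst theta * norm_V (u' - u) +
  pi^-1 * (poincare_cst * poincare_cst) *
    (`|axial u' - axial u| * norm_V u' + `|axial u| * norm_V (u' - u)) +
  `|cd| * embed_cst * norm_H (w' - w) + embed_cst * norm_H (q' - q).

(** The terms other than the axial one are bilinear; the difference of the axial terms is
    split as (N' - N) (u', v') + N (u' - u, v'), with N the axial factor, by inserting the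
    mixed product. *)
Lemma residual_le (F F' : (R -> R) -> R) (u u' w w' q q' v : R -> R) :
  in_V' F -> in_V' F' -> in_V u -> in_V u' -> in_H w -> in_H w' -> in_H q -> in_H q' -> in_V v ->
  `|residual F' u' w' q' v - residual F u w q v| <= residual_dist F F' u u' w w' q q' * norm_V v.
Proof.
move=> FV FV' uV uV' wH wH' qH qH' vV.
have subE (E : lmodType R) (S : set E) (l : E -> R) (a b : E) :
    (forall (k : R) a b, S a -> S b -> l (k *: a + b) = k * l a + l b) ->
    S a -> S b -> l (b - a) = l b - l a.
  by move=> llin Sa Sb; have := llin (- 1) a b Sa Sb; rewrite scaleN1r addrC => ->; ring.
have duV := S_sub in_V_lin uV' uV; have dwH := S_sub in_H_lin wH' wH.
have dqH := S_sub in_H_lin qH' qH; have dFV := S_sub in_V'_lin FV' FV.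
have vH := in_V_H vV.
have e2 := subE _ in_V (fun u => elastic u v) u u' (fun k a b aV bV => elastic_lin theta k aV bV vV) uV uV'.
have e3 := subE _ in_V (fun u => inner_H (D u) (D v)) u u' (fun k a b aV bV => innerD_lin k aV bV vV) uV uV'.
have e4 := subE _ in_H (fun u => inner_H u v) w w' (fun k a b aV bV => inner_H_lin k aV bV vH) wH wH'.
have e5 := subE _ in_H (fun u => inner_H u v) q q' (fun k a b aV bV => inner_H_lin k aV bV vH) qH qH'.
have -> : residual F' u' w' q' v - residual F u w q v =
    (F' - F) v + elastic (u' - u) v +
    pi^-1 * ((axial u' - axial u) * inner_H (D u') (D v) + axial u * inner_H (D (u' - u)) (D v))
    + cd * inner_H (w' - w) v - inner_H (q' - q) v.
  by rewrite e2 e3 e4 e5 [(F' - F) v](_ : _ = F' v - F v)// /residual; ring.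
have pi0 : 0 <= (pi : R)^-1 by rewrite invr_ge0 pi_ge0.
have b1 := V'_le dFV vV; have b2 := elastic_le theta duV vV.
have b3 := ler_wpM2l (normr_ge0 (axial u' - axial u)) (innerD_le2 uV' vV).
have b4 := ler_wpM2l (normr_ge0 (axial u)) (innerD_le2 duV vV).
have b5 := ler_wpM2l (normr_ge0 cd) (inner_H_le dwH vV).
have b6 := inner_H_le dqH vV.
have b34 := ler_wpM2l pi0 (lerD b3 b4).
have -> : residual_dist F F' u u' w w' q q' * norm_V v = norm_V' (F' - F) * norm_V v +
    elastic_cst theta * norm_V (u' - u) * norm_V v +
    pi^-1 * (`|axial u' - axial u| * (poincare_cst * poincare_cst * norm_V u' * norm_V v) +
      `|axial u| * (poincare_cst * poincare_cst * norm_V (u' - u) * norm_V v)) +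
    `|cd| * (embed_cst * norm_H (w' - w) * norm_V v) + embed_cst * norm_H (q' - q) * norm_V v.
  by rewrite /residual_dist; ring.
rewrite (le_trans (ler_normB _ _))// lerD// (le_trans (ler_normD _ _))// lerD//; last by rewrite normrM.
rewrite (le_trans (ler_normD _ _))// lerD//; first by rewrite (le_trans (ler_normD _ _))// lerD.
rewrite normrM (ger0_norm pi0) (le_trans _ b34)// ler_wpM2l// (le_trans (ler_normD _ _))//.
by rewrite !normrM.
Qed.

Lemma residual_scal F u w q k v : in_V' F -> in_V u -> in_H w -> in_H q -> in_V v ->
  residual F u w q (k *: v) = k * residual F u w q v.
Proof.
move=> FV uV wH qH vV; have vH := in_V_H vV.
have H (E : lmodType R) (S : set E) (l : E -> R) (a : E) : S 0 ->
    (forall (k : R) a b, S a -> S b -> l (k *: a + b) = k * l a + l b) ->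
    S a -> l (k *: a) = k * l a.
  move=> S0 llin Sa; have := llin (- 1) 0 0 S0 S0; have := llin k a 0 Sa S0.
  by rewrite scaler0 !addr0; lra.
rewrite /residual (V'_scal k FV vV).
rewrite (elastic_sym theta u (k *: v)) (H _ in_V (fun v => elastic v u) v in_V0 (fun k a b aV bV => elastic_lin theta k aV bV uV) vV).
rewrite (inner_H_sym (D u)) (H _ in_V (fun v => inner_H (D v) (D u)) v in_V0 (fun k a b aV bV => innerD_lin k aV bV uV) vV).
rewrite (inner_H_sym w) (H _ in_H (fun v => inner_H v w) v in_H0 (fun k a b aV bV => inner_H_lin k aV bV wH) vH).
rewrite (inner_H_sym q) (H _ in_H (fun v => inner_H v q) v in_H0 (fun k a b aV bV => inner_H_lin k aV bV qH) vH).
by rewrite (elastic_sym theta v u) (inner_H_sym (D v)) (inner_H_sym v w) (inner_H_sym v q); ring.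
Qed.

(** [vanish_ae_uniformly] for the residual at the values of the simple functions
    that approximate y, yt, ytt and p. *)
Lemma equation_ae :
  {ae mu, forall t, IT t -> forall v, in_V v -> residual (ytt t) (y t) (yt t) (p t) v = 0}.
Proof.
have [yV [hy hyE] _] := y_V; have [wH [hw hwE] _] := yt_H.
have [FV [hF hFE] _] := ytt_V'; have [qH [hq hqE] _] := p_H.
pose K n : finType := (pattern (hF n) * pattern (hy n) * pattern (hw n) * pattern (hq n))%type.
pose G n (k : K n) :=
  residual (sf_value k.1.1.1) (sf_value k.1.1.2) (sf_value k.1.2) (sf_value k.2).
apply: (@vanish_ae_uniformly K G) => [v vV|]; first exact: equation_along.
have := ae_and yV (ae_and wH (ae_and FV (ae_and qH (ae_and hyE (ae_and hwE (ae_and hFE hqE)))))).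
apply: filterS => t [h1 [h2 [h3 [h4 [h5 [h6 [h7 h8]]]]]]] tT.
have ytV := h1 tT; have wtH := h2 tT; have FtV := h3 tT; have qtH := h4 tT.
split; first by move=> k v vV; exact: residual_scal.
exists (fun n => (sf_pattern (hF n) t, sf_pattern (hy n) t, sf_pattern (hw n) t, sf_pattern (hq n) t)).
have hyV n : in_V (sf_eval (hy n) t) by exact: (sf_eval_in in_V0 in_V_lin).
have hwH n : in_H (sf_eval (hw n) t) by exact: (sf_eval_in in_H0 in_H_lin).
have hFV n : in_V' (sf_eval (hF n) t) by exact: (sf_eval_in in_V'0 in_V'_lin).
have hqH n : in_H (sf_eval (hq n) t) by exact: (sf_eval_in in_H0 in_H_lin).
exists (fun n => residual_dist (ytt t) (sf_eval (hF n) t) (y t) (sf_eval (hy n) t)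
  (yt t) (sf_eval (hw n) t) (p t) (sf_eval (hq n) t)); split; last first.
  by move=> n v vV; rewrite /G /= -!sf_evalE; exact: residual_le.
rewrite /residual_dist.
have cN := @norm_continuousN _ _ in_V norm_V in_V_lin norm_V_ge0 norm_V_lin _ _ hyV ytV (h5 tT).
have cA := axial_cont hyV ytV (h5 tT).
have cA0 : `|axial (sf_eval (hy n) t) - axial (y t)| @[n --> \oo] --> (0 : R).
  have c0 : axial (sf_eval (hy n) t) - axial (y t) @[n --> \oo] --> (0 : R).
    have -> : (0 : R) = axial (y t) - axial (y t) by rewrite subrr.
    by apply: cvgB cA _; exact: cvg_cst.
  by rewrite -[X in _ --> X](@normr0 R R); exact: cvg_norm c0.
have -> : (0 : R) = 0 + elastic_cst theta * 0 + pi^-1 * (poincare_cst * poincare_cst) *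
    (0 * norm_V (y t) + `|axial (y t)| * 0) + `|cd| * embed_cst * 0 + embed_cst * 0.
  by ring.
have H c (f : nat -> R) : f n @[n --> \oo] --> (0 : R) -> c * f n @[n --> \oo] --> (c * 0 : R).
  by move=> f0; apply: cvgM f0; exact: cvg_cst.
apply: cvgD; last by apply: H; exact: (h8 tT).
apply: cvgD; last by apply: H; exact: (h6 tT).
apply: cvgD.
  by apply: cvgD; [exact: (h7 tT)|apply: H; exact: (h5 tT)].
apply: cvgM; first exact: cvg_cst.
by apply: cvgD; [exact: cvgM|apply: H; exact: (h5 tT)].
Qed.

End Hamilton.

End Evolution.

End Arch.

(** * From Hamilton's principle to the equation of motion *)
Theorem mainTheorem3 (R : realType) (T : R) (m : nat) (x theta : nat -> R)
  (cd beta : R) (p y yt : R -> R -> R) (ytt : R -> (R -> R) -> R)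
  (T_gt0 : 0 < T)
  (x_first : x 0%N = 0) (x_last : x m.+1 = pi)
  (x_incr : forall i, (i <= m)%N -> x i < x i.+1)
  (theta_gt0 : forall i, (1 <= i <= m)%N -> 0 < theta i)
  (cd_ge0 : 0 <= cd)
  (p_L2 : bochner_L2 (in_H m x) (norm_H m x) T p)
  (y_W : in_W m x T y yt ytt)
  (y_hamilton : extended_hamilton m x theta T beta cd p y yt) :
  (\forall t \ae (@lebesgue_measure R), t \in `[0, T] ->
     eq_V' m x
       (ytt t + opA m x theta (y t)
        - (pi^-1 * (beta + 2^-1 * norm_H m x (pw_deriv m x (y t)) ^+ 2)) *:
            (embed_H m x (pw_deriv m x (pw_deriv m x (y t)))
             + \sum_(1 <= i < m.+1)
                 jump (pw_deriv m x (y t)) (x i) *: delta (x i))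
        + cd *: embed_H m x (yt t))
       (embed_H m x (p t))) /\
  ((\forall t \ae (@lebesgue_measure R), t \in `[0, T] ->
      in_DA m x theta (y t)) ->
   \forall t \ae (@lebesgue_measure R), t \in `[0, T] ->
     eq_V' m x
       (ytt t + embed_H m x (iter 4 (pw_deriv m x) (y t))
        - (pi^-1 * (beta + 2^-1 * \int[@lebesgue_measure R]_(s in `]0, pi[)
                                     `|pw_deriv m x (y t) s| ^+ 2)) *:
            (embed_H m x (pw_deriv m x (pw_deriv m x (y t)))
             + \sum_(1 <= i < m.+1)
                 (theta i * right_trace (pw_deriv m x (pw_deriv m x (y t))) (x i))
                   *: delta (x i))
        + cd *: embed_H m x (yt t))
       (embed_H m x (p t))).
Proof.
move: y_W; rewrite /in_W nHE nVE => -[y_V yt_H ytt_V' y_yt yt_ytt]; rewrite nHE in p_L2.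
have weak := equation_ae x_first x_last x_incr T_gt0 y_V yt_H y_yt p_L2 ytt_V' yt_ytt y_hamilton.
have state : {ae @lebesgue_measure R, forall t, t \in `[0, T] -> in_V m x (y t) /\
    forall v, in_V m x v -> residual m x theta cd beta (ytt t) (y t) (yt t) (p t) v = 0}.
  have [yV _ _] := y_V.
  have := ae_and (ae_and (ae_set1 0) (ae_set1 T)) (ae_and yV weak).
  apply: filterS => t [[t0 tT] [tV tE]] tI.
  have {}tI : t \in `]0, T[.
    move: tI; rewrite !in_itv/= => /andP[t_ge0 t_leT].
    by rewrite !lt_neqAle t_ge0 t_leT eq_sym !andbT; apply/andP; split; apply/eqP.
  by split; [exact: tV|exact: tE].
have apply_at (F1 F2 F3 F4 F5 : (R -> R) -> R) (c d : R) v :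
    (F1 + F2 - c *: (F3 + F4) + d *: F5) v = F1 v + F2 v - c * (F3 + F4) v + d * F5 v by [].
rewrite dvE jpE; split.
  apply: filterS state => t H /H [tV tE] v vV.
  rewrite apply_at axial_pairing// opAE /embed_H ipE.
  by move: (tE v vV); rewrite /residual /axial; lra.
move=> yDA; have := ae_and state yDA; apply: filterS => t [H1 H2] tT v vV.
have [tV tE] := H1 tT; have [_ [f fH uf]] := H2 tT.
have {}uf w : in_V m x w -> elastic m x theta (y t) w = ip m x f w.
  by move=> wV; have := uf w wV; rewrite opAE /embed_H ipE.
have -> : \sum_(1 <= i < m.+1)
      (theta i * right_trace (dv m x (dv m x (y t))) (x i)) *: delta (x i) =
    \sum_(1 <= i < m.+1) jp (dv m x (y t)) (x i) *: delta (x i).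
  apply: eq_big_nat => i im.
  by rewrite (jump_condition x_first x_last x_incr theta_gt0 tV fH uf).
rewrite apply_at axial_pairing// /embed_H ipE.
have -> : ip m x (iter 4 (dv m x) (y t)) v = elastic m x theta (y t) v.
  rewrite uf//; apply: inner_H_ae => //; last exact: aeW.
  exact: (fourth_derivative x_first x_last x_incr tV fH uf).
have -> : \int[@lebesgue_measure R]_(s in `]0, pi[) `|dv m x (y t) s| ^+ 2 =
    nH m x (dv m x (y t)) ^+ 2.
  rewrite norm_H_sqr inner_HE//; try exact: in_V_DH tV.
  by apply: eq_Rintegral => s _; rewrite real_normK ?num_real// expr2.
by move: (tE v vV); rewrite /residual /axial; lra.
Qed.
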